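(* Let $\{\rho_k^2(\alpha),P_k(\alpha)\}$ and $\{\rho_k^2,P_k\}$ denote the eigenvalues and corresponding eigenprojection operators of $T(\alpha)T^*(\alpha)$ and $TT^*$, respectively. Then, as $\alpha\downarrow0$, $$0\le\rho_k^2(\alpha)\uparrow\rho_k^2\le1\qquad\text{for all }k\ge1,$$ and $$\|P_k(\alpha)-P_k\|\le\|P_k(\alpha)-P_k\|_{HS}\to0 .$$
   Context: Setting. $E\subseteq\mathbb R$, $\nu$ is a $\sigma$-finite measure on $E$, $\mathcal H=L^2(E,\nu)$, $X$ is a mean-zero random element of $\mathcal H$ with $\mathrm E\|X\|^4_{\mathcal H}<\infty$ and covariance operator $S=\mathrm E[X\otimes X]$, where $(f\otimes g)h=\langle f,h\rangle g$. $\mathcal H=\mathcal H_1\oplus\mathcal H_2$ with $\mathcal H_1\perp\mathcal H_2$ closed subspaces and orthogonal projections $\Upsilon_1,\Upsilon_2$; $X_i=\Upsilon_iX$, $S_i=\Upsilon_iS\Upsilon_i$ (on $\mathcal H_i$, injective), $S_{12}=\Upsilon_1S\Upsilon_2:\mathcal H_2\to\mathcal H_1$. $\{\phi_{ij}\}_j$ is an orthonormal basis of $\mathcal H_i$ of eigenvectors of $S_i$ with eigenvalues $\lambda_{i1}\ge\lambda_{i2}\ge\cdots>0$. Let $\gamma_{jk}=\mathrm E[\langle X_1,\phi_{1j}\rangle\langle X_2,\phi_{2k}\rangle]$. RKHS. $\mathcal H(K_i)$ is the reproducing kernel Hilbert space of the covariance kernel $K_i$ of $X_i$: as a set it is $\operatorname{Im}(S_i^{1/2})$,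 with $\|f\|^2_{\mathcal H(K_i)}=\sum_j\langle f,\phi_{ij}\rangle^2/\lambda_{ij}$. $\Gamma_i:\mathcal H_i\to\mathcal H(K_i)$, $\Gamma_ig=\sum_j\sqrt{\lambda_{ij}}\langle g,\phi_{ij}\rangle\phi_{ij}$, is unitary. Operators. $T:\mathcal H(K_2)\to\mathcal H(K_1)$ is $(T\tilde g)(s)=\langle K_{12}(s,\cdot),\tilde g\rangle_{\mathcal H(K_2)}$ with $K_{12}(s,t)=\mathrm E[X_1(s)X_2(t)]$; equivalently $T=\Gamma_1C\Gamma_2^{-1}$, where $C:\mathcal H_2\to\mathcal H_1$ is the bounded operator with $\langle C\phi_{2k},\phi_{1j}\rangle=\gamma_{jk}/\sqrt{\lambda_{1j}\lambda_{2k}}$. $T$ is assumed to admit a singular value decomposition $T=\sum_k\rho_k\,\tilde g_k\otimes_{\mathcal H(K_2)}\tilde f_k$ (so $T$ is compact). For $\alpha>0$, $T(\alpha)=\Gamma_1(S_1+\alpha I)^{-1/2}S_{12}(S_2+\alpha I)^{-1/2}\Gamma_2^{-1}$, a Hilbert–Schmidt operator. Notation. $\rho_k^2(\alpha)$ and $\rho_k^2$ are the $k$-th eigenvalues, in decreasing order, of $T(\alpha)T^*(\alpha)$ and $TT^*$; $P_k(\alpha)$ is the orthogonal projection in $\mathcal H(K_1)$ onto the eigenspace of $T(\alpha)T^*(\alpha)$ for $\rho_k^2(\alpha)$, and $P_k$ the orthogonal projection onto the eigenspace of $TT^*$ for $\rho_k^2$. $\|\cdot\|$ and $\|\cdot\|_{HS}$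 are the operator and Hilbert–Schmidt norms on $\mathcal H(K_1)$.
   Formalization: The claim ‖P_k(α)−P_k‖_HS→0 fails if a multiple ρ_k² splits for small α; it is proved when ρ_j²=ρ_k² implies ρ_j²(α)=ρ_k²(α) for small α, and unconditionally when P_k(α) projects onto the sum of the eigenspaces of all ρ_j²(α) with ρ_j²=ρ_k². *)

(* Defs.v *)
From HB Require Import structures.
From mathcomp Require Import all_boot all_order all_algebra.
From mathcomp Require Import all_classical all_reals all_analysis.
Import Order.TTheory GRing.Theory Num.Theory.
Import numFieldNormedType.Exports.
Set Implicit Arguments.
Unset Strict Implicit.
Unset Printing Implicit Defensive.
Local Open Scope classical_set_scope.
Local Open Scope quotient_scope.
Local Open Scope ring_scope.

Section L2.
Context {d} {T : measurableType d} {R : realType}.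
Variable mu : {measure set T -> \bar R}.

(* The library's LspaceType, L^p modulo a.e. equality, carries no algebraic
   structure, so L^2 is rebuilt as a quotient of the lmodType LfunType. *)
Local Notation Lfun2 := (LfunType mu (lee1n 2)).

Definition ae_null : {pred Lfun2} := fun f => `[< f = cst 0 %[ae mu] >].

Lemma ae_null_zmod_closed : zmod_closed ae_null.
Proof.
split; first by apply/asboolP; apply: nearW.
move=> f g /asboolP f0 /asboolP g0; apply/asboolP.
apply: filterS2 f0 g0 => x /(_ I) /= fx /(_ I) /= gx _.
by change (f x - g x = 0); rewrite fx gx subr0.
Qed.

HB.instance Definition _ :=
  GRing.isZmodClosed.Build Lfun2 ae_null ae_null_zmod_closed.

Lemma ae_nullZ (a : R) (f : Lfun2) : f \in ae_null -> a *: f \in ae_null.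
Proof.
move=> /asboolP f0; apply/asboolP; apply: filterS f0 => x /(_ I) /= fx _.
by change (a * f x = 0); rewrite fx mulr0.
Qed.

Definition L2 : Type := Quotient.quot ae_null.
HB.instance Definition _ := GRing.Zmodule.on L2.

Definition L2_scale (a : R) (f : L2) : L2 := \pi_L2 (a *: (repr f : Lfun2)).

Lemma L2_piD (f g : Lfun2) : \pi_L2 (f + g) = \pi_L2 f + \pi_L2 g.
Proof. by rewrite /L2 piE. Qed.

Lemma L2_piZ a (f : Lfun2) : L2_scale a (\pi_L2 f) = \pi_L2 (a *: f).
Proof.
apply/eqP; rewrite /L2_scale -Quotient.idealrBE -scalerBr; apply: ae_nullZ.
by rewrite Quotient.idealrBE reprK.
Qed.

Lemma L2_scaleA a b f : L2_scale a (L2_scale b f) = L2_scale (a * b) f.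
Proof. by elim/quotW: f => f; rewrite [L2_scale b _]L2_piZ !L2_piZ scalerA. Qed.

Lemma L2_scale1 : left_id 1 L2_scale.
Proof. by elim/quotW => f; rewrite L2_piZ scale1r. Qed.

Lemma L2_scaleDr : right_distributive L2_scale +%R.
Proof.
move=> a; elim/quotW => f; elim/quotW => g.
by rewrite -L2_piD !L2_piZ scalerDr L2_piD.
Qed.

Lemma L2_scaleDl f : {morph L2_scale^~ f : a b / a + b}.
Proof. by elim/quotW: f => f a b; rewrite !L2_piZ scalerDl L2_piD. Qed.

HB.instance Definition _ :=
  GRing.Zmodule_isLmodule.Build R L2 L2_scaleA L2_scale1 L2_scaleDr L2_scaleDl.

Definition L2_dot (f g : L2) : R :=
  \int[mu]_x ((repr f : Lfun2) x * (repr g : Lfun2) x).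
End L2.

Notation L2on nu mE := (L2 (mrestr nu mE)).

Section InnerProductSpaces.
Context {R : realType} {V : lmodType R}.

(* An inner product space whose underlying space is a subspace of V. The axioms
   are not fields: they hold in every instance considered. This format allows a
   closed subspace of L^2 and an RKHS, which has another inner product, to share
   the same ambient vectors. Operators are total functions V -> V, meaningful
   only on the underlying space of their domain. *)
Record ipspace := IPSpace { ips : set V ; ip : V -> V -> R }.

Implicit Types (H K : ipspace) (A B : V -> V) (J : set nat) (e u : nat -> V).

Definition ipnorm H (f : V) : R := Num.sqrt (ip H f f).

Definition ipopen H (U : set V) : Prop :=
  forall f, U f -> exists2 r : R, 0 < r & forall g, ipnorm H (g - f) < r -> U g.

Definition closed_subspace H (M : set V) : Prop :=
  [/\ M `<=` ips H, M 0, forall a f g, M f -> M g -> M (a *: f + g) &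
      forall f, ips H f ->
        (forall r : R, 0 < r -> exists2 g, M g & ipnorm H (g - f) < r) -> M f].

Definition restrict_ip H (M : set V) : ipspace := IPSpace M (ip H).

(* s = \sum_(j in J) u j, with convergence in the norm of H *)
Definition sums_to H J u (s : V) : Prop :=
  ipnorm H (\sum_(0 <= j < n | j \in J) u j - s) @[n --> \oo] --> 0.

Definition orthonormal_on H J e : Prop :=
  (forall j, J j -> ips H (e j)) /\
  (forall j k, J j -> J k -> ip H (e j) (e k) = (j == k)%:R).

Definition orthonormal_basis H J e : Prop :=
  orthonormal_on H J e /\
  forall f, ips H f -> sums_to H J (fun j => ip H f (e j) *: e j) f.

Definition bounded_linear H K A : Prop :=
  [/\ forall f, ips H f -> ips K (A f),
      forall a f g, ips H f -> ips H g -> A (a *: f + g) = a *: A f + A g &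
      exists c : R, forall f, ips H f -> ipnorm K (A f) <= c * ipnorm H f].

(* B = A^* for A : H -> K *)
Definition adjoint_op H K A B : Prop :=
  (forall g, ips K g -> ips H (B g)) /\
  (forall f g, ips H f -> ips K g -> ip K (A f) g = ip H f (B g)).

(* B = A^{-1} for A : H -> K *)
Definition inverse_op H K A B : Prop :=
  [/\ forall f, ips H f -> ips K (A f) /\ B (A f) = f &
      forall g, ips K g -> ips H (B g) /\ A (B g) = g].

(* B = A^{1/2}: the bounded, self-adjoint, nonnegative square root *)
Definition sqrt_op H A B : Prop :=
  [/\ bounded_linear H H B, adjoint_op H H B B,
      forall f, ips H f -> 0 <= ip H (B f) f &
      forall f, ips H f -> B (B f) = A f].

(* B = A^{-1/2} *)
Definition invsqrt_op H A B : Prop :=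
  exists2 A', inverse_op H H A A' & sqrt_op H A' B.

Definition orthproj H (M : set V) P : Prop :=
  forall f, ips H f -> M (P f) /\ forall g, M g -> ip H (f - P f) g = 0.

Definition opnorm H A : \bar R :=
  ereal_sup [set (ipnorm H (A f))%:E | f in [set f | ips H f /\ ipnorm H f <= 1]].

(* (J, e) is meant to be an orthonormal basis of H, on which the value does not
   depend *)
Definition hsnorm H J e A : \bar R :=
  sqrte (\sum_(0 <= j <oo | j \in J) (ipnorm H (A (e j)) ^+ 2)%:E)%E.

Definition eigenspace_op H A (c : R) : set V :=
  [set f | ips H f /\ A f = c *: f].

(* The k.+1-th largest eigenvalue of A, counted with multiplicity (so k = 0 is
   the largest): the largest c such that A has k.+1 orthonormal eigenvectors with
   eigenvalues at least c. It is meant for compact nonnegative A; it is 0 when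
   dim H <= k. *)
Definition eigval H A (k : nat) : R :=
  sup [set c : R | exists e, orthonormal_on H `I_k.+1 e /\
    forall i, (i < k.+1)%N -> exists2 c', c <= c' & A (e i) = c' *: e i].

(* \sum_(j in I) (eigenspace of A for mu j) *)
Definition eigenspace_sum H A (mu : nat -> R) (I : set nat) : set V :=
  [set f | exists n (j : 'I_n -> nat) (g : 'I_n -> V),
    (forall i, I (j i) /\ eigenspace_op H A (mu (j i)) (g i)) /\
    f = \sum_(i < n) g i].

(* A : H -> K is \sum_k sigma_k <., g_k>_H f_k with singular values decreasing to
   0, indexed from 0 and padded with zeros when the rank is finite *)
Definition svd H K A (sigma : nat -> R) (g f : nat -> V) : Prop :=
  [/\ forall k, 0 <= sigma k.+1 <= sigma k, sigma @ \oo --> 0,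
      orthonormal_on H [set k | 0 < sigma k] g,
      orthonormal_on K [set k | 0 < sigma k] f &
      forall h, ips H h ->
        sums_to K [set k | 0 < sigma k] (fun k => (sigma k * ip H h (g k)) *: f k)
          (A h)].

(* J is either nat or an initial segment of it, according to dim H *)
Definition eigenbasis H A J phi (lam : nat -> R) : Prop :=
  [/\ forall j k, J k -> (j <= k)%N -> J j, orthonormal_basis H J phi,
      forall j, J j -> A (phi j) = lam j *: phi j,
      forall j, J j -> 0 < lam j &
      forall j k, J k -> (j <= k)%N -> lam k <= lam j].

(* H(K_i): the image of H under Shalf = S_i^{1/2}, with inner product
   \sum_j <f, phi_j> <g, phi_j> / lam_j *)
Definition rkhs H (Shalf : V -> V) J phi (lam : nat -> R) : ipspace :=
  IPSpace (Shalf @` ips H)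
    (fun f g => limn (fun n =>
       \sum_(0 <= j < n | j \in J) (ip H f (phi j) * ip H g (phi j) / lam j))).

Definition Gamma_op H J phi (lam : nat -> R) (G : V -> V) : Prop :=
  forall g, ips H g ->
    sums_to H J (fun j => (Num.sqrt (lam j) * ip H g (phi j)) *: phi j) (G g).

Section Random.
Context {d : measure_display} {Omega : measurableType d}.
Variable P : probability Omega R.

Definition random_element H (X : Omega -> V) : Prop :=
  (forall w, ips H (X w)) /\ (forall U, ipopen H U -> measurable (X @^-1` U)).

(* m = E[Y]: the mean element, characterized by <m, f> = E<Y, f> for all f *)
Definition mean_element H (Y : Omega -> V) (m : V) : Prop :=
  ips H m /\
  forall f, ips H f -> (ip H m f)%:E = 'E_P[fun w => ip H (Y w) f]%E.

(* S = E[X (x) X], where (X (x) X) h = <X, h> X *)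
Definition covariance_op H (X : Omega -> V) (S : V -> V) : Prop :=
  forall h, ips H h -> mean_element H (fun w => ip H (X w) h *: X w) (S h).

End Random.
End InnerProductSpaces.
Arguments ipspace {R} V.

Section L2space.
Context {d : measure_display} {T : measurableType d} {R : realType}.

Definition L2space (mu : {measure set T -> \bar R}) : ipspace (L2 mu) :=
  IPSpace setT (@L2_dot _ _ _ mu).

End L2space.

(* Main.v *)
Require Import Defs.
From HB Require Import structures.
From mathcomp Require Import all_boot all_order all_algebra.
From mathcomp Require Import all_classical all_reals all_analysis.
From mathcomp Require Import measurable_realfun ring lra.
Import Order.TTheory GRing.Theory Num.Theory.
Import numFieldNormedType.Exports.
Set Implicit Arguments.
Unset Strict Implicit.
Unset Printing Implicit Defensive.
Local Open Scope classical_set_scope.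
Local Open Scope ring_scope.

(* In the orthonormal bases psi_ij = Gamma_i phi_ij of H(K_i), T(alpha) = D_1 T D_2
   where D_i is diagonal with entries sqrt(lambda / (lambda + alpha)): a contraction
   that increases strongly to the identity as alpha decreases to 0. The min-max
   principle then makes the eigenvalues of T(alpha) T(alpha)^* monotone in alpha and
   bounded by those of T T^*, and T has norm at most 1 by Cauchy-Schwarz for the form
   <S u, v>, which the normalization by sqrt lambda turns into the identity on both
   factors. Since T(alpha) T(alpha)^* -> T T^* strongly, the min-max principle on the
   span of the top eigenvectors of T T^* gives the convergence of the eigenvalues.
   For the eigenprojections, let e be an eigenvector of T T^* for r, and Q_alpha the
   projection onto the eigenvectors of T(alpha) T(alpha)^* whose eigenvalues tend
   to r; the others stay at a distance delta > 0 from r, so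
     delta |e - Q_alpha e| <= |(T(alpha) T(alpha)^* - r) e| -> 0,
   and |Q_alpha - Q|_HS^2 = 2 sum_l |e_l - Q_alpha e_l|^2 for projections of the same
   finite rank. The eigenvectors of T(alpha) T(alpha)^* exist because its quadratic
   form attains its maximum on the unit ball, by weak compactness; this is where
   the completeness of L^2 is needed. *)

(** * Inner product spaces *)

Section InnerSpace.
Context {R : realType} {V : lmodType R}.

(** Strong convergence of T(alpha) T(alpha)^* by itself bounds the limiting eigenvalues only from
    below. The matching upper bound is the domination <T(alpha) T(alpha)^* x, x> <= <T T^* D_1 x,
    D_1 x>, valid for every alpha > 0; it also keeps the eigenvalues that lie below a cluster away
    from it. Two features of the eigenprojections shape the rest. A multiple eigenvalue of T T^* may
    be approached by distinct eigenvalues of T(alpha) T(alpha)^*, so the natural object is the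
    projection onto the whole cluster; the eigenspace of a single eigenvalue is treated under the
    condition that the cluster does not split. And the eigenvalue 0 may have an infinite-dimensional
    eigenspace: its projection is handled as the complement of one of finite rank, and that rank is
    the same for all small alpha. Compactness is used as a bound on quadratic forms, which T(alpha)
    inherits from T by the same domination. Since [eigval] is a supremum over systems of
    eigenvectors, that a positive one is attained has to be proved before it can be used. *)

Record inner_space (K : ipspace V) : Prop := InnerSpace {
  ips0 : ips K 0;
  ipsL : forall a f g, ips K f -> ips K g -> ips K (a *: f + g);
  ipC : forall f g, ips K f -> ips K g -> ip K f g = ip K g f;
  ipL : forall a f g h, ips K f -> ips K g -> ips K h ->
    ip K (a *: f + g) h = a * ip K f h + ip K g h;
  ip_ge0 : forall f, ips K f -> 0 <= ip K f f;
  ip_eq0 : forall f, ips K f -> ip K f f = 0 -> f = 0 }.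

Context (K : ipspace V) (HK : inner_space K).
Implicit Types (x y z : V) (a b : R).

Lemma ipsD x y : ips K x -> ips K y -> ips K (x + y).
Proof. by move=> ? ?; rewrite -[x]scale1r; exact: ipsL. Qed.

Lemma ipsZ a x : ips K x -> ips K (a *: x).
Proof. by move=> ?; rewrite -[_ *: _]addr0; apply: ipsL => //; exact: ips0. Qed.

Lemma ipsN x : ips K x -> ips K (- x).
Proof. by rewrite -scaleN1r; exact: ipsZ. Qed.

Lemma ips_sum (I : Type) (r : seq I) (P : pred I) (F : I -> V) :
  (forall i, P i -> ips K (F i)) -> ips K (\sum_(i <- r | P i) F i).
Proof. by move=> PF; elim/big_ind: _ => //; [exact: ips0|exact: ipsD]. Qed.

Lemma ipDl x y z : ips K x -> ips K y -> ips K z ->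
  ip K (x + y) z = ip K x z + ip K y z.
Proof. by move=> ? ? ?; rewrite -[x in LHS]scale1r ipL// mul1r. Qed.

Lemma ip0l z : ips K z -> ip K 0 z = 0.
Proof.
move=> Kz; have K0 := ips0 HK.
by have := ipDl K0 K0 Kz; rewrite addr0; lra.
Qed.

Lemma ipZl a x z : ips K x -> ips K z -> ip K (a *: x) z = a * ip K x z.
Proof.
move=> Kx Kz; rewrite -[_ *: _]addr0 ipL//; last exact: ips0.
by rewrite ip0l// addr0.
Qed.

Lemma ipNl x z : ips K x -> ips K z -> ip K (- x) z = - ip K x z.
Proof. by move=> Kx Kz; rewrite -scaleN1r ipZl// mulN1r. Qed.

Lemma ipBl x y z : ips K x -> ips K y -> ips K z ->
  ip K (x - y) z = ip K x z - ip K y z.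
Proof. by move=> ? ? ?; rewrite ipDl ?ipNl//; exact: ipsN. Qed.

Lemma ip_suml (I : Type) (r : seq I) (P : pred I) (F : I -> V) z :
  (forall i, P i -> ips K (F i)) -> ips K z ->
  ip K (\sum_(i <- r | P i) F i) z = \sum_(i <- r | P i) ip K (F i) z.
Proof.
move=> PF Kz; elim: r => [|i r IH]; first by rewrite !big_nil ip0l.
by rewrite !big_cons; case: ifP => Pi //; rewrite ipDl ?IH//; [exact: PF|exact: ips_sum].
Qed.

Lemma ipDr x y z : ips K x -> ips K y -> ips K z ->
  ip K z (x + y) = ip K z x + ip K z y.
Proof. by move=> Kx Ky Kz; rewrite ipC ?ipDl// 1?[ip K x z]ipC 1?[ip K y z]ipC//; exact: ipsD. Qed.

Lemma ipZr a x z : ips K x -> ips K z -> ip K z (a *: x) = a * ip K z x.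
Proof. by move=> Kx Kz; rewrite ipC ?ipZl// 1?[ip K x z]ipC//; exact: ipsZ. Qed.

Lemma ip0r z : ips K z -> ip K z 0 = 0.
Proof. by move=> Kz; rewrite ipC ?ip0l//; exact: ips0. Qed.

Lemma ipNr x z : ips K x -> ips K z -> ip K z (- x) = - ip K z x.
Proof. by move=> Kx Kz; rewrite -scaleN1r ipZr// mulN1r. Qed.

Lemma ipBr x y z : ips K x -> ips K y -> ips K z ->
  ip K z (x - y) = ip K z x - ip K z y.
Proof. by move=> ? ? ?; rewrite ipDr ?ipNr//; exact: ipsN. Qed.

Lemma ip_sumr (I : Type) (r : seq I) (P : pred I) (F : I -> V) z :
  (forall i, P i -> ips K (F i)) -> ips K z ->
  ip K z (\sum_(i <- r | P i) F i) = \sum_(i <- r | P i) ip K z (F i).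
Proof.
move=> PF Kz; rewrite ipC ?ip_suml//; last exact: ips_sum.
by apply: eq_bigr => i Pi; rewrite ipC//; exact: PF.
Qed.

Definition linear_on (A : V -> V) : Prop :=
  forall a f g, ips K f -> ips K g -> A (a *: f + g) = a *: A f + A g.

Lemma linear_on0 (A : V -> V) : linear_on A -> A 0 = 0.
Proof.
move=> AL; have := AL (-1) _ _ (ips0 HK) (ips0 HK).
by rewrite scaler0 addr0 scaleN1r addNr.
Qed.

Lemma linear_onZ (A : V -> V) a x : linear_on A -> ips K x -> A (a *: x) = a *: A x.
Proof. by move=> AL Kx; have := AL a _ _ Kx (ips0 HK); rewrite (linear_on0 AL) !addr0. Qed.

Lemma linear_onD (A : V -> V) x y : linear_on A -> ips K x -> ips K y -> A (x + y) = A x + A y.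
Proof. by move=> AL Kx Ky; rewrite -[x in LHS]scale1r AL// scale1r. Qed.

Lemma linear_onB (A : V -> V) x y : linear_on A -> ips K x -> ips K y -> A (x - y) = A x - A y.
Proof. by move=> AL Kx Ky; rewrite addrC -scaleN1r AL// scaleN1r addrC. Qed.

Lemma linear_on_sum (A : V -> V) (I : Type) (r : seq I) (P : pred I) (t : I -> R) (F : I -> V) :
  linear_on A -> (forall i, P i -> ips K (F i)) ->
  A (\sum_(i <- r | P i) t i *: F i) = \sum_(i <- r | P i) t i *: A (F i).
Proof.
move=> AL PF; elim: r => [|i r IH]; first by rewrite !big_nil (linear_on0 AL).
rewrite !big_cons; case: ifPn => // Pi; rewrite AL ?IH//; first exact: PF.
by apply: ips_sum => l /PF; exact: ipsZ.
Qed.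

End InnerSpace.

Create HintDb ips.
#[export] Hint Resolve ips0 ipsD ipsZ ipsN ips_sum : ips.
Ltac in_ips := solve [auto 20 with ips].

(** The quadratic is evaluated at its minimizer [- b / c]; for [c = 0] it is affine and takes the
    value -1 unless [b = 0]. It serves both Cauchy-Schwarz and the eigenvector equation of a
    maximizer. *)
Lemma discr_le0 (R : realType) (a b c : R) : 0 <= c ->
  (forall t, 0 <= a + 2 * t * b + t ^+ 2 * c) -> b ^+ 2 <= a * c.
Proof.
rewrite le_eqVlt => /predU1P[<-|c0] q0.
  rewrite mulr0; have [->|b0] := eqVneq b 0; first by rewrite expr0n.
  have := q0 (- (a + 1) / (2 * b)).
  suff -> : a + 2 * (- (a + 1) / (2 * b)) * b + (- (a + 1) / (2 * b)) ^+ 2 * 0 = -1 :> R by lra.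
  by field.
have := q0 (- b / c).
have -> : a + 2 * (- b / c) * b + (- b / c) ^+ 2 * c = (a * c - b ^+ 2) / c.
  by field; rewrite gt_eqF.
by rewrite pmulr_lge0 ?invr_gt0// subr_ge0.
Qed.

Section Norm.
Context {R : realType} {V : lmodType R} (K : ipspace V) (HK : inner_space K).
Implicit Types (x y z : V) (a b : R).

Lemma ip_addE x y : ips K x -> ips K y ->
  ip K (x + y) (x + y) = ip K x x + 2 * ip K x y + ip K y y.
Proof.
move=> Kx Ky; rewrite ipDl// ?ipDr//; try in_ips.
by rewrite [ip K y x]ipC//; ring.
Qed.

Lemma ip_subE x y : ips K x -> ips K y ->
  ip K (x - y) (x - y) = ip K x x - 2 * ip K x y + ip K y y.
Proof.
move=> Kx Ky; rewrite ip_addE//; try in_ips.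
by rewrite !ipNr// ?ipNl//; try in_ips; ring.
Qed.

(** Cauchy-Schwarz for a form that may be degenerate: the identity gives the usual inequality, and
    the covariance operator gives the bound 1 on the norm of T. *)
Lemma form_CS (A : V -> V) :
  linear_on K A -> (forall f, ips K f -> ips K (A f)) ->
  (forall f g, ips K f -> ips K g -> ip K (A f) g = ip K f (A g)) ->
  (forall f, ips K f -> 0 <= ip K (A f) f) ->
  forall x y, ips K x -> ips K y ->
    ip K (A x) y ^+ 2 <= ip K (A x) x * ip K (A y) y.
Proof.
move=> AL KA AC A0 x y Kx Ky; apply: discr_le0 => [|t]; first exact: A0.
have := A0 (t *: y + x); rewrite AL// ipDl//; try in_ips.
rewrite ipDr ?[ip K (A x) (_ + _)]ipDr ?ipZl ?ipZr//; try in_ips.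
rewrite [ip K (A y) x]AC// [ip K y (A x)]ipC//; try in_ips.
move=> /(_ _)/le_trans; apply; first by in_ips.
by rewrite le_eqVlt; apply/orP; left; apply/eqP; ring.
Qed.

Lemma ip_CS x y : ips K x -> ips K y -> ip K x y ^+ 2 <= ip K x x * ip K y y.
Proof. by move=> Kx Ky; apply: (@form_CS id) => // *; exact: ip_ge0. Qed.

Lemma ipnorm_ge0 x : 0 <= ipnorm K x.
Proof. exact: sqrtr_ge0. Qed.

Lemma sqr_ipnorm x : ips K x -> ipnorm K x ^+ 2 = ip K x x.
Proof. by move=> Kx; rewrite sqr_sqrtr//; exact: ip_ge0. Qed.

Lemma ipnorm0 : ipnorm K 0 = 0.
Proof. by rewrite /ipnorm ip0l ?sqrtr0//; in_ips. Qed.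

Lemma ipnormZ a x : ips K x -> ipnorm K (a *: x) = `|a| * ipnorm K x.
Proof.
move=> Kx; rewrite /ipnorm ipZl// ?ipZr//; try in_ips.
by rewrite mulrA -expr2 sqrtrM ?sqr_ge0// sqrtr_sqr.
Qed.

Lemma ipnormN x : ips K x -> ipnorm K (- x) = ipnorm K x.
Proof. by move=> Kx; rewrite -scaleN1r ipnormZ// normrN1 mul1r. Qed.

Lemma ipnormB x y : ips K x -> ips K y -> ipnorm K (x - y) = ipnorm K (y - x).
Proof. by move=> Kx Ky; rewrite -opprB ipnormN//; in_ips. Qed.

Lemma ip_le_norm x y : ips K x -> ips K y -> `|ip K x y| <= ipnorm K x * ipnorm K y.
Proof.
move=> Kx Ky; rewrite -sqrtr_sqr -sqrtrM ?ip_ge0//.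
by rewrite ler_wsqrtr//; exact: ip_CS.
Qed.

Lemma ipnormD x y : ips K x -> ips K y -> ipnorm K (x + y) <= ipnorm K x + ipnorm K y.
Proof.
move=> Kx Ky; rewrite -ler_sqr ?nnegrE ?addr_ge0 ?ipnorm_ge0//.
rewrite sqr_ipnorm ?ip_addE//; try in_ips.
rewrite sqrrD !sqr_ipnorm//.
have := le_trans (ler_norm _) (ip_le_norm Kx Ky).
by set a := ip K x y; set b := _ * _; lra.
Qed.

Lemma ipnorm_sum (I : Type) (r : seq I) (P : pred I) (F : I -> V) :
  (forall i, P i -> ips K (F i)) ->
  ipnorm K (\sum_(i <- r | P i) F i) <= \sum_(i <- r | P i) ipnorm K (F i).
Proof.
move=> PF; elim: r => [|i r IH]; first by rewrite !big_nil ipnorm0.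
rewrite !big_cons; case: ifP => Pi //; apply: le_trans (ipnormD _ _) _ => //; try in_ips.
by rewrite lerD2l.
Qed.

Lemma ipnorm_le a x : ips K x -> 0 <= a -> ip K x x <= a ^+ 2 -> ipnorm K x <= a.
Proof. by move=> Kx a0 xa; rewrite -ler_sqr ?nnegrE ?ipnorm_ge0// sqr_ipnorm. Qed.

Lemma ip_eq x y : ips K x -> ips K y -> (forall z, ips K z -> ip K x z = ip K y z) -> x = y.
Proof.
move=> Kx Ky xy; apply/eqP; rewrite -subr_eq0; apply/eqP/(ip_eq0 HK); first by in_ips.
by rewrite ipBl ?xy ?subrr//; in_ips.
Qed.

End Norm.

(** * Finite orthonormal sums and Bessel's inequality *)

Section Orthonormal.
Context {R : realType} {V : lmodType R} (K : ipspace V) (HK : inner_space K).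
Context (J : set nat) (e : nat -> V) (Je : orthonormal_on K J e).
Implicit Types (x y z : V) (t : nat -> R).

Let Ke j : J j -> ips K (e j). Proof. exact: Je.1. Qed.

Lemma ons_ip1 (r : seq nat) (P : pred nat) t j : uniq r ->
  (forall i, P i -> J i) -> J j ->
  ip K (\sum_(i <- r | P i) t i *: e i) (e j) = if (j \in r) && P j then t j else 0.
Proof.
move=> ur PJ Jj; rewrite ip_suml//; [|by move=> i /PJ/Ke; in_ips|exact: Ke].
rewrite (eq_bigr (fun i => if i == j then t i else 0)); last first.
  move=> i /PJ Ji; rewrite ipZl ?Je.2//; try exact: Ke.
  by case: eqP => _; rewrite ?mulr1 ?mulr0.
rewrite -big_mkcondr/=; case: ifPn => [/andP[jr Pj]|].
  rewrite big_mkcond (bigD1_seq j)//= eqxx Pj big1 ?addr0// => i.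
  by move=> /negPf ->; rewrite andbF.
rewrite negb_and => jP; rewrite big_seq_cond big1// => i.
by move=> /and3P[ir Pi /eqP ij]; move: jP; rewrite -ij ir Pi.
Qed.

Lemma ons_ip_sum (r : seq nat) (P : pred nat) t x : uniq r ->
  (forall i, P i -> J i) -> ips K x ->
  ip K (\sum_(i <- r | P i) t i *: e i) x = \sum_(i <- r | P i) t i * ip K x (e i).
Proof.
move=> ur PJ Kx; rewrite ip_suml//; last by move=> i /PJ/Ke; in_ips.
by apply: eq_bigr => i /PJ/Ke Kei; rewrite ipZl// [ip K (e i) x]ipC.
Qed.

Lemma ons_ip_sums (r : seq nat) (P : pred nat) t s : uniq r ->
  (forall i, P i -> J i) ->
  ip K (\sum_(i <- r | P i) t i *: e i) (\sum_(i <- r | P i) s i *: e i) =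
  \sum_(i <- r | P i) t i * s i.
Proof.
move=> ur PJ; rewrite ons_ip_sum//; last by apply: ips_sum => // i /PJ/Ke; in_ips.
rewrite big_seq_cond [RHS]big_seq_cond; apply: eq_bigr => i /andP[ir Pi].
by rewrite ons_ip1 ?ir ?Pi//; exact: PJ.
Qed.

Lemma ips_ons (r : seq nat) (P : pred nat) t :
  (forall i, P i -> J i) -> ips K (\sum_(i <- r | P i) t i *: e i).
Proof. by move=> PJ; apply: ips_sum => // i /PJ/Ke; in_ips. Qed.

Lemma bessel_eq (r : seq nat) (P : pred nat) x : uniq r ->
  (forall i, P i -> J i) -> ips K x ->
  ip K (x - \sum_(i <- r | P i) ip K x (e i) *: e i)
       (x - \sum_(i <- r | P i) ip K x (e i) *: e i) =
  ip K x x - \sum_(i <- r | P i) ip K x (e i) ^+ 2.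
Proof.
move=> ur PJ Kx; have KS := ips_ons r (fun i => ip K x (e i)) PJ.
rewrite ip_subE// ons_ip_sums// ipC// ons_ip_sum//.
by under eq_bigr do rewrite -expr2; ring.
Qed.

Lemma bessel (r : seq nat) (P : pred nat) x : uniq r ->
  (forall i, P i -> J i) -> ips K x ->
  \sum_(i <- r | P i) ip K x (e i) ^+ 2 <= ip K x x.
Proof.
move=> ur PJ Kx; rewrite -subr_ge0 -bessel_eq// ip_ge0//.
by have := ips_ons r (fun i => ip K x (e i)) PJ; in_ips.
Qed.

End Orthonormal.

(** * Limits of real functions along filters *)

Lemma cvg_squeeze0 (R : realType) (T : Type) (F : set_system T) {FF : Filter F}
    (f g : T -> R) (l : R) :
  (\near F, `|f F - l| <= g F) -> g @ F --> 0 -> f @ F --> l.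
Proof.
move=> fg /cvgrPdist_le g0; apply/cvgrPdist_le => eps eps0.
apply: filterS2 fg (g0 _ eps0) => t /=; rewrite sub0r normrN distrC => ft.
by apply: le_trans; exact: le_trans (ler_norm _).
Qed.

Lemma cvg_unique_real (R : realType) (T : Type) (F : set_system T) {FF : ProperFilter F}
    (f : T -> R) (a b : R) : f @ F --> a -> f @ F --> b -> a = b.
Proof. exact: (cvg_unique (@norm_hausdorff _ R)). Qed.

Lemma cvg_ext (R : realType) (T : Type) (F : set_system T) (f g : T -> R) (l : R) :
  f =1 g -> f @ F --> l -> g @ F --> l.
Proof. by move=> /funext ->. Qed.

Lemma cvg_le_near (R : realType) (T : Type) (F : set_system T) {FF : ProperFilter F}
    (f : T -> R) (l b : R) :
  f @ F --> l -> F [set t | f t <= b] -> l <= b.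
Proof. by move=> fl fb; apply: cvgr_to_le fl _. Qed.

Lemma cvg_ge_near (R : realType) (T : Type) (F : set_system T) {FF : ProperFilter F}
    (f : T -> R) (l b : R) :
  f @ F --> l -> F [set t | b <= f t] -> b <= l.
Proof. by move=> fl fb; apply: cvgr_to_ge fl _. Qed.

Lemma cvg_sum (R : realType) (T I : Type) (F : set_system T) {FF : Filter F}
    (r : seq I) (P : pred I) (f : I -> T -> R) (l : I -> R) :
  (forall i, P i -> f i @ F --> l i) ->
  \sum_(i <- r | P i) f i t @[t --> F] --> \sum_(i <- r | P i) l i.
Proof.
move=> fl; elim: r => [|i r IH].
  by rewrite big_nil; under eq_cvg do rewrite big_nil; exact: cvg_cst.
rewrite big_cons; under eq_cvg do rewrite big_cons.
by case: ifPn => // Pi; apply: cvgD => //; exact: fl.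
Qed.

Lemma cvg_sqr (R : realType) (T : Type) (F : set_system T) {FF : Filter F}
    (f : T -> R) (a : R) : f @ F --> a -> f t ^+ 2 @[t --> F] --> a ^+ 2.
Proof. by move=> fa; rewrite expr2; exact: (cvgM fa fa). Qed.

Lemma cvg_sum0 (R : realType) (T I : Type) (F : set_system T) {FF : Filter F}
    (r : seq I) (P : pred I) (f : I -> T -> R) :
  (forall i, P i -> f i @ F --> 0) -> \sum_(i <- r | P i) f i t @[t --> F] --> 0.
Proof.
move=> f0; have S0 : \sum_(i <- r | P i) (0 : R) = 0 by rewrite big1.
have : \sum_(i <- r | P i) f i t @[t --> F] --> \sum_(i <- r | P i) (0 : R).
  by apply: cvg_sum => i; exact: f0.
by rewrite S0.
Qed.

(** A compact segment provides a cluster point, and a cluster point of an ultrafilter is a limit.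
    Ultrafilters thus replace the extraction of subsequences. *)
Lemma ultra_cvg_bounded (R : realType) (T : Type) (U : set_system T) (f : T -> R) (M : R) :
  UltraFilter U -> U [set t | `|f t| <= M] -> exists l : R, f @ U --> l.
Proof.
move=> UU UM.
have fUM : U (f @^-1` `[- M, M]%classic).
  by apply: filterS UM => t; rewrite /= in_itv/= ler_norml.
have [l [_ cl]] := segment_compact (fmap_proper_filter f _) fUM.
exists l => N Nl; have [//|UN] := in_ultra_setVsetC (f @^-1` N) UU.
have /cl/(_ Nl)[x []] // : (f @ U) (~` N) by [].
Qed.

(** * Orthonormal bases, Parseval's identity and weak compactness *)

Section Basis.
Context {R : realType} {V : lmodType R} (K : ipspace V) (HK : inner_space K).
Implicit Types (x y z : V).

Lemma ipnorm_cvg_ip (T : Type) (F : set_system T) {FF : Filter F} (u : T -> V) (s z : V) :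
  (forall t, ips K (u t)) -> ips K s -> ips K z ->
  ipnorm K (u t - s) @[t --> F] --> 0 -> ip K (u t) z @[t --> F] --> ip K s z.
Proof.
move=> Ku Ks Kz us; apply: (@cvg_squeeze0 _ _ _ _ _ (fun t => ipnorm K (u t - s) * ipnorm K z)).
  by apply: nearW => t; rewrite -ipBl//; apply: ip_le_norm => //; in_ips.
by rewrite -[X in _ --> X](mul0r (ipnorm K z)); apply: cvgMl.
Qed.

Context (J : set nat) (e : nat -> V).

Section OrthonormalSums.
Hypothesis Je : orthonormal_on K J e.

Let Ke j : J j -> ips K (e j). Proof. exact: Je.1. Qed.

Lemma sums_to_coef (c : nat -> R) s j : J j -> ips K s ->
  sums_to K J (fun i => c i *: e i) s -> ip K s (e j) = c j.
Proof.
move=> Jj Ks cs; have KS n : ips K (\sum_(0 <= i < n | i \in J) c i *: e i).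
  by apply: (ips_ons HK Je) => i /set_mem.
apply: cvg_unique_real (ipnorm_cvg_ip KS Ks (Ke Jj) cs) _.
apply: cvg_near_cst; exists j.+1 => // n /= jn.
rewrite (ons_ip1 HK Je) ?iota_uniq//; last by move=> i /set_mem.
by rewrite mem_index_iota jn mem_set.
Qed.

Lemma sums_to_ip (c : nat -> R) s z : ips K s -> ips K z ->
  sums_to K J (fun i => c i *: e i) s ->
  \sum_(0 <= i < n | i \in J) c i * ip K z (e i) @[n --> \oo] --> ip K s z.
Proof.
move=> Ks Kz cs; have KS n : ips K (\sum_(0 <= i < n | i \in J) c i *: e i).
  by apply: (ips_ons HK Je) => i /set_mem.
apply: cvg_ext (ipnorm_cvg_ip KS Ks Kz cs) => n.
by rewrite (ons_ip_sum HK Je) ?iota_uniq// => i /set_mem.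
Qed.

End OrthonormalSums.

Section OrthonormalBasis.
Hypothesis Kb : orthonormal_basis K J e.

Let Je : orthonormal_on K J e := Kb.1.
Let Ke j : J j -> ips K (e j). Proof. exact: Je.1. Qed.

Definition psum x n : V := \sum_(0 <= j < n | j \in J) ip K x (e j) *: e j.

Lemma ips_psum x n : ips K (psum x n).
Proof. by apply: (ips_ons HK Je) => i /set_mem. Qed.

Lemma psum_cvg x : ips K x -> ipnorm K (psum x n - x) @[n --> \oo] --> 0.
Proof. exact: Kb.2. Qed.

Lemma parseval x z : ips K x -> ips K z ->
  \sum_(0 <= j < n | j \in J) ip K x (e j) * ip K z (e j) @[n --> \oo] --> ip K x z.
Proof. by move=> Kx Kz; apply: (sums_to_ip Je) => //; exact: Kb.2. Qed.

Lemma parseval_le x M : ips K x ->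
  (forall n, \sum_(0 <= j < n | j \in J) ip K x (e j) ^+ 2 <= M) -> ip K x x <= M.
Proof.
move=> Kx xM; apply: (cvgr_to_le (parseval Kx Kx)); apply: nearW => n.
by under eq_bigr do rewrite -expr2.
Qed.

Lemma basis_eq x y : ips K x -> ips K y ->
  (forall j, J j -> ip K x (e j) = ip K y (e j)) -> x = y.
Proof.
move=> Kx Ky xy; apply: (ip_eq HK) => // z Kz.
apply: cvg_unique_real (parseval Kx Kz) _.
apply: cvg_ext (parseval Ky Kz) => n.
by apply: eq_bigr => i /set_mem Ji; rewrite xy.
Qed.

End OrthonormalBasis.

(* The Riesz-Fischer property; it expresses the completeness of K. *)
Definition ell2_complete : Prop := forall (c : nat -> R) (M : R),
  (forall n, \sum_(0 <= j < n | j \in J) c j ^+ 2 <= M) ->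
  exists2 x, ips K x & forall j, J j -> ip K x (e j) = c j.

(** Every coefficient converges along the ultrafilter, all at once and without a diagonal argument;
    Bessel bounds the limits, and the Riesz-Fischer property assembles them into [y]. *)
Lemma ball_weakly_compact (U : set_system V) : orthonormal_basis K J e -> ell2_complete ->
  UltraFilter U -> U [set x | ips K x /\ ip K x x <= 1] ->
  exists y, [/\ ips K y, ip K y y <= 1 &
    forall z, ips K z -> ip K x z @[x --> U] --> ip K y z].
Proof.
move=> Kb Kc UU Uball; have Je := Kb.1.
have Ke j : J j -> ips K (e j) by exact: Je.1.
have bnd z : ips K z -> U [set x | `|ip K x z| <= ipnorm K z].
  move=> Kz; apply: filterS Uball => x [Kx x1] /=.
  apply: le_trans (ip_le_norm HK Kx Kz) _.
  by rewrite ler_piMl ?ipnorm_ge0// (ipnorm_le HK)// expr1n.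
have cvgU j : exists l : R, J j -> ip K x (e j) @[x --> U] --> l.
  have [Jj|nJj] := pselect (J j); last by exists 0.
  by have [l xl] := ultra_cvg_bounded UU (bnd _ (Ke _ Jj)); exists l.
have [c cE] := choice cvgU.
have [|y Ky yc] := Kc c 1.
  move=> n; apply: (@cvg_le_near _ _ U _
    (fun x => \sum_(0 <= j < n | j \in J) ip K x (e j) ^+ 2)).
    apply: cvg_sum => j /set_mem Jj; have := cE _ Jj.
    by move=> /[dup] /cvgM /[apply]; rewrite expr2.
  apply: filterS Uball => x [Kx x1]; apply: le_trans x1.
  by apply: (bessel HK Je); rewrite ?iota_uniq// => j /set_mem.
have y1 : ip K y y <= 1.
  apply: (parseval_le Kb) => // n; apply: (@cvg_le_near _ _ U _
    (fun x => \sum_(0 <= j < n | j \in J) ip K x (e j) ^+ 2)).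
    apply: cvg_sum => j /set_mem Jj; have := cE _ Jj; rewrite yc//.
    by move=> /[dup] /cvgM /[apply]; rewrite expr2.
  apply: filterS Uball => x [Kx x1]; apply: le_trans x1.
  by apply: (bessel HK Je); rewrite ?iota_uniq// => j /set_mem.
(* Replacing [z] by a partial sum costs [eps / 3] uniformly on the unit ball, and leaves finitely
   many coefficients. *)
exists y; split => // z Kz; apply/cvgrPdist_le => eps eps0.
have /cvgrPdist_le/(_ (eps / 3))[|n _ /(_ n (leqnn n))] := psum_cvg Kb Kz; first lra.
rewrite sub0r normrN ger0_norm ?ipnorm_ge0// => zn.
have Kzn := ips_psum Kb z n.
have near_zn x : ips K x -> ip K x x <= 1 -> `|ip K x (psum z n) - ip K x z| <= eps / 3.
  move=> Kx x1; rewrite -ipBr//; apply: le_trans (ip_le_norm HK Kx _) _; first by in_ips.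
  by apply: le_trans zn; rewrite ler_piMl ?ipnorm_ge0// (ipnorm_le HK)// expr1n.
have : ip K x (psum z n) @[x --> U] --> ip K y (psum z n).
  have E x : ips K x -> ip K x (psum z n) =
      \sum_(0 <= j < n | j \in J) ip K z (e j) * ip K x (e j).
    by move=> Kx; rewrite ipC//(ons_ip_sum HK Je) ?iota_uniq// => i /set_mem.
  rewrite E//; apply: cvg_trans (near_eq_cvg _) _; last first.
    apply: cvg_sum => j /set_mem Jj; rewrite yc//.
    apply: cvgM; [exact: cvg_cst|exact: cE].
  by apply: filterS Uball => x [Kx _]; rewrite E.
move=> /cvgrPdist_le/(_ (eps / 3)) H; near=> x.
have [Kx x1] : [set x | ips K x /\ ip K x x <= 1] x by near: x; exact: Uball.
have : `|ip K y (psum z n) - ip K x (psum z n)| <= eps / 3 by near: x; apply: H; lra.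
have := near_zn _ Kx x1; have := near_zn _ Ky y1.
set a := ip K y (psum z n); set b := ip K y z; set c' := ip K x (psum z n).
rewrite !ler_norml => /andP[? ?] /andP[? ?] /andP[? ?]; apply/andP; split; lra.
Unshelve. all: by end_near. Qed.
End Basis.

(** * Spectral theory of compact nonnegative operators *)

Section PositiveOperator.
Context {R : realType} {V : lmodType R}.

(** The normalization 0 <= A <= I keeps the sets whose suprema define [eigval] bounded by 1. *)
Record pos_contraction (K : ipspace V) (A : V -> V) : Prop := PosContraction {
  pc_ips : forall f, ips K f -> ips K (A f);
  pc_lin : linear_on K A;
  pc_sym : forall f g, ips K f -> ips K g -> ip K (A f) g = ip K f (A g);
  pc_ge0 : forall f, ips K f -> 0 <= ip K (A f) f;
  pc_le1 : forall f, ips K f -> ip K (A f) f <= ip K f f }.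

(* Compactness of a nonnegative operator, expressed by its quadratic form: up to
   eps, it is dominated by that of a finite-rank operator. *)
Definition compact_form (K : ipspace V) (A : V -> V) : Prop :=
  forall eps : R, 0 < eps -> exists n (g : nat -> V), (forall i, ips K (g i)) /\
    forall z, ips K z -> ip K (A z) z <= \sum_(i < n) ip K z (g i) ^+ 2 + eps * ip K z z.

Definition orth_below (K : ipspace V) (e : nat -> V) (n : nat) (x : V) : Prop :=
  forall i, (i < n)%N -> ip K x (e i) = 0.

End PositiveOperator.

Section Maximizer.
Context {R : realType} {V : lmodType R} (K : ipspace V) (HK : inner_space K).
Context (J : set nat) (b : nat -> V).
Hypotheses (Kb : orthonormal_basis K J b) (Kc : ell2_complete K J b).
Context (A : V -> V) (HA : pos_contraction K A) (cA : compact_form K A).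
Implicit Types (x y z : V) (e : nat -> V).

Let AK f : ips K f -> ips K (A f). Proof. exact: pc_ips. Qed.

Lemma pc_formD x y : ips K x -> ips K y ->
  ip K (A (x + y)) (x + y) = ip K (A x) x + 2 * ip K (A x) y + ip K (A y) y.
Proof.
move=> Kx Ky; have AD := linear_onD (pc_lin HA) Kx Ky.
rewrite AD ipDl// ?ipDr//; try in_ips.
by rewrite (pc_sym HA Ky Kx) [ip K y _]ipC//; [ring|in_ips].
Qed.

Lemma pc_formZ a x : ips K x -> ip K (A (a *: x)) (a *: x) = a ^+ 2 * ip K (A x) x.
Proof.
move=> Kx; have AZ := linear_onZ HK a (pc_lin HA) Kx.
by rewrite AZ ipZl// ?ipZr//; try in_ips; ring.
Qed.

(* The ball is weakly compact and the form of a compact operator is weakly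
   continuous on it. *)
Lemma form_maximizer n e : (forall i, (i < n)%N -> ips K (e i)) ->
  exists y, [/\ ips K y, ip K y y <= 1, orth_below K e n y &
    forall z, ips K z -> orth_below K e n z -> ip K (A z) z <= ip K (A y) y * ip K z z].
Proof.
move=> Ke; pose W := [set x | [/\ ips K x, ip K x x <= 1 & orth_below K e n x]].
pose q x := ip K (A x) x; pose M := sup (q @` W).
have W0 : W 0.
  by split; [in_ips|rewrite ip0l//; in_ips|move=> i ni; rewrite ip0l//; exact: Ke].
have supq : has_sup (q @` W).
  split; first by exists (q 0), 0.
  by exists 1 => _ [x [Kx x1 _] <-]; apply: le_trans x1; exact: (pc_le1 HA).
(* The sets of near-maximizers form a filter base; an ultrafilter that refines it plays the part of
   a maximizing sequence. *)
pose F := filter_from [set eps : R | 0 < eps] (fun eps => [set x | W x /\ M - eps < q x]).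
have FF : ProperFilter F.
  apply: filter_from_proper => [|eps /= eps0].
    apply: filter_from_filter; first by exists 1 => /=.
    move=> i j /= i0 j0; exists (Num.min i j); first by rewrite /= lt_min i0.
    move=> x [Wx Mx]; split; split=> //; apply: le_lt_trans Mx; rewrite lerD2l lerN2.
      by rewrite ge_min lexx.
    by rewrite ge_min lexx orbT.
  by have [_ [x Wx <-] Mx] := sup_adherent eps0 supq; exists x; split.
have [U [UU FU]] := ultraFilterLemma FF.
have UW : U W by apply: FU; exists 1 => //= x [].
have [|y [Ky y1 yE]] := ball_weakly_compact HK Kb Kc UU.
  by apply: filterS UW => x [].
have Wy : W y.
  split=> // i ni; apply: cvg_unique_real (yE _ (Ke _ ni)) _; apply: cvg_near_cst.
  by apply: filterS UW => x [_ _ ->].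
have My : M <= q y.
  suff H (eps : R) : 0 < eps -> M <= q y + eps by apply/ler_addgt0Pr.
  (* Two vectors of the unit ball are at squared distance at most 4, which costs [4 * (eps / 5)] in
     the compactness bound; being a near-maximizer only up to [eps / 5] costs the last fifth. *)
  move=> eps0; have e5 : 0 < eps / 5 by lra.
  have [m [g [Kg gA]]] := cA e5.
  (* A bound of [q] from above on the ball, from the expansion of the form at [y]. It involves [x]
     through finitely many inner products, hence converges along [U], to [q y + 4 * (eps / 5)]. *)
  pose h x := q y + 2 * (ip K x (A y) - ip K y (A y)) +
              \sum_(i < m) (ip K x (g i) - ip K y (g i)) ^+ 2 + 4 * (eps / 5).
  have hU : h @ U --> q y + 2 * (ip K y (A y) - ip K y (A y)) +
              \sum_(i < m) (ip K y (g i) - ip K y (g i)) ^+ 2 + 4 * (eps / 5).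
    apply: cvgD; last exact: cvg_cst.
    apply: cvgD.
      apply: cvgD; first exact: cvg_cst.
      by apply: cvgM; [exact: cvg_cst|apply: cvgB; [apply: yE; in_ips|exact: cvg_cst]].
    apply: cvg_sum => i _; rewrite expr2.
    by apply: cvgM; (apply: cvgB; [exact: yE|exact: cvg_cst]).
  have MU : U [set x | M - eps / 5 <= h x].
    have : U [set x | W x /\ M - eps / 5 < q x] by apply: FU; exists (eps / 5).
    apply: filterS => x [[Kx x1 _] /ltW] /le_trans; apply.
    have Kxy : ips K (x - y) by in_ips.
    have -> : q x = q y + 2 * ip K (A y) (x - y) + ip K (A (x - y)) (x - y).
      by rewrite -pc_formD// subrKC.
    have gxy : ip K (A (x - y)) (x - y) <=
        \sum_(i < m) (ip K x (g i) - ip K y (g i)) ^+ 2 + eps / 5 * ip K (x - y) (x - y).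
      apply: le_trans (gA _ Kxy) _; rewrite lerD2r le_eqVlt; apply/orP; left; apply/eqP.
      by apply: eq_bigr => i _; rewrite ipBl.
    have xy4 : eps / 5 * ip K (x - y) (x - y) <= eps / 5 * 4.
      rewrite ler_wpM2l//; first exact: ltW.
      have : 0 <= ip K (x + y) (x + y) by apply: ip_ge0 => //; in_ips.
      by rewrite ip_addE// ip_subE//; lra.
    have -> : ip K (A y) (x - y) = ip K x (A y) - ip K y (A y).
      by rewrite ipC// ?ipBl//; in_ips.
    by rewrite /h; lra.
  have H : M - eps / 5 <= q y + 4 * (eps / 5).
    apply: cvg_ge_near MU; apply: cvg_trans hU _.
    by rewrite !subrr big1 ?mulr0 ?addr0// => i _; rewrite subrr expr0n.
  by clear -H; lra.
exists y; split; try by case: Wy.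
move=> z Kz zo; have [z0|z0] := eqVneq z 0.
  by rewrite z0 !ip0r ?mulr0//; in_ips.
have zz : 0 < ip K z z.
  rewrite lt_neqAle ip_ge0// andbT eq_sym; apply/eqP => /(ip_eq0 HK Kz)/eqP.
  by rewrite (negPf z0).
rewrite -ler_pdivrMr//; apply: le_trans My; apply: ub_le_sup; first exact: supq.2.
exists ((Num.sqrt (ip K z z))^-1 *: z); last first.
  by rewrite /q pc_formZ// exprVn sqr_sqrtr ?ltW// mulrC.
split; first by in_ips.
  rewrite ipZl ?ipZr//; try in_ips.
  by rewrite mulrA -expr2 exprVn sqr_sqrtr ?mulVf ?gt_eqF ?(ltW zz).
by move=> i ni; rewrite ipZl ?zo ?mulr0//; exact: Ke.
Qed.

(** As M > 0, comparing [y] with itself gives it norm 1. The residual h = M y - A y is orthogonal to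
    the earlier eigenvectors, so every y + t h is admissible; the form M |z|^2 - <A z, z> is
    nonnegative there and vanishes at [y], and its discriminant forces h = 0. *)
Lemma maximizer_eigen n e (mu : nat -> R) y :
  (forall i, (i < n)%N -> ips K (e i) /\ A (e i) = mu i *: e i) ->
  ips K y -> ip K y y <= 1 -> orth_below K e n y ->
  (forall z, ips K z -> orth_below K e n z -> ip K (A z) z <= ip K (A y) y * ip K z z) ->
  0 < ip K (A y) y -> ip K y y = 1 /\ A y = ip K (A y) y *: y.
Proof.
move=> Ke Ky y1 yo ymax; set M := ip K (A y) y => M0.
have yy : ip K y y = 1.
  apply/eqP; rewrite eq_le y1 /=; have := ymax _ Ky yo.
  by rewrite -/M ler_pMr.
split=> //; pose h := M *: y - A y.
have Kh : ips K h by rewrite /h; in_ips.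
have ho : orth_below K e n h.
  move=> i ni; have [Kei Aei] := Ke _ ni.
  rewrite ipBl ?ipZl//; try in_ips.
  by rewrite (pc_sym HA)// Aei ipZr// yo// !mulr0 subrr.
have : ip K h h ^+ 2 <= 0 * (M * ip K h h - ip K (A h) h).
  apply: discr_le0 => [|t]; first by rewrite subr_ge0; exact: ymax.
  have := ymax (y + t *: h); rewrite pc_formD// ?pc_formZ//; try in_ips.
  rewrite ip_addE// ?[ip K (A y) _]ipZr// ?ipZr ?ipZl//; try in_ips.
  have -> : ip K h h = M * ip K y h - ip K (A y) h.
    by rewrite {1}/h ipBl ?ipZl//; in_ips.
  rewrite -/M yy => /(_ _ _) H; rewrite -subr_ge0 in H.
  apply: le_trans (H _ _) _; try in_ips.
    move=> i ni; have [Kei _] := Ke _ ni.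
    by rewrite ipDl// ?ipZl//; try in_ips; rewrite yo// ho// mulr0 addr0.
  by rewrite le_eqVlt; apply/orP; left; apply/eqP; rewrite /h; ring.
rewrite mul0r => h2; have /eqP : ip K h h ^+ 2 = 0 by apply/le_anti; rewrite h2 sqr_ge0.
by rewrite sqrf_eq0 => /eqP/(ip_eq0 HK Kh)/eqP; rewrite subr_eq0 eq_sym => /eqP.
Qed.

End Maximizer.

(** The dimension count behind the min-max principle: n linear conditions on n + 1 unknowns have a
    nonzero solution, which is then normalized. *)
Lemma ex_orth_coeffs (R : realType) (n : nat) (M : nat -> nat -> R) :
  exists t : nat -> R, \sum_(0 <= i < n.+1 | i \in `I_n.+1) t i ^+ 2 = 1 /\
    forall l, (l < n)%N -> \sum_(0 <= i < n.+1 | i \in `I_n.+1) t i * M i l = 0.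
Proof.
have big_In (f : nat -> R) : \sum_(0 <= i < n.+1 | i \in `I_n.+1) f i = \sum_(i < n.+1) f i.
  by rewrite big_mkord; apply: eq_bigl => i; rewrite mem_set/=.
pose Mx : 'M[R]_(n.+1, n) := \matrix_(i, j) M i j.
have /rowV0Pn[v /sub_kermxP vM v0] : kermx Mx != 0.
  by rewrite -mxrank_eq0 mxrank_ker subn_eq0 -ltnNge ltnS rank_leq_col.
pose s := \sum_(i < n.+1) v 0 i ^+ 2.
have s0 : 0 < s.
  rewrite lt_neqAle sumr_ge0 ?andbT; last by move=> i _; exact: sqr_ge0.
  apply: contra v0 => /eqP/esym/eqP; rewrite psumr_eq0; last by move=> i _; exact: sqr_ge0.
  move=> /allP vi; apply/eqP/rowP => i; rewrite mxE.
  by have := vi i; rewrite mem_index_enum sqrf_eq0 => /(_ isT)/eqP.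
exists (fun i => v 0 (inord i) / Num.sqrt s); split=> [|l ln].
  rewrite big_In; under eq_bigr do rewrite inord_val exprMn exprVn sqr_sqrtr ?ltW//.
  by rewrite -mulr_suml mulfV// gt_eqF.
rewrite big_In; have := congr1 (fun m : 'rV_n => m 0 (Ordinal ln)) vM.
rewrite !mxE => vl; under eq_bigr do rewrite inord_val mulrAC.
rewrite -mulr_suml (_ : \sum_i _ = 0) ?mul0r// -[RHS]vl.
by apply: eq_bigr => i _; rewrite mxE.
Qed.

(** * The min-max principle and the existence of top eigenvectors *)

Section EigvalTheory.
Context {R : realType} {V : lmodType R} (K : ipspace V) (HK : inner_space K).
Context (J : set nat) (b : nat -> V).
Hypotheses (Kb : orthonormal_basis K J b) (Kc : ell2_complete K J b).
Implicit Types (x y z : V) (e : nat -> V) (A : V -> V).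

Definition eigval_set A (k : nat) : set R :=
  [set c : R | exists e, orthonormal_on K `I_k.+1 e /\
    forall i, (i < k.+1)%N -> exists2 c', c <= c' & A (e i) = c' *: e i].

Definition lincomb n (t : nat -> R) e : V := \sum_(0 <= i < n | i \in `I_n) t i *: e i.

Lemma eigvalE A k : eigval K A k = sup (eigval_set A k).
Proof. by []. Qed.

Lemma orthonormal_extend n e y : orthonormal_on K `I_n e -> ips K y -> ip K y y = 1 ->
  orth_below K e n y -> orthonormal_on K `I_n.+1 (fun i => if (i < n)%N then e i else y).
Proof.
move=> [Ke eo] Ky yy yo; split=> [i _|i l /=].
  by case: ifPn => // /Ke.
rewrite ltnS leq_eqVlt => /predU1P[->|ni]; rewrite ltnS leq_eqVlt => /predU1P[->|nl].
- by rewrite !ltnn eqxx.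
- by rewrite ltnn nl ?yo// gtn_eqF.
- by rewrite ltnn ni ipC ?yo//; [rewrite ltn_eqF|exact: Ke].
- by rewrite ni nl; exact: eo.
Qed.

Section OneOperator.
Context (A : V -> V) (HA : pos_contraction K A).

Let AK f : ips K f -> ips K (A f). Proof. exact: pc_ips. Qed.

Lemma eigval_set_le1 k c : eigval_set A k c -> c <= 1.
Proof.
move=> [e [[Ke eo] /(_ 0%N isT)[c' cc' Ae]]]; apply: le_trans cc' _.
have Ke0 : ips K (e 0%N) by exact: Ke.
by have := pc_le1 HA Ke0; rewrite Ae ipZl// eo//= mulr1.
Qed.

Lemma eigval_set0 k c : eigval_set A k c -> eigval_set A k 0.
Proof.
move=> [e [eo Ae]]; exists e; split=> // i ik; have [c' _ Aei] := Ae i ik.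
exists c' => //; have Kei : ips K (e i) by exact: eo.1.
by have := pc_ge0 HA Kei; rewrite Aei ipZl// eo.2//= eqxx mulr1.
Qed.

Lemma eigval_ge c k : eigval_set A k c -> c <= eigval K A k.
Proof. by move=> Ac; apply: ub_le_sup => //; exists 1 => ?; exact: eigval_set_le1. Qed.

Lemma eigval_ge0 k : 0 <= eigval K A k.
Proof.
(* There may be no k + 1 orthonormal eigenvectors, for instance in dimension at most k; the supremum
   of the empty set is 0. *)
rewrite eigvalE; have [->|/set0P[c Ac]] := eqVneq (eigval_set A k) set0.
  by rewrite sup0.
exact/eigval_ge/(eigval_set0 Ac).
Qed.

Lemma eigval_le M k : 0 <= M -> (forall c, eigval_set A k c -> c <= M) -> eigval K A k <= M.
Proof.
move=> M0 AM; rewrite eigvalE; have [->|/set0P A0] := eqVneq (eigval_set A k) set0.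
  by rewrite sup0.
by apply: ge_sup => // c /AM.
Qed.

Lemma eigval_le1 k : eigval K A k <= 1.
Proof. by apply: eigval_le => // c; exact: eigval_set_le1. Qed.

Lemma eigval_nonincr j k : (j <= k)%N -> eigval K A k <= eigval K A j.
Proof.
move=> jk; apply: eigval_le; first exact: eigval_ge0.
move=> c [e [[Ke eo] Ae]]; apply: eigval_ge; exists e; split; [split|].
- by move=> i /= ij; apply: Ke => /=; exact: leq_trans jk.
- by move=> i l /= ij lj; apply: eo => /=; exact: leq_trans jk.
- by move=> i ij; apply: Ae; exact: leq_trans jk.
Qed.

(* The subspace spanned by the w_i meets the preimage by F of the complement of
   the e_l, since it has a greater dimension than their number. *)
Lemma minmax_le (F : V -> V) k (w e : nat -> V) (c M : R) : 0 <= M ->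
  orthonormal_on K `I_k.+1 w ->
  (forall f, ips K f -> ips K (F f)) ->
  linear_on K F ->
  (forall f, ips K f -> ip K (F f) (F f) <= ip K f f) ->
  (forall l, (l < k)%N -> ips K (e l)) ->
  (forall y, ips K y -> orth_below K e k y -> ip K (A y) y <= M * ip K y y) ->
  (forall t : nat -> R, c * ip K (lincomb k.+1 t w) (lincomb k.+1 t w) <=
    ip K (A (F (lincomb k.+1 t w))) (F (lincomb k.+1 t w))) -> c <= M.
Proof.
move=> M0 wo FK FL F1 Ke eM cw.
have Kw i : `I_k.+1 i -> ips K (w i) by exact: wo.1.
have [t [t1 tM]] := ex_orth_coeffs k (fun i l => ip K (F (w i)) (e l)).
have := cw t; rewrite /lincomb; set x := \sum_(0 <= i < k.+1 | _) _ => cx.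
have Kx : ips K x by apply: ips_sum => // l /set_mem/Kw; in_ips.
have xx : ip K x x = 1.
  by rewrite (ons_ip_sums HK wo) ?iota_uniq// => i /set_mem.
have Fxo : orth_below K e k (F x).
  move=> l lk; have Kel := Ke _ lk; rewrite (linear_on_sum HK _ _ FL) ?ip_suml//;
    try by move=> i /set_mem/Kw; in_ips.
  rewrite -[RHS](tM _ lk); apply: eq_bigr => i /set_mem/Kw Kwi.
  by rewrite ipZl//; in_ips.
have := eM _ (FK _ Kx) Fxo; have := F1 _ Kx; move: cx; rewrite xx mulr1.
move=> cAF FF AF; apply: le_trans cAF (le_trans AF _).
by rewrite ler_piMr.
Qed.

Lemma eigval_set_form (e : nat -> V) k c t : orthonormal_on K `I_k.+1 e ->
  (forall i, (i < k.+1)%N -> exists2 c', c <= c' & A (e i) = c' *: e i) ->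
  c * ip K (lincomb k.+1 t e) (lincomb k.+1 t e) <=
  ip K (A (lincomb k.+1 t e)) (lincomb k.+1 t e).
Proof.
move=> eo Ae; rewrite /lincomb.
have Kei i : `I_k.+1 i -> ips K (e i) by exact: eo.1.
have ex_mu i : exists m : R, (i < k.+1)%N -> c <= m /\ A (e i) = m *: e i.
  have [ik|] := boolP (i < k.+1)%N; last by exists 0.
  by have [m] := Ae i ik; exists m.
have [mu muE] := choice ex_mu.
have -> : A (\sum_(0 <= i < k.+1 | i \in `I_k.+1) t i *: e i) =
    \sum_(0 <= i < k.+1 | i \in `I_k.+1) (t i * mu i) *: e i.
  rewrite (linear_on_sum HK _ _ (pc_lin HA)); last by move=> i /set_mem/Kei.
  apply: eq_bigr.
  by move=> i /set_mem/muE[_ ->]; rewrite scalerA.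
have In_eo i : i \in `I_k.+1 -> `I_k.+1 i by move/set_mem.
rewrite !(ons_ip_sums HK eo) ?iota_uniq//.
rewrite mulr_sumr; apply: ler_sum => i /set_mem ik; rewrite mulrAC -expr2 mulrC.
by rewrite ler_wpM2l ?sqr_ge0//; case: (muE _ ik).
Qed.

(** The last clause includes i = n: off the n eigenvectors the form is bounded by the next
    eigenvalue, even when that one is 0 and has no eigenvector in the system. With it a finite
    system stands in for a full spectral decomposition. *)
Definition top_eigensystem n e : Prop :=
  [/\ orthonormal_on K `I_n e,
      forall i, (i < n)%N -> 0 < eigval K A i /\ A (e i) = eigval K A i *: e i &
      forall i, (i <= n)%N -> forall y, ips K y -> orth_below K e i y ->
        ip K (A y) y <= eigval K A i * ip K y y].

Hypothesis cA : compact_form K A.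

(** Let M be the maximum of the form off the earlier eigenvectors. If M > 0, adjoining the maximizer
    gives n + 1 eigenvectors with eigenvalues at least M, so M <= [eigval K A n]; min-max with the
    [e i] as test vectors gives the converse. *)
Lemma next_eigenvector n e : orthonormal_on K `I_n e ->
  (forall i, (i < n)%N -> A (e i) = eigval K A i *: e i) ->
  (forall i, (i < n)%N -> forall y, ips K y -> orth_below K e i y ->
        ip K (A y) y <= eigval K A i * ip K y y) ->
  exists y, [/\ ips K y, orth_below K e n y,
    (forall z, ips K z -> orth_below K e n z -> ip K (A z) z <= eigval K A n * ip K z z) &
    0 < eigval K A n -> ip K y y = 1 /\ A y = eigval K A n *: y].
Proof.
move=> eo Ae etail.
have Ke i : (i < n)%N -> ips K (e i) by exact: eo.1.
have [y [Ky y1 yo ymax]] := form_maximizer HK Kb Kc HA cA Ke.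
have My0 := pc_ge0 HA Ky; set M := ip K (A y) y in ymax My0.
have ME : 0 < M -> ip K y y = 1 /\ A y = M *: y.
  by apply: (maximizer_eigen HK HA (mu := eigval K A) _ Ky y1 yo ymax) => i ni; split; auto.
have MA : M <= eigval K A n.
  move: (My0); rewrite le_eqVlt => /predU1P[<-|M0]; first exact: eigval_ge0.
  have [yy AyM] := ME M0.
  pose e' i := if (i < n)%N then e i else y.
  apply: eigval_ge; exists e'; split; first exact: orthonormal_extend.
  move=> i; rewrite ltnS leq_eqVlt /e' => /predU1P[->|ni]; first by rewrite ltnn; exists M.
  rewrite ni; exists (eigval K A i); last exact: Ae.
    have := etail i ni y Ky; rewrite yy mulr1; apply.
    by move=> l li; apply: yo; exact: ltn_trans ni.
exists y; split => //.
  move=> z Kz zo; apply: le_trans (ymax z Kz zo) _.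
  by rewrite ler_wpM2r// ip_ge0.
suff <- : M = eigval K A n by exact: ME.
apply/le_anti; rewrite MA /=; apply: eigval_le => // c [w [wo Aw]].
apply: (minmax_le (F := id) My0 wo _ _ _ Ke ymax) => //.
by move=> t; exact: eigval_set_form.
Qed.

Lemma top_eigensystem0 e : top_eigensystem 0 e.
Proof.
have e0 : orthonormal_on K `I_0 e by split.
have [|||y [_ _ ytail _]] := @next_eigenvector 0 e => //.
by split=> // i; rewrite leqn0 => /eqP -> z Kz _; apply: ytail.
Qed.

Lemma top_eigensystemS n e : top_eigensystem n e -> 0 < eigval K A n ->
  exists e', top_eigensystem n.+1 e'.
Proof.
move=> [eo Ae etail] en0.
have Ke i : (i < n)%N -> ips K (e i) by exact: eo.1.
have [||y [Ky yo ytail /(_ en0)[yy Ay]]] := next_eigenvector eo.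
- by move=> i /Ae[].
- by move=> i /ltnW; exact: etail.
pose e' i := if (i < n)%N then e i else y.
have e'o : orthonormal_on K `I_n.+1 e' by exact: orthonormal_extend.
have Ae' i : (i < n.+1)%N -> 0 < eigval K A i /\ A (e' i) = eigval K A i *: e' i.
  rewrite ltnS leq_eqVlt /e' => /predU1P[->|ni]; first by rewrite ltnn.
  by rewrite ni; exact: Ae.
have e'tail i : (i < n.+1)%N -> forall z, ips K z -> orth_below K e' i z ->
    ip K (A z) z <= eigval K A i * ip K z z.
  move=> ni z Kz zo; apply: etail => // l li.
  by have := zo l li; rewrite /e' (leq_trans li).
exists e'; split=> // i; rewrite leq_eqVlt => /predU1P[->|]; last exact: e'tail.
(* The tail bound at the new index n + 1 comes from a second application, to the extended system. *)
by have [i' /Ae'[]//|z []] := next_eigenvector e'o _ e'tail.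
Qed.

Lemma ex_top_eigensystem n : (forall i, (i < n)%N -> 0 < eigval K A i) ->
  exists e, top_eigensystem n e.
Proof.
elim: n => [_|n IH en0]; first by exists (fun=> 0); exact: top_eigensystem0.
have [i ni|e /top_eigensystemS] := IH; first by apply: en0; exact: ltnW.
by apply; exact: en0.
Qed.

(** The min-max argument asks for k test vectors, but there may be only m < k positive eigenvalues.
    The system is then padded with zero vectors, to which everything is orthogonal. *)
Lemma eigval_tail k : exists e, (forall l, (l < k)%N -> ips K (e l)) /\
  forall y, ips K y -> orth_below K e k y -> ip K (A y) y <= eigval K A k * ip K y y.
Proof.
suff [m mk [e [[eo _ etail] mek]]] : exists2 m, (m <= k)%N &
    exists e, top_eigensystem m e /\ (m = k \/ eigval K A m = 0).
  exists (fun l => if (l < m)%N then e l else 0); split=> [l lk|y Ky yo].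
    by case: ifP => lm; [exact: eo.1|exact: ips0].
  have : ip K (A y) y <= eigval K A m * ip K y y.
    apply: etail => // l lm; have := yo l (leq_trans lm mk); by rewrite lm.
  case: mek => [->//|->]; rewrite mul0r => /le_trans; apply.
  by rewrite mulr_ge0 ?eigval_ge0// ip_ge0.
elim: k => [|k [m mk [e [te mek]]]].
  by exists 0%N => //; exists (fun=> 0); split; [exact: top_eigensystem0|left].
have [m0|m0] := eqVneq (eigval K A m) 0.
  by exists m; [exact: leq_trans mk _|exists e; split=> //; right].
have [|e' te'] := top_eigensystemS te; first by rewrite lt_neqAle eq_sym m0 eigval_ge0.
case: mek => [mk'|me]; last by rewrite me eqxx in m0.
by exists m.+1; [rewrite mk'|exists e'; split=> //; left; rewrite mk'].
Qed.

Lemma minmax_le_eigval (F : V -> V) k (w : nat -> V) (c : R) :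
  orthonormal_on K `I_k.+1 w ->
  (forall f, ips K f -> ips K (F f)) ->
  linear_on K F ->
  (forall f, ips K f -> ip K (F f) (F f) <= ip K f f) ->
  (forall t : nat -> R, c * ip K (lincomb k.+1 t w) (lincomb k.+1 t w) <=
    ip K (A (F (lincomb k.+1 t w))) (F (lincomb k.+1 t w))) -> c <= eigval K A k.
Proof.
move=> wo FK FL F1 cw; have [e [Ke etail]] := eigval_tail k.
by apply: (minmax_le (eigval_ge0 k) wo FK FL F1 Ke etail).
Qed.

End OneOperator.

(** The contraction F carries the span of k + 1 eigenvectors of A to vectors on which the form of B
    is large enough for min-max. It is applied with F = D_1 to compare T(alpha) with T, and with a
    quotient of two such diagonals to compare two values of alpha. *)
Lemma eigval_mono A B (F : V -> V) k :
  pos_contraction K A -> pos_contraction K B -> compact_form K B ->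
  (forall f, ips K f -> ips K (F f)) ->
  linear_on K F ->
  (forall f, ips K f -> ip K (F f) (F f) <= ip K f f) ->
  (forall f, ips K f -> ip K (A f) f <= ip K (B (F f)) (F f)) ->
  eigval K A k <= eigval K B k.
Proof.
move=> HA HB cB FK FL F1 AB; apply: eigval_le; first exact: eigval_ge0.
move=> c [w [wo Aw]]; apply: (minmax_le_eigval HB cB wo FK FL F1) => t.
apply: le_trans (eigval_set_form HA t wo Aw) _; apply: AB.
by apply: ips_sum => // i /set_mem ik; apply: ipsZ => //; exact: wo.1.
Qed.

End EigvalTheory.

(** * Eigenprojections *)

Section Projections.
Context {R : realType} {V : lmodType R} (K : ipspace V) (HK : inner_space K).
Implicit Types (x y z f g : V) (u v e : nat -> V) (I : set nat).

(** Both a length [n] and a set [I] are present because a cluster of eigenvalues occupies an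
    interval of indices inside a longer eigensystem. *)
Definition oproj n I u x : V := \sum_(0 <= i < n | i \in I) ip K x (u i) *: u i.

Section OneFamily.
Context (I : set nat) (u : nat -> V) (uo : orthonormal_on K I u).

Let Ku i : I i -> ips K (u i). Proof. exact: uo.1. Qed.

Lemma ips_oproj n x : ips K (oproj n I u x).
Proof. by apply: (ips_ons HK uo) => i /set_mem. Qed.

Lemma ip_oproj n x y : ips K y ->
  ip K (oproj n I u x) y = \sum_(0 <= i < n | i \in I) ip K x (u i) * ip K y (u i).
Proof. by move=> Ky; rewrite (ons_ip_sum HK uo) ?iota_uniq// => i /set_mem. Qed.

Lemma ip_oproj_basis n x i : (i < n)%N -> I i -> ip K (oproj n I u x) (u i) = ip K x (u i).
Proof.
move=> ni Ii; rewrite (ons_ip1 HK uo) ?iota_uniq//; last by move=> ? /set_mem.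
by rewrite mem_index_iota ni mem_set.
Qed.

Lemma ip_oproj_sym n x y : ips K x -> ips K y ->
  ip K (oproj n I u x) y = ip K x (oproj n I u y).
Proof.
move=> Kx Ky; rewrite [RHS]ipC//; last exact: ips_oproj.
by rewrite !ip_oproj//; apply: eq_bigr => i _; rewrite mulrC.
Qed.

Lemma ip_oproj2 n x : ips K x -> ip K (oproj n I u x) (oproj n I u x) = ip K (oproj n I u x) x.
Proof.
move=> Kx; rewrite [RHS]ip_oproj// (ons_ip_sums HK uo) ?iota_uniq//.
by move=> i /set_mem.
Qed.

Lemma ip_sub_oproj n x : ips K x ->
  ip K (x - oproj n I u x) (x - oproj n I u x) =
  ip K x x - \sum_(0 <= i < n | i \in I) ip K x (u i) ^+ 2.
Proof. by move=> Kx; apply: (bessel_eq HK uo) => //; [exact: iota_uniq|move=> i /set_mem]. Qed.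

End OneFamily.

Lemma oproj_sub_form n I u v x : orthonormal_on K I u -> orthonormal_on K I v -> ips K x ->
  ip K (oproj n I u x - oproj n I v x) (oproj n I u x - oproj n I v x) =
  \sum_(0 <= i < n | i \in I) ip K x (u i) * ip K x (u i) +
  \sum_(0 <= l < n | l \in I) ip K x (v l) * ip K x (v l) -
  2 * \sum_(0 <= l < n | l \in I) \sum_(0 <= i < n | i \in I)
    ip K (v l) (u i) * (ip K x (u i) * ip K x (v l)).
Proof.
move=> uo vo Kx; have Ku := ips_oproj uo n x; have Kv := ips_oproj vo n x.
rewrite ip_subE// !ip_oproj2// !ip_oproj//.
have -> : \sum_(0 <= i < n | i \in I) ip K x (u i) * ip K (oproj n I v x) (u i) =
    \sum_(0 <= l < n | l \in I) \sum_(0 <= i < n | i \in I)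
       ip K (v l) (u i) * (ip K x (u i) * ip K x (v l)).
  rewrite exchange_big/=; apply: eq_bigr => i /set_mem Ii.
  have Kui : ips K (u i) by exact: uo.1.
  rewrite ip_oproj// mulr_sumr; apply: eq_bigr => l /set_mem Il.
  by rewrite [ip K (u i) _]ipC//; [ring|exact: vo.1].
ring.
Qed.

Context (J : set nat) (b : nat -> V) (Kb : orthonormal_basis K J b).

Let Kbj j : J j -> ips K (b j). Proof. exact: Kb.1.1. Qed.

Lemma hsnorm_cvgE (A : V -> V) (l : R) :
  \sum_(0 <= j < n | j \in J) ip K (A (b j)) (A (b j)) @[n --> \oo] --> l ->
  (forall f, ips K f -> ips K (A f)) -> hsnorm K J b A = (Num.sqrt l)%:E.
Proof.
move=> Al KA; rewrite /hsnorm.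
suff -> : (\sum_(0 <= j <oo | j \in J) (ipnorm K (A (b j)) ^+ 2)%:E = l%:E)%E by [].
apply/cvg_lim => //; apply: cvg_EFin; first by apply: nearW => n; rewrite sumEFin.
apply: cvg_ext Al => n /=; rewrite sumEFin/=.
by apply: eq_bigr => j /set_mem/Kbj/KA KAb; rewrite sqr_ipnorm.
Qed.

(* For projections of equal finite rank, |Q_u - Q_v|_HS^2 = 2 tr(Q_v - Q_v Q_u Q_v) *)
Lemma hsnorm_oproj_sub n I u v (A : V -> V) : orthonormal_on K I u -> orthonormal_on K I v ->
  (forall f, ips K f -> A f = oproj n I u f - oproj n I v f) ->
  hsnorm K J b A = (Num.sqrt (2 * \sum_(0 <= l < n | l \in I)
     ip K (v l - oproj n I u (v l)) (v l - oproj n I u (v l))))%:E.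
Proof.
move=> uo vo AE; apply: hsnorm_cvgE; last first.
  move=> f Kf; rewrite AE//; have := ips_oproj uo n f; have := ips_oproj vo n f; in_ips.
have cvg_bu w w' : ips K w -> ips K w' ->
    \sum_(0 <= j < N | j \in J) ip K (b j) w * ip K (b j) w' @[N --> \oo] --> ip K w w'.
  move=> Kw Kw'; apply: cvg_ext (parseval HK Kb Kw Kw') => N.
  by apply: eq_bigr => j /set_mem/Kbj Kj; rewrite ipC// [ip K w' _]ipC.
have -> : 2 * \sum_(0 <= l < n | l \in I)
     ip K (v l - oproj n I u (v l)) (v l - oproj n I u (v l)) =
  \sum_(0 <= i < n | i \in I) ip K (u i) (u i) +
  \sum_(0 <= l < n | l \in I) ip K (v l) (v l) -
  2 * \sum_(0 <= l < n | l \in I) \sum_(0 <= i < n | i \in I)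
    ip K (v l) (u i) * ip K (u i) (v l).
  have -> : \sum_(0 <= i < n | i \in I) ip K (u i) (u i) =
            \sum_(0 <= i < n | i \in I) ip K (v i) (v i).
    by apply: eq_bigr => i /set_mem Ii; rewrite uo.2// vo.2.
  have -> : \sum_(0 <= l < n | l \in I)
      ip K (v l - oproj n I u (v l)) (v l - oproj n I u (v l)) =
    \sum_(0 <= l < n | l \in I) ip K (v l) (v l) -
    \sum_(0 <= l < n | l \in I) \sum_(0 <= i < n | i \in I) ip K (v l) (u i) * ip K (u i) (v l).
    rewrite -sumrB; apply: eq_bigr => l /set_mem Il; have Kv : ips K (v l) by exact: vo.1.
    rewrite ip_sub_oproj//; congr (_ - _); apply: eq_bigr => i /set_mem Ii.
    by rewrite expr2; congr (_ * _); rewrite ipC//; exact: uo.1.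
  ring.
(* The sum over the basis is moved inside the finite sums over [I], so that Parseval's identity
   applies to each term. *)
apply: (@cvg_ext _ _ _ (fun N =>
  \sum_(0 <= i < n | i \in I) \sum_(0 <= j < N | j \in J) ip K (b j) (u i) * ip K (b j) (u i) +
  \sum_(0 <= l < n | l \in I) \sum_(0 <= j < N | j \in J) ip K (b j) (v l) * ip K (b j) (v l) -
  2 * \sum_(0 <= l < n | l \in I) \sum_(0 <= i < n | i \in I)
    ip K (v l) (u i) * \sum_(0 <= j < N | j \in J) ip K (b j) (u i) * ip K (b j) (v l))).
  move=> N; rewrite [RHS](eq_bigr (fun j =>
  \sum_(0 <= i < n | i \in I) ip K (b j) (u i) * ip K (b j) (u i) +
  \sum_(0 <= l < n | l \in I) ip K (b j) (v l) * ip K (b j) (v l) -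
  2 * \sum_(0 <= l < n | l \in I) \sum_(0 <= i < n | i \in I)
    ip K (v l) (u i) * (ip K (b j) (u i) * ip K (b j) (v l)))); last first.
    by move=> j /set_mem/Kbj Kj; rewrite AE// oproj_sub_form.
  rewrite sumrB big_split/=; congr (_ + _ - _); [exact: exchange_big|exact: exchange_big|].
  rewrite -[RHS]mulr_sumr; congr (2 * _); rewrite [RHS]exchange_big/=.
  by apply: eq_bigr => l _; rewrite [RHS]exchange_big/=; apply: eq_bigr => i _; rewrite mulr_sumr.
have cvg_tr w : (forall i, I i -> ips K (w i)) ->
    \sum_(0 <= i < n | i \in I) \sum_(0 <= j < N | j \in J) ip K (b j) (w i) * ip K (b j) (w i)
    @[N --> \oo] --> \sum_(0 <= i < n | i \in I) ip K (w i) (w i).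
  by move=> Kw; apply: cvg_sum => i /set_mem/Kw Kwi; exact: cvg_bu.
have cvg_cross : 2 * (\sum_(0 <= l < n | l \in I) \sum_(0 <= i < n | i \in I)
    ip K (v l) (u i) * \sum_(0 <= j < N | j \in J) ip K (b j) (u i) * ip K (b j) (v l))
    @[N --> \oo] --> 2 * (\sum_(0 <= l < n | l \in I) \sum_(0 <= i < n | i \in I)
    ip K (v l) (u i) * ip K (u i) (v l)).
  apply: cvgMr; apply: cvg_sum => l /set_mem Il; apply: cvg_sum => i /set_mem Ii.
  by apply: cvgMr; apply: cvg_bu; [exact: uo.1|exact: vo.1].
exact: cvgB (cvgD (cvg_tr _ uo.1) (cvg_tr _ vo.1)) cvg_cross.
Qed.

(** Self-adjointness turns the coefficient <A f, b_j> into <f, A b_j>, which is at most |A b_j| for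
    f in the unit ball; Parseval's identity sums these bounds. The Hilbert-Schmidt norm may be
    infinite here. *)
Lemma opnorm_le_hsnorm (A : V -> V) : (forall f, ips K f -> ips K (A f)) ->
  (forall f g, ips K f -> ips K g -> ip K (A f) g = ip K f (A g)) ->
  (opnorm K A <= hsnorm K J b A)%E.
Proof.
move=> KA AC; apply: ub_ereal_sup => _ [f [Kf f1] <-]; rewrite /hsnorm.
have s0 j : j \in J -> (0 <= ((ipnorm K (A (b j))) ^+ 2)%:E)%E.
  by move=> _; rewrite lee_fin sqr_ge0.
have part n : (((\sum_(0 <= j < n | j \in J) ipnorm K (A (b j)) ^+ 2))%:E <=
    \sum_(0 <= j <oo | j \in J) (ipnorm K (A (b j)) ^+ 2)%:E)%E.
  by rewrite -sumEFin; apply: nneseries_lim_ge => j _; exact: s0.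
move: part; case: (\sum_(0 <= j <oo | j \in J) _)%E => [r| |] part; last 2 first.
- by rewrite leey.
- by have := part 0%N; rewrite leeNy_eq.
rewrite lee_fin /ipnorm ler_wsqrtr//; have KAf := KA _ Kf.
apply: (parseval_le HK Kb) => // n; have := part n; rewrite lee_fin; apply: le_trans.
apply: ler_sum => j /set_mem/Kbj Kj; have KAb := KA _ Kj.
rewrite AC//; apply: le_trans (ip_CS HK Kf KAb) _.
rewrite sqr_ipnorm// ler_piMl ?ip_ge0//.
by rewrite -sqr_ipnorm// expr_le1// ipnorm_ge0.
Qed.

Lemma orthproj_sym (M : set V) (P : V -> V) : M `<=` ips K -> orthproj K M P ->
  forall f g, ips K f -> ips K g -> ip K (P f) g = ip K f (P g).
Proof.
move=> MK PM f g Kf Kg; have [MPf fPf] := PM _ Kf; have [MPg gPg] := PM _ Kg.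
have KPf := MK _ MPf; have KPg := MK _ MPg.
have := fPf _ MPg; have := gPg _ MPf; rewrite !ipBl//.
rewrite [ip K g _]ipC// [ip K (P g) _]ipC//; lra.
Qed.

Lemma orthproj_uniq (M : set V) (P Q : V -> V) : M `<=` ips K ->
  orthproj K M P -> orthproj K M Q -> forall f, ips K f -> P f = Q f.
Proof.
move=> MK PM QM f Kf; have [MPf fPf] := PM _ Kf; have [MQf fQf] := QM _ Kf.
have KPf := MK _ MPf; have KQf := MK _ MQf.
apply/eqP; rewrite -subr_eq0; apply/eqP/(ip_eq0 HK); first by in_ips.
have := fPf _ MPf; have := fPf _ MQf; have := fQf _ MPf; have := fQf _ MQf.
by rewrite ip_subE// !ipBl// [ip K (Q f) (P f)]ipC//; lra.
Qed.

Lemma opnorm_sub_orthproj (M N : set V) (P Q : V -> V) : M `<=` ips K -> N `<=` ips K ->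
  orthproj K M P -> orthproj K N Q ->
  (opnorm K (P \- Q)%R <= hsnorm K J b (P \- Q)%R)%E.
Proof.
move=> MK NK PM QN; have KP f : ips K f -> ips K (P f) by move=> /PM[/MK].
have KQ f : ips K f -> ips K (Q f) by move=> /QN[/NK].
apply: opnorm_le_hsnorm => [f Kf|f g Kf Kg] /=; first by in_ips.
rewrite ipBl ?ipBr//; try in_ips.
by rewrite (orthproj_sym MK PM)// (orthproj_sym NK QN).
Qed.

End Projections.

Lemma near_forall_lt (T : Type) (F : set_system T) {FF : Filter F} (n : nat) (P : nat -> T -> Prop) :
  (forall i, (i < n)%N -> \forall t \near F, P i t) ->
  \forall t \near F, forall i, (i < n)%N -> P i t.
Proof.
elim: n => [_|n IH Pn]; first by apply: nearW.
have H1 := Pn n (ltnSn n); have H2 := IH (fun i ni => Pn i (ltnW ni)).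
apply: filterS2 H1 H2 => t Pnt Pt i; rewrite ltnS leq_eqVlt => /predU1P[->//|].
exact: Pt.
Qed.

(** * Projections onto eigenspaces and spectral gaps *)

Section Gap.
Context {R : realType} {V : lmodType R} (K : ipspace V) (HK : inner_space K).
Context (A : V -> V) (HA : pos_contraction K A).
Implicit Types (x y z f g : V) (u v e : nat -> V) (I : set nat).

Let AK f : ips K f -> ips K (A f). Proof. exact: pc_ips. Qed.

Context (n : nat) (e : nat -> V) (te : top_eigensystem K A n e).

Let eo : orthonormal_on K `I_n e. Proof. by case: te. Qed.
Let Ke i : (i < n)%N -> ips K (e i). Proof. exact: eo.1. Qed.

Lemma top_sub I : (forall i, I i -> (i < n)%N) -> orthonormal_on K I e.
Proof. by move=> In; split=> [i /In/Ke//|i j /In ni /In nj]; exact: eo.2. Qed.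

Lemma ip_eigvec x i : (i < n)%N -> ips K x -> ip K (A x) (e i) = eigval K A i * ip K x (e i).
Proof.
move=> ni Kx; have Kei := Ke ni; have [_ /(_ _ ni)[_ Aei] _] := te.
by rewrite (pc_sym HA)// Aei ipZr.
Qed.

(** An eigenvector for [c] is orthogonal to the [e i] with another eigenvalue. What the projection
    leaves of it is thus orthogonal to all n of them and still an eigenvector for [c], which the
    tail bound [eigval K A n < c] excludes unless it is 0. *)
Lemma oproj_eigvec I c g : (forall i, I i -> (i < n)%N) ->
  (forall i, (i < n)%N -> ~ I i -> eigval K A i <> c) -> eigval K A n < c ->
  eigenspace_op K A c g -> oproj K n I e g = g.
Proof.
move=> In Inc nc [Kg Ag]; have Io := top_sub In.
have KQ := ips_oproj HK Io n g.
have gi i : (i < n)%N -> ~ I i -> ip K g (e i) = 0.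
  move=> ni Ii; have := ip_eigvec ni Kg; rewrite Ag ipZl//; last exact: Ke.
  move/eqP; rewrite -subr_eq0 -mulrBl mulf_eq0 subr_eq0 => /orP[/eqP ci|/eqP//].
  by case: (Inc i ni Ii).
pose y := g - oproj K n I e g; have Ky : ips K y by rewrite /y; in_ips.
have yo : orth_below K e n y.
  move=> i ni; rewrite ipBl//; last exact: Ke.
  have [Ii|nIi] := pselect (I i); first by rewrite ip_oproj_basis ?subrr.
  rewrite gi// (ons_ip1 HK eo) ?iota_uniq//; last by move=> j /set_mem/In.
  by rewrite memNset// andbF subrr.
have AQ : A (oproj K n I e g) = c *: oproj K n I e g.
  rewrite /oproj (linear_on_sum HK _ _ (pc_lin HA)); last by move=> i /set_mem/In/Ke.
  rewrite scaler_sumr; apply: eq_bigr => i /set_mem Ii; have ni := In _ Ii.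
  have [_ /(_ _ ni)[_ ->] _] := te; rewrite !scalerA mulrC; congr (_ *: _).
  have := ip_eigvec ni Kg; rewrite Ag ipZl//; exact: Ke.
have Ay : A y = c *: y.
  by rewrite (linear_onB (pc_lin HA))// AQ Ag scalerBr.
have [_ _ /(_ n (leqnn n) y Ky yo)] := te; rewrite Ay ipZl// => cy.
apply/esym/eqP; rewrite -subr_eq0; apply/eqP/(ip_eq0 HK Ky)/le_anti.
rewrite ip_ge0// andbT; move: cy; rewrite -subr_ge0 -mulrBl => cy.
by rewrite -(nmulr_rge0 _ (_ : eigval K A n - c < 0)) ?subr_lt0.
Qed.

Lemma eigenspace_op_sub c : eigenspace_op K A c `<=` ips K.
Proof. by move=> f []. Qed.

Lemma eigenspace_sum_sub (mu : nat -> R) (I : set nat) : eigenspace_sum K A mu I `<=` ips K.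
Proof. by move=> f [m [j [g [jg ->]]]]; apply: ips_sum => // i _; have [_ []] := jg i. Qed.

Lemma oproj_in_eigenspace I c f : (forall i, I i -> (i < n)%N) ->
  (forall i, I i -> eigval K A i = c) -> ips K f -> eigenspace_op K A c (oproj K n I e f).
Proof.
move=> In Ic Kf; split; first exact: (ips_oproj HK (top_sub In)).
rewrite /oproj (linear_on_sum HK _ _ (pc_lin HA)); last by move=> i /set_mem/In/Ke.
rewrite scaler_sumr; apply: eq_bigr => i /set_mem Ii; have ni := In _ Ii.
by have [_ /(_ _ ni)[_ ->] _] := te; rewrite !scalerA mulrC Ic.
Qed.

Lemma orthproj_eigenspace I c : (forall i, I i -> (i < n)%N) ->
  (forall i, I i -> eigval K A i = c) ->
  (forall i, (i < n)%N -> ~ I i -> eigval K A i <> c) -> eigval K A n < c ->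
  orthproj K (eigenspace_op K A c) (oproj K n I e).
Proof.
move=> In Ic Inc nc f Kf; split; first exact: oproj_in_eigenspace.
move=> g Mg; have Io := top_sub In; have Kg := Mg.1; have KQ := ips_oproj HK Io n f.
rewrite ipBl// (ip_oproj_sym HK Io)//.
by rewrite (oproj_eigvec In Inc nc Mg) subrr.
Qed.

Lemma orthproj_eigenspace_sum I (mu : nat -> R) k : (forall i, I i -> (i < n)%N) -> I k ->
  (forall i, I i -> mu i = eigval K A i) ->
  (forall i j, (i < n)%N -> ~ I i -> I j -> eigval K A i <> eigval K A j) ->
  (forall j, I j -> eigval K A n < eigval K A j) ->
  orthproj K (eigenspace_sum K A mu I) (oproj K n I e).
Proof.
move=> In Ik muE Inc nc f Kf; have Io := top_sub In; split.
  (* Every term needs an index in [I]; positions outside [I] carry the zero vector, filed under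
     [k]. *)
  exists n, (fun i : 'I_n => if (i : nat) \in I then (i : nat) else k),
     (fun i : 'I_n => if (i : nat) \in I then ip K f (e i) *: e i else 0).
  split; last by rewrite /oproj big_mkord big_mkcond.
  move=> i; case: ifPn => [/set_mem Ii|_].
    have Kei : ips K (e i) by exact: Ke.
    split=> //; split; first by in_ips.
    rewrite (linear_onZ HK _ (pc_lin HA))//; have [_ /(_ _ (In _ Ii))[_ ->] _] := te.
    by rewrite muE// !scalerA mulrC.
  by split=> //; split; [exact: ips0|rewrite (linear_on0 HK (pc_lin HA)) scaler0].
move=> _ [m [j [g [jg ->]]]]; have KQ := ips_oproj HK Io n f.
rewrite ip_sumr//; last 2 first.
- by move=> i _; have [_ []] := jg i.
- by in_ips.
apply: big1 => i _; have [Iji Mg] := jg i; have Kg := Mg.1.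
have Qg : oproj K n I e (g i) = g i.
  apply: (oproj_eigvec (c := mu (j i))) Mg => //; rewrite muE//; last exact: nc.
  by move=> l nl Il; apply: Inc.
by rewrite ipBl// (ip_oproj_sym HK Io)// Qg subrr.
Qed.

(** Cauchy-Schwarz for the form of A, between [y] and [A y]. *)
Lemma pc_ker y : ips K y -> ip K (A y) y <= 0 -> A y = 0.
Proof.
move=> Ky Ay; apply: (ip_eq0 HK); first by in_ips.
apply/eqP; rewrite -sqrf_eq0 eq_le sqr_ge0 andbT.
have KAy := AK Ky; have := form_CS HK (pc_lin HA) AK (pc_sym HA) (pc_ge0 HA) Ky KAy.
by move=> /le_trans; apply; rewrite mulr_le0_ge0//; exact: (pc_ge0 HA).
Qed.

Lemma in_ker f : eigval K A n = 0 -> ips K f ->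
  eigenspace_op K A 0 (f - oproj K n `I_n e f).
Proof.
move=> n0 Kf; have KQ := ips_oproj HK eo n f; have Ky : ips K (f - oproj K n `I_n e f) by in_ips.
split=> //; rewrite scale0r; apply: pc_ker => //.
have [_ _ /(_ n (leqnn n) _ Ky)] := te; rewrite n0 mul0r; apply=> i ni.
by rewrite ipBl//; [rewrite ip_oproj_basis ?subrr|exact: Ke].
Qed.

Lemma oproj_orth_ker f g : ips K f -> eigenspace_op K A 0 g -> ip K (oproj K n `I_n e f) g = 0.
Proof.
move=> Kf [Kg Ag]; rewrite (ip_oproj HK eo)// big1// => i /set_mem/= ni.
have := ip_eigvec ni Kg; rewrite Ag scale0r ip0l//; last exact: Ke.
have [_ /(_ _ ni)[mu0 _] _] := te; move/esym/eqP; rewrite mulf_eq0 gt_eqF//= => /eqP ->.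
by rewrite mulr0.
Qed.

(** The tail bound says that the form vanishes off the n eigenvectors with positive eigenvalues, so
    the kernel is exactly their orthogonal complement. *)
Lemma orthproj_ker : eigval K A n = 0 ->
  orthproj K (eigenspace_op K A 0) (fun f => f - oproj K n `I_n e f).
Proof.
move=> n0 f Kf; split; first exact: in_ker.
by move=> g Mg; rewrite subKr oproj_orth_ker.
Qed.

Lemma orthproj_ker_sum (mu : nat -> R) I k : eigval K A n = 0 -> I k ->
  (forall i, I i -> mu i = 0) ->
  orthproj K (eigenspace_sum K A mu I) (fun f => f - oproj K n `I_n e f).
Proof.
move=> n0 Ik mu0 f Kf; split.
  exists 1%N, (fun=> k), (fun=> f - oproj K n `I_n e f); split; last by rewrite big_ord1.
  by move=> _; rewrite mu0//; split=> //; exact: in_ker.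
move=> _ [m [j [g [jg ->]]]]; rewrite subKr ip_sumr//.
- by apply: big1 => i _; have [Iji] := jg i; rewrite mu0//; exact: oproj_orth_ker.
- by move=> i _; have [_ []] := jg i.
- exact: (ips_oproj HK eo).
Qed.

(** What remains of [x] is u + y, with [u] in the span of the first p eigenvectors and [y]
    orthogonal to all n. The form of A - r is at least d |u|^2 on [u] and at most - d |y|^2 on [y];
    testing (A - r) x against u - y makes both contributions positive, and |u - y| = |u + y|. *)
Lemma gap_le p x r d : (p <= n)%N -> ips K x -> 0 <= d ->
  (forall j, (j < p)%N -> r + d <= eigval K A j) -> eigval K A n <= r - d ->
  d * ipnorm K (x - oproj K n [set i | (p <= i < n)%N] e x) <= ipnorm K (A x - r *: x).
Proof.
move=> pn Kx d0 pd nd.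
have po : orthonormal_on K `I_p e by apply: top_sub => i /= ip; exact: leq_trans pn.
have Io : orthonormal_on K [set i | (p <= i < n)%N] e by apply: top_sub => i /= /andP[].
pose u := oproj K n `I_p e x; pose y := x - oproj K n `I_n e x; set z := x - oproj K n [set i | (p <= i < n)%N] e x.
have Ku : ips K u := ips_oproj HK po n x.
have KI := ips_oproj HK Io n x; have KQ := ips_oproj HK eo n x.
have Ky : ips K y by rewrite /y; in_ips.
have zE : z = u + y.
  rewrite /z /y addrCA [oproj K n `I_n e x](_ : _ = u + oproj K n [set i | (p <= i < n)%N] e x).
    by rewrite opprD addNKr.
  rewrite /u /oproj (bigID (mem `I_p)) /=; congr (_ + _); apply: eq_bigl => i.
    apply/andP/idP => [[]//|/[dup] ip ->]; split=> //; apply/mem_set => /=.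
    by move/set_mem: ip => /= /leq_trans; exact.
  apply/andP/idP => [[/set_mem/= ni pi]|/set_mem/= /andP[pi ni]].
    by apply/mem_set; rewrite /= ni andbT leqNgt; apply: contra pi => ip; exact/mem_set.
  split; first exact/mem_set.
  by apply/negP => /set_mem/=; rewrite ltnNge pi.
have Kz : ips K z by rewrite zE; in_ips.
have yo i : (i < n)%N -> ip K y (e i) = 0.
  by move=> ni; rewrite ipBl//; [rewrite ip_oproj_basis ?subrr|exact: Ke].
have oy I : (forall i, I i -> (i < n)%N) -> ip K (oproj K n I e x) y = 0.
  move=> In; rewrite (ip_oproj HK (top_sub In))// big1// => i /set_mem/In ni.
  by rewrite yo// mulr0.
have uy : ip K u y = 0 by apply: oy => i /= ip; exact: leq_trans pn.
have tail : ip K (A y) y <= (r - d) * ip K y y.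
  have [_ _ /(_ n (leqnn n) _ Ky yo)/le_trans] := te; apply.
  by rewrite ler_wpM2r// ip_ge0.
have Axu : (r + d) * ip K u u <= ip K (A x) u.
  rewrite ip_oproj2// (ip_oproj HK po)// [ip K (A x) u]ipC//; last by in_ips.
  rewrite (ip_oproj HK po)//; last by in_ips.
  rewrite mulr_sumr; apply: ler_sum => i /set_mem/= ip.
  rewrite ip_eigvec//; last exact: leq_trans pn.
  by rewrite [leRHS]mulrCA ler_wpM2r ?pd// -expr2 sqr_ge0.
have xu : ip K x u = ip K u u by rewrite ip_oproj2// ipC.
have xy : ip K x y = ip K y y.
  by rewrite {2}/y ipBl// oy ?subr0.
have Axy : ip K (A x) y = ip K (A y) y.
  rewrite {2}/y -{1}(subrK (oproj K n `I_n e x) x) -/y.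
  rewrite (linear_onD (pc_lin HA))//.
  rewrite ipDl//; try in_ips; rewrite -[RHS]addr0; congr (_ + _).
  rewrite (pc_sym HA)// (ip_oproj HK eo)//; last by in_ips.
  rewrite big1// => i /set_mem/= ni; rewrite ip_eigvec// yo// !mulr0//.
clearbody u y.
have key : d * ip K z z <= ip K (A x - r *: x) (u - y).
  rewrite zE ip_addE// uy ipBl//; try in_ips.
  rewrite !ipBr// ?ipZl//; try in_ips.
  rewrite ?ipZl// xu xy Axy; lra.
have uyz : ipnorm K (u - y) = ipnorm K z.
  by rewrite zE /ipnorm ip_subE// ip_addE// uy !mulr0 subr0 addr0.
have [z0|z0] := eqVneq (ipnorm K z) 0; first by rewrite z0 mulr0 ipnorm_ge0.
have zp : 0 < ipnorm K z by rewrite lt_neqAle eq_sym z0 ipnorm_ge0.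
rewrite -(ler_pM2r zp) -mulrA -expr2 sqr_ipnorm//; apply: le_trans key _.
rewrite -uyz; apply: le_trans (ler_norm _) (ip_le_norm HK _ _); in_ips.
Qed.

End Gap.

(** * Perturbation of eigenvalues and eigenprojections *)

Section Perturbation.
Context {R : realType} {V : lmodType R} (K : ipspace V) (HK : inner_space K).
Context (J : set nat) (b : nat -> V).
Hypotheses (Kb : orthonormal_basis K J b) (Kc : ell2_complete K J b).
Context (B : V -> V) (Ba : R -> V -> V).
Hypotheses (HB : pos_contraction K B) (cB : compact_form K B).
Hypotheses (HBa : forall a : R, 0 < a -> pos_contraction K (Ba a))
           (cBa : forall a : R, 0 < a -> compact_form K (Ba a)).
Hypothesis eigval_Ba_le : forall (a : R) k, 0 < a -> eigval K (Ba a) k <= eigval K B k.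
Hypothesis Ba_cvg : forall x, ips K x -> ipnorm K (Ba a x - B x) @[a --> (0:R)^'+] --> 0.
Implicit Types (x y z f g : V) (u v e : nat -> V) (I : set nat).

Let gt0 : \forall a \near (0:R)^'+, 0 < a.
Proof. exact: nbhs_right_gt. Qed.

(** The vectors of the finite-rank bound serve as test vectors for min-max: orthogonally to them
    only the term with [eps / 2] is left. *)
Lemma eigval_small (eps : R) : 0 < eps -> exists k, eigval K B k < eps.
Proof.
move=> eps0; have eps2 : 0 < eps / 2 by lra.
have [n [g [Kg gB]]] := cB eps2; exists n.
apply: (@le_lt_trans _ _ (eps / 2)); last lra.
apply: eigval_le => [|c [w [wo Bw]]]; first exact: ltW.
apply: (minmax_le HK (F := id) (ltW eps2) wo _ _ _ (fun l _ => Kg l)) => //.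
  move=> y Ky yo; apply: le_trans (gB _ Ky) _.
  by rewrite big1 ?add0r// => i _; rewrite yo ?expr0n.
by move=> t; exact: eigval_set_form.
Qed.

(** The upper bound is domination. For the lower one, [eta a] adds up the errors at the k + 1 top
    eigenvectors of B and so bounds the perturbation of the form on their whole span. If the limit
    is 0, nonnegativity replaces this second half. *)
Lemma eigval_cvg k : eigval K (Ba a) k @[a --> (0:R)^'+] --> eigval K B k.
Proof.
have [Bk0|Bk0] := eqVneq (eigval K B k) 0.
  rewrite Bk0; apply: cvg_near_cst; apply: filterS gt0 => a a0.
  by apply/le_anti; rewrite -{1}Bk0 eigval_Ba_le// eigval_ge0//; exact: HBa.
have Bkp i : (i < k.+1)%N -> 0 < eigval K B i.
  rewrite ltnS => ik; apply: lt_le_trans (eigval_nonincr HK HB ik).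
  by rewrite lt_neqAle eq_sym Bk0 eigval_ge0.
have [e te] := ex_top_eigensystem HK Kb Kc HB cB Bkp.
have [eo Be _] := te; have Ke i : (i < k.+1)%N -> ips K (e i) by exact: eo.1.
pose eta a := \sum_(0 <= i < k.+1 | i \in `I_k.+1) ipnorm K (Ba a (e i) - B (e i)).
have eta0 : eta a @[a --> (0:R)^'+] --> 0.
  by apply: cvg_sum0 => i /set_mem/Ke; exact: Ba_cvg.
apply: (@cvg_squeeze0 _ _ _ _ _ eta) => //; apply: filterS gt0 => a a0.
have Hx := HBa a0.
rewrite distrC ger0_norm ?subr_ge0 ?eigval_Ba_le// lerBlDr addrC -lerBlDr.
apply: (minmax_le_eigval HK Kb Kc Hx (cBa a0) (F := id) eo) => // t.
set x := lincomb _ _ _.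
have Kx : ips K x by apply: ips_sum => // i /set_mem/Ke; in_ips.
have Kde i : (i < k.+1)%N -> ips K (Ba a (e i) - B (e i)).
  by move=> /Ke Kei; have := pc_ips HB Kei; have := pc_ips Hx Kei; in_ips.
have t_le i : (i < k.+1)%N -> `|t i| <= ipnorm K x.
  move=> ik; have Kei := Ke _ ik; have := ip_le_norm HK Kx Kei.
  rewrite /x /lincomb (ons_ip1 HK eo) ?iota_uniq//; last by move=> j /set_mem.
  rewrite mem_index_iota ik mem_set//= {2}/ipnorm eo.2//= eqxx sqrtr1 mulr1.
  exact.
have dx : ipnorm K (Ba a x - B x) <= eta a * ipnorm K x.
  rewrite /x /lincomb (linear_on_sum HK _ _ (pc_lin Hx)); last by move=> i /set_mem/Ke.
  rewrite (linear_on_sum HK _ _ (pc_lin HB)); last by move=> i /set_mem/Ke.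
  rewrite -sumrB; apply: le_trans (ipnorm_sum HK _ _) _.
    move=> i /set_mem ik; rewrite -scalerBr; have := Kde _ ik; in_ips.
  rewrite -/(lincomb _ _ _) -/x mulr_suml; apply: ler_sum => i /set_mem ik.
  rewrite -scalerBr ipnormZ//; last exact: Kde.
  by rewrite mulrC ler_wpM2l ?ipnorm_ge0 ?t_le.
have KBx := pc_ips HB Kx; have KBax := pc_ips Hx Kx.
have dxx : `|ip K (Ba a x - B x) x| <= eta a * ip K x x.
  apply: le_trans (ip_le_norm HK _ Kx) _; first by in_ips.
  by rewrite -sqr_ipnorm// expr2 mulrA ler_wpM2r// ipnorm_ge0.
have Bx : eigval K B k * ip K x x <= ip K (B x) x.
  apply: eigval_set_form => // i ik; exists (eigval K B i); last by have [] := Be i ik.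
  exact: (eigval_nonincr HK HB).
move: dxx; rewrite ipBl// ler_norml => /andP[dxx _].
by rewrite mulrBl; lra.
Qed.

Lemma eigval_gt_near k c : c < eigval K B k -> \forall a \near (0:R)^'+, c < eigval K (Ba a) k.
Proof. by move=> ck; have /cvgr_gt := @eigval_cvg k; exact. Qed.

Lemma eigval_gt_near_lt n c : (forall i, (i < n)%N -> c < eigval K B i) ->
  \forall a \near (0:R)^'+, forall i, (i < n)%N -> c < eigval K (Ba a) i.
Proof. by move=> cn; apply: near_forall_lt => i ni; exact/eigval_gt_near/cn. Qed.

Section OneCluster.
Context (p n : nat) (e : nat -> V) (te : top_eigensystem K B n e).
Hypotheses (pn : (p <= n)%N)
  (nB : forall i, (i < n)%N -> eigval K B n < eigval K B i)
  (pB : forall i j, (p <= i < n)%N -> (j < p)%N -> eigval K B i < eigval K B j).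

Local Notation I := [set i | (p <= i < n)%N].

Let n_pos i : (i < n)%N -> 0 < eigval K B i.
Proof. by move=> /nB; apply: le_lt_trans; exact: eigval_ge0. Qed.

Let Ke i : (i < n)%N -> ips K (e i).
Proof. by have [eo _ _] := te; exact: eo.1. Qed.

(** The eigenvalues within the block [I] may differ: [d] measures the distance from [r] to those
    outside it. It is fixed before [a], and the estimate holds for every choice of eigenvectors
    [ea]. *)
Lemma eigenvector_residual l : I l -> exists2 d : R, 0 < d &
  \forall a \near (0:R)^'+, forall ea, top_eigensystem K (Ba a) n ea ->
    d * ipnorm K (e l - oproj K n I ea (e l)) <= ipnorm K (Ba a (e l) - B (e l)).
Proof.
move=> /andP[pl ln]; set r := eigval K B l.
have [d [d0 nd pd]] : exists d : R, [/\ 0 < d, eigval K B n <= r - d &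
    forall j, (j < p)%N -> r + d < eigval K B j].
  have [p0|p0] := posnP p.
    exists (r - eigval K B n); split; [by rewrite subr_gt0 nB|lra|by rewrite p0].
  (* Half of the upper gap, since the upper eigenvalues of [Ba a] approach theirs from below; the
     lower gap in full, since the lower ones never exceed those of B. *)
  pose d := Num.min (r - eigval K B n) ((eigval K B p.-1 - r) / 2).
  have rp : r < eigval K B p.-1 by apply: pB; rewrite ?pl// prednK.
  exists d; split; first by rewrite lt_min subr_gt0 nB//= divr_gt0// subr_gt0.
    have : d <= r - eigval K B n by rewrite ge_min lexx.
    lra.
  move=> j jp; apply: (@lt_le_trans _ _ (eigval K B p.-1)).
    have : d <= (eigval K B p.-1 - r) / 2 by rewrite ge_min lexx orbT.
    lra.
  by apply: eigval_nonincr => //; rewrite -ltnS prednK.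
exists d => //; have := eigval_gt_near_lt pd; apply: filterS2 gt0 => a a0 pda ea tea.
have -> : B (e l) = r *: e l by have [_ /(_ _ ln)[]] := te.
apply: (gap_le HK (HBa a0) tea) => //; [exact: Ke|exact: ltW|by move=> j /pda/ltW|].
exact: le_trans (eigval_Ba_le _ a0) nd.
Qed.

(** The projections enter through the norms of their differences, so they can be the block
    projections or the complements of these. *)
Lemma hsnorm_cvg0 J' b' (Pa : R -> V -> V) (P : V -> V) : orthonormal_basis K J' b' ->
  (\forall a \near (0:R)^'+, forall ea, top_eigensystem K (Ba a) n ea -> forall f, ips K f ->
     ipnorm K (Pa a f - P f) = ipnorm K (oproj K n I ea f - oproj K n I e f)) ->
  hsnorm K J' b' (Pa a \- P)%R @[a --> (0:R)^'+] --> 0%E.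
Proof.
move=> Kb' PaE.
have Io : orthonormal_on K I e by apply: (top_sub te) => i /andP[].
have [d dP] : exists d : nat -> R, forall l, I l -> 0 < d l /\
  \forall a \near (0:R)^'+, forall ea, top_eigensystem K (Ba a) n ea ->
    d l * ipnorm K (e l - oproj K n I ea (e l)) <= ipnorm K (Ba a (e l) - B (e l)).
  have H l : exists d : R, I l -> 0 < d /\
    \forall a \near (0:R)^'+, forall ea, top_eigensystem K (Ba a) n ea ->
      d * ipnorm K (e l - oproj K n I ea (e l)) <= ipnorm K (Ba a (e l) - B (e l)).
    have [Il|nIl] := pselect (I l); last by exists 0.
    by have [d d0 dP] := eigenvector_residual Il; exists d.
  by have [d dP] := choice H; exists d.
pose h a := Num.sqrt (2 * \sum_(0 <= l < n | l \in I)
   (ipnorm K (Ba a (e l) - B (e l)) / d l) ^+ 2).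
have h0 : h a @[a --> (0:R)^'+] --> 0.
  rewrite -[X in _ --> X]sqrtr0; apply: continuous_cvg; first exact: sqrt_continuous.
  rewrite -[X in _ --> X](mulr0 2); apply: cvgMr.
  apply: cvg_sum0 => l /set_mem /andP[_ ln].
  have dl0 : ipnorm K (Ba a (e l) - B (e l)) / d l @[a --> (0:R)^'+] --> 0.
    by rewrite -[X in _ --> X](mul0r (d l)^-1); apply: cvgMl; exact/Ba_cvg/Ke.
  by rewrite -[X in _ --> X](mul0r 0); exact: (cvgM dl0 dl0).
have hs_le : \forall a \near (0:R)^'+, (0 <= hsnorm K J' b' (Pa a \- P)%R <= (h a)%:E)%E.
  have dPn : \forall a \near (0:R)^'+, forall l, (l < n)%N -> I l ->
      forall ea, top_eigensystem K (Ba a) n ea ->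
      d l * ipnorm K (e l - oproj K n I ea (e l)) <= ipnorm K (Ba a (e l) - B (e l)).
    apply: near_forall_lt => l ln; have [Il|nIl] := pselect (I l); last by apply: nearW.
    by have [_] := dP l Il; apply: filterS => a + _.
  have posn := eigval_gt_near_lt n_pos.
  apply: filterS2 (filterI gt0 posn) (filterI PaE dPn) => a [a0 posa] [PaEa dPa].
  have [ea tea] := ex_top_eigensystem HK Kb Kc (HBa a0) (cBa a0) posa.
  have Iao : orthonormal_on K I ea by apply: (top_sub tea) => i /andP[].
  have -> : hsnorm K J' b' (Pa a \- P)%R =
      hsnorm K J' b' (fun f => oproj K n I ea f - oproj K n I e f).
    rewrite /hsnorm; congr sqrte; apply: eq_eseriesr => j /set_mem Jj.
    by congr (_ ^+ 2)%:E; apply: (PaEa _ tea); exact: Kb'.1.1.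
  rewrite (hsnorm_oproj_sub (n := n) HK Kb' Iao Io)// !lee_fin sqrtr_ge0/= ler_wsqrtr//.
  rewrite ler_pM2l//; apply: ler_sum => l /set_mem Il; have [d0 _] := dP l Il.
  have ln : (l < n)%N by case/andP: Il.
  have Kel := Ke ln; have KQ := ips_oproj HK Iao n (e l).
  rewrite -(sqr_ipnorm HK); last by in_ips.
  rewrite ler_sqr ?nnegrE ?divr_ge0 ?ipnorm_ge0 ?(ltW d0)//.
  by rewrite ler_pdivlMr// mulrC dPa.
have h0E : (h a)%:E @[a --> (0:R)^'+] --> (0:R)%:E.
  by apply: cvg_EFin; [exact: nearW|exact: h0].
by apply: (squeeze_cvge hs_le) h0E; exact: cvg_cst.
Qed.

End OneCluster.

End Perturbation.

(** * Clusters of positive eigenvalues and the kernel *)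

Section EigenprojectionConvergence.
Context {R : realType} {V : lmodType R} (K : ipspace V) (HK : inner_space K).
Context (J : set nat) (b : nat -> V).
Hypotheses (Kb : orthonormal_basis K J b) (Kc : ell2_complete K J b).
Context (B : V -> V) (Ba : R -> V -> V).
Hypotheses (HB : pos_contraction K B) (cB : compact_form K B).
Hypotheses (HBa : forall a : R, 0 < a -> pos_contraction K (Ba a))
           (cBa : forall a : R, 0 < a -> compact_form K (Ba a)).
Hypothesis eigval_Ba_le : forall (a : R) k, 0 < a -> eigval K (Ba a) k <= eigval K B k.
Hypothesis Ba_cvg : forall x, ips K x -> ipnorm K (Ba a x - B x) @[a --> (0:R)^'+] --> 0.
Context (J' : set nat) (b' : nat -> V) (Kb' : orthonormal_basis K J' b').

Let gt0 : \forall a \near (0:R)^'+, 0 < a.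
Proof. exact: nbhs_right_gt. Qed.

(** Here [p] is the first index where the eigenvalue is down to the k-th one and [n] the first where
    it is below; the latter exists because the eigenvalues become arbitrarily small. *)
Lemma eigval_cluster k : 0 < eigval K B k -> exists p n, [/\ (p <= k < n)%N,
  forall i, (i < n)%N -> eigval K B n < eigval K B i,
  forall i, (p <= i < n)%N -> eigval K B i = eigval K B k &
  forall j, (j < p)%N -> eigval K B k < eigval K B j].
Proof.
move=> k0.
have ex_n : exists n, eigval K B n < eigval K B k by apply: eigval_small k0.
have ex_p : exists p, eigval K B p <= eigval K B k by exists k.
case: (ex_minnP ex_n) => n nk n_min; case: (ex_minnP ex_p) => p pk p_min.
have below i : (i < n)%N -> eigval K B k <= eigval K B i.
  by move=> ni; rewrite leNgt; apply: contraL ni => /n_min; rewrite -leqNgt.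
exists p, n; split.
- by rewrite p_min//= ltnNge; apply/negP => /(eigval_nonincr HK HB); rewrite leNgt nk.
- by move=> i /below; apply: lt_le_trans.
- move=> i /andP[pi ni]; apply/le_anti; rewrite below// andbT.
  exact: le_trans (eigval_nonincr HK HB pi) pk.
- by move=> j jp; rewrite ltNge; apply: contraL jp => /p_min; rewrite -leqNgt.
Qed.

Lemma eigval_zero_rank k : eigval K B k = 0 -> exists n, [/\ eigval K B n = 0,
  (forall i, (i < n)%N -> 0 < eigval K B i) & forall i, eigval K B i = 0 -> (n <= i)%N].
Proof.
move=> k0; have ex_n : exists n, eigval K B n <= 0 by exists k; rewrite k0.
case: (ex_minnP ex_n) => n n0 n_min; exists n; split.
- by apply/le_anti; rewrite n0 eigval_ge0.
- by move=> i ni; rewrite ltNge; apply: contraL ni => /n_min; rewrite -leqNgt.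
- by move=> i i0; apply: n_min; rewrite i0.
Qed.

Lemma eigval_Ba0 a k : 0 < a -> eigval K B k = 0 -> eigval K (Ba a) k = 0.
Proof.
by move=> a0 k0; apply/le_anti; rewrite -{1}k0 eigval_Ba_le// eigval_ge0//; exact: HBa.
Qed.

(* [Ma a] is either the eigenspace of [Ba a] for its k-th eigenvalue, or the sum of
   its eigenspaces for the eigenvalues that tend to the k-th eigenvalue of B. *)
Lemma eigenprojection_cvg_pos k p n (Ma : R -> set V) (Pa : R -> V -> V) (P : V -> V) :
  (p <= n)%N -> 0 < eigval K B k ->
  (forall i, (i < n)%N -> eigval K B n < eigval K B i) ->
  (forall i, (p <= i < n)%N -> eigval K B i = eigval K B k) ->
  (forall j, (j < p)%N -> eigval K B k < eigval K B j) ->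
  eigval K B n < eigval K B k ->
  (forall a, Ma a `<=` ips K) ->
  (forall a, 0 < a -> orthproj K (Ma a) (Pa a)) ->
  orthproj K (eigenspace_op K B (eigval K B k)) P ->
  (\forall a \near (0:R)^'+, forall e, top_eigensystem K (Ba a) n e ->
     orthproj K (Ma a) (oproj K n [set i | (p <= i < n)%N] e)) ->
  hsnorm K J' b' (Pa a \- P)%R @[a --> (0:R)^'+] --> 0%E.
Proof.
move=> pn k0 nB IB pB nk MaK PaM PM Ma_oproj.
have n_pos i : (i < n)%N -> 0 < eigval K B i.
  by move=> /nB; apply: le_lt_trans; exact: eigval_ge0.
have [e te] := ex_top_eigensystem HK Kb Kc HB cB n_pos.
apply: (hsnorm_cvg0 HK Kb Kc HB cB HBa cBa eigval_Ba_le Ba_cvg te pn nB _ Kb').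
  by move=> i j Ii jp; rewrite IB// pB.
apply: filterS2 gt0 Ma_oproj => a a0 Ma_oproj ea tea f Kf.
rewrite (orthproj_uniq HK (MaK a) (PaM a a0) (Ma_oproj ea tea) Kf).
rewrite (orthproj_uniq HK (@eigenspace_op_sub _ _ K B _) PM _ Kf (Q := oproj K n [set i | (p <= i < n)%N] e))//.
apply: (orthproj_eigenspace HK HB te) => //; first by move=> i /andP[].
move=> i ni /= Ii; have [ip|pi] := ltnP i p; last by rewrite pi ni in Ii.
by apply/eqP; rewrite gt_eqF// pB.
Qed.

(** Since (I - Q_a) - (I - Q) = Q - Q_a, it suffices to treat all n positive eigenvalues as one
    block separated from 0, that is, with p = 0. *)
Lemma eigenprojection_cvg_zero k n (Ma : R -> set V) (Pa : R -> V -> V) (P : V -> V) :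
  eigval K B k = 0 -> eigval K B n = 0 -> (forall i, (i < n)%N -> 0 < eigval K B i) ->
  (forall a, Ma a `<=` ips K) ->
  (forall a, 0 < a -> orthproj K (Ma a) (Pa a)) ->
  orthproj K (eigenspace_op K B (eigval K B k)) P ->
  (forall a, 0 < a -> forall e, top_eigensystem K (Ba a) n e ->
     orthproj K (Ma a) (fun f => f - oproj K n `I_n e f)) ->
  hsnorm K J' b' (Pa a \- P)%R @[a --> (0:R)^'+] --> 0%E.
Proof.
move=> k0 n0 n_pos MaK PaM PM Ma_oproj.
have [e te] := ex_top_eigensystem HK Kb Kc HB cB n_pos.
apply: (hsnorm_cvg0 (p := 0) HK Kb Kc HB cB HBa cBa eigval_Ba_le Ba_cvg te _ _ _ Kb') => //.
  by move=> i /n_pos; rewrite n0.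
apply: filterS gt0 => a a0 ea tea f Kf.
have [eo _ _] := te; have [eao _ _] := tea.
have KQ := ips_oproj HK eo n f; have KQa := ips_oproj HK eao n f.
rewrite (orthproj_uniq HK (MaK a) (PaM a a0) (Ma_oproj a a0 ea tea) Kf).
rewrite (orthproj_uniq HK (@eigenspace_op_sub _ _ K B _) PM _ Kf (Q := fun f => f - oproj K n `I_n e f)).
  rewrite -[in RHS]ipnormB//; congr ipnorm.
  by rewrite opprB addrC addrA subrK.
by rewrite k0; exact: (orthproj_ker HK HB te).
Qed.

(** If a multiple eigenvalue of B were approached by distinct eigenvalues of [Ba a], the eigenspace
    of one of them would be too small; the last hypothesis rules this out near 0. *)
Lemma eigenprojection_cvg k (Pa : R -> V -> V) (P : V -> V) :
  (forall a, 0 < a -> orthproj K (eigenspace_op K (Ba a) (eigval K (Ba a) k)) (Pa a)) ->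
  orthproj K (eigenspace_op K B (eigval K B k)) P ->
  (\forall a \near (0:R)^'+, forall j, eigval K B j = eigval K B k ->
     eigval K (Ba a) j = eigval K (Ba a) k) ->
  hsnorm K J' b' (Pa a \- P)%R @[a --> (0:R)^'+] --> 0%E.
Proof.
move=> PaM PM Bk; have [k0|k0] := eqVneq (eigval K B k) 0.
  have [n [n0 n_pos _]] := eigval_zero_rank k0.
  apply: (eigenprojection_cvg_zero k0 n0 n_pos _ PaM PM) => [a|a a0 e te].
    exact: eigenspace_op_sub.
  rewrite eigval_Ba0//; apply: (orthproj_ker HK (HBa a0) te).
  exact: eigval_Ba0.
have {}k0 : 0 < eigval K B k by rewrite lt_neqAle eq_sym k0 eigval_ge0.
have [p [n [/andP[pk kn] nB IB pB]]] := eigval_cluster k0.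
apply: (eigenprojection_cvg_pos (ltnW (leq_ltn_trans pk kn)) k0 nB IB pB (nB _ kn) _ PaM PM).
  by move=> a; exact: eigenspace_op_sub.
have nBa := eigval_gt_near_lt HK Kb Kc HB cB HBa cBa eigval_Ba_le Ba_cvg nB.
have pBa := eigval_gt_near_lt HK Kb Kc HB cB HBa cBa eigval_Ba_le Ba_cvg pB.
apply: filterS3 (filterI gt0 Bk) nBa pBa => a [a0 Bka] nBa pBa e te.
apply: (orthproj_eigenspace HK (HBa a0) te).
- by move=> i /andP[].
- by move=> i Ii; apply/Bka/IB.
- move=> i ni /= Ii; have [ip|pi] := ltnP i p; last by rewrite pi ni in Ii.
  by apply/eqP; rewrite gt_eqF//; apply: le_lt_trans (pBa _ ip); exact: eigval_Ba_le.
- by apply: le_lt_trans (nBa _ kn); exact: eigval_Ba_le.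
Qed.

(** Summing over the whole cluster keeps the rank, or the corank for the eigenvalue 0, equal to that
    of the limit, however the eigenvalues split. *)
Lemma eigenprojection_sum_cvg k (Pa : R -> V -> V) (P : V -> V) :
  (forall a, 0 < a -> orthproj K (eigenspace_sum K (Ba a) (eigval K (Ba a))
     [set j | eigval K B j = eigval K B k]) (Pa a)) ->
  orthproj K (eigenspace_op K B (eigval K B k)) P ->
  hsnorm K J' b' (Pa a \- P)%R @[a --> (0:R)^'+] --> 0%E.
Proof.
move=> PaM PM; have [k0|k0] := eqVneq (eigval K B k) 0.
  have [n [n0 n_pos _]] := eigval_zero_rank k0.
  apply: (eigenprojection_cvg_zero k0 n0 n_pos _ PaM PM) => [a|a a0 e te].
    exact: eigenspace_sum_sub.
  apply: (orthproj_ker_sum HK (HBa a0) te (k := k)) => //; first exact: eigval_Ba0.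
  by move=> i /= ik; rewrite eigval_Ba0// ik.
have {}k0 : 0 < eigval K B k by rewrite lt_neqAle eq_sym k0 eigval_ge0.
have [p [n [/andP[pk kn] nB IB pB]]] := eigval_cluster k0.
apply: (eigenprojection_cvg_pos (ltnW (leq_ltn_trans pk kn)) k0 nB IB pB (nB _ kn) _ PaM PM).
  by move=> a; exact: eigenspace_sum_sub.
have nBa := eigval_gt_near_lt HK Kb Kc HB cB HBa cBa eigval_Ba_le Ba_cvg nB.
have pBa := eigval_gt_near_lt HK Kb Kc HB cB HBa cBa eigval_Ba_le Ba_cvg pB.
have -> : [set j | eigval K B j = eigval K B k] = [set i | (p <= i < n)%N].
  apply/seteqP; split=> i /=; last exact: IB.
  move=> ik; apply/andP; split.
    by rewrite leqNgt; apply/negP => /pB; rewrite ik ltxx.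
  rewrite ltnNge; apply/negP => /(eigval_nonincr HK HB).
  by rewrite ik leNgt nB.
apply: filterS3 gt0 nBa pBa => a a0 nBa pBa e te.
apply: (orthproj_eigenspace_sum HK (HBa a0) te (k := k)) => //=.
- by move=> i /andP[].
- by rewrite pk.
- move=> i j ni Ii jI; have [ip|pi] := ltnP i p; last by rewrite pi ni in Ii.
  apply/eqP; rewrite gt_eqF//; apply: le_lt_trans (pBa _ ip).
  by rewrite -(IB _ jI) eigval_Ba_le.
- by move=> j /andP[_ jn]; apply: le_lt_trans (nBa _ jn); exact: eigval_Ba_le.
Qed.

End EigenprojectionConvergence.

(** * Adjoint pairs and the products of an operator with its adjoint *)

Section Adjoint.
Context {R : realType} {V : lmodType R}.
Context (H K : ipspace V) (HH : inner_space H) (HK : inner_space K).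
Context (A B : V -> V) (AK : forall f, ips H f -> ips K (A f)) (AB : adjoint_op H K A B).

Let BH g : ips K g -> ips H (B g). Proof. exact: AB.1. Qed.

Lemma adjoint_op_sym : adjoint_op K H B A.
Proof.
split=> // g f Kg Hf; rewrite ipC//; last exact: BH.
by rewrite -AB.2// ipC//; exact: AK.
Qed.

(** Being an adjoint forces linearity. Applied to the reversed pair, this is also the source of the
    linearity of T, of T(alpha) and of the covariance operator. *)
Lemma adjoint_lin : linear_on K B.
Proof.
move=> a f g Kf Kg; apply: (ip_eq HH); try in_ips.
move=> z Hz; rewrite adjoint_op_sym.2//; try in_ips.
rewrite ipDl ?ipZl//; try in_ips.
by rewrite [RHS]ipDl ?[in RHS]ipZl ?adjoint_op_sym.2//; in_ips.
Qed.

Hypothesis A1 : forall f g, ips H f -> ips K g -> ip K (A f) g ^+ 2 <= ip H f f * ip K g g.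

Lemma adjoint_le g : ips K g -> ip H (B g) (B g) <= ip K g g.
Proof.
move=> Kg; have KBg := BH Kg; have := A1 KBg Kg; rewrite AB.2// expr2.
have := ip_ge0 HH KBg; rewrite le_eqVlt => /predU1P[<- _|Bg0]; first exact: ip_ge0.
by rewrite ler_pM2l.
Qed.

Lemma adjoint_norm_le g : ips K g -> ipnorm H (B g) <= ipnorm K g.
Proof. by move=> Kg; rewrite ler_wsqrtr// adjoint_le. Qed.

Lemma adjoint_norm_ler f : ips H f -> ipnorm K (A f) <= ipnorm H f.
Proof.
move=> Hf; have KAf := AK Hf; apply: (ipnorm_le HK) => //; first exact: ipnorm_ge0.
rewrite sqr_ipnorm//; have := A1 Hf KAf; rewrite expr2.
have := ip_ge0 HK KAf; rewrite le_eqVlt => /predU1P[<- _|Af0]; first exact: ip_ge0.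
by rewrite ler_pM2r.
Qed.

End Adjoint.

Section AdjointSquare.
Context {R : realType} {V : lmodType R}.
Context (H K : ipspace V) (HH : inner_space H) (HK : inner_space K).
Context (A B : V -> V) (AK : forall f, ips H f -> ips K (A f)) (AB : adjoint_op H K A B).
Hypothesis B1 : forall g, ips K g -> ip H (B g) (B g) <= ip K g g.

Let BH g : ips K g -> ips H (B g). Proof. exact: AB.1. Qed.

Lemma adjoint_square_form f g : ips K f -> ips K g ->
  ip K ((A \o B) f) g = ip H (B f) (B g).
Proof. by move=> Kf Kg; rewrite /= AB.2//; exact: BH. Qed.

Lemma adjoint_square_pc : pos_contraction K (A \o B).
Proof.
split.
- by move=> f Kf /=; auto.
- move=> a f g Kf Kg /=; rewrite (adjoint_lin HH HK AK AB)//.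
  by apply: (adjoint_lin HK HH BH (adjoint_op_sym HH HK AK AB)); exact: BH.
- move=> f g Kf Kg; rewrite adjoint_square_form// ipC//; try exact: BH.
  by rewrite -adjoint_square_form// ipC//; apply: AK; exact: BH.
- by move=> f Kf; rewrite adjoint_square_form// ip_ge0//; exact: BH.
- by move=> f Kf; rewrite adjoint_square_form//; exact: B1.
Qed.

(** The form is the sum of sigma_k^2 <z, f_k>^2. The terms before N are the finite-rank part, with
    vectors sigma_k f_k; from N on, sigma_k^2 <= [eps] and Bessel's inequality bounds the rest. *)
Lemma svd_compact_form sigma g f : svd H K A sigma g f -> compact_form K (A \o B).
Proof.
move=> [sigma_dec sigma0 go fo Asum] eps eps0; pose S := [set k | 0 < sigma k].
have sigma_ge0 k : 0 <= sigma k by case/andP: (sigma_dec k) => s0; exact: le_trans.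
have sigma_le j k : (j <= k)%N -> sigma k <= sigma j.
  elim: k => [|k IH]; first by rewrite leqn0 => /eqP ->.
  rewrite leq_eqVlt => /predU1P[->//|]; rewrite ltnS => /IH; apply: le_trans.
  by case/andP: (sigma_dec k).
have Hg k : S k -> ips H (g k) by exact: go.1.
have Kf k : S k -> ips K (f k) by exact: fo.1.
have Bg k z : S k -> ips K z -> ip H (B z) (g k) = sigma k * ip K z (f k).
  move=> Sk Kz; rewrite ipC//; [|exact: BH|exact: Hg]; rewrite -AB.2//; last exact: Hg.
  apply: cvg_unique_real (sums_to_ip HK fo _ Kz (Asum _ (Hg _ Sk))) _; first exact/AK/Hg.
  apply: cvg_near_cst; exists k.+1 => // n /= kn.
  rewrite big_mkcond (bigD1_seq k) ?iota_uniq ?mem_index_iota ?kn//= mem_set// big1.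
    by rewrite addr0 go.2// eqxx mulr1.
  move=> j jk; case: ifPn => // /set_mem Sj.
  by rewrite go.2// eq_sym (negPf jk) mulr0 mul0r.
have form z : ips K z ->
    \sum_(0 <= k < n | k \in S) sigma k ^+ 2 * ip K z (f k) ^+ 2 @[n --> \oo] -->
    ip K ((A \o B) z) z.
  move=> Kz; have KBz := BH Kz; apply: cvg_ext (sums_to_ip HK fo (AK KBz) Kz (Asum _ KBz)) => n.
  by apply: eq_bigr => k /set_mem Sk; rewrite Bg//; ring.
have [N sN] : exists N, sigma N ^+ 2 <= eps.
  have s20 : sigma n ^+ 2 @[n --> \oo] --> 0.
    by rewrite -[X in _ --> X](mul0r 0); exact: (cvgM sigma0 sigma0).
  have /cvgrPdist_le/(_ eps eps0)[N _ /(_ N (leqnn N))] := s20.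
  by rewrite sub0r normrN ger0_norm ?sqr_ge0// => ?; exists N.
exists N, (fun k => if k \in S then sigma k *: f k else 0); split.
  by move=> k; case: ifPn => [/set_mem/Kf|_]; in_ips.
move=> z Kz; apply: cvg_le_near (form z Kz) _; exists N => // n /= Nn.
rewrite (big_cat_nat (leq0n N) Nn)/= lerD//.
  rewrite big_mkord big_mkcond/=; apply: ler_sum => k _.
  case: ifPn => [/set_mem Sk|_]; last by rewrite sqr_ge0.
  by rewrite ipZr ?exprMn//; exact: Kf.
apply: (@le_trans _ _ (eps * \sum_(0 <= k < n | k \in S) ip K z (f k) ^+ 2)).
  rewrite [in leRHS](big_cat_nat (leq0n N) Nn)/= mulrDr; apply: ler_wpDl.
    by rewrite mulr_ge0 ?(ltW eps0)// sumr_ge0// => k _; exact: sqr_ge0.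
  rewrite mulr_sumr big_seq_cond [leRHS]big_seq_cond.
  apply: ler_sum => k /andP[]; rewrite mem_index_iota => /andP[Nk _] _.
  rewrite ler_wpM2r ?sqr_ge0//; apply: le_trans sN.
  by rewrite ler_sqr ?nnegrE// sigma_le.
rewrite ler_wpM2l ?(ltW eps0)//.
by apply: (bessel HK fo); rewrite ?iota_uniq// => k /set_mem.
Qed.

End AdjointSquare.

(** * Diagonal operators in an orthonormal basis *)

Section Diagonal.
Context {R : realType} {V : lmodType R} (K : ipspace V) (HK : inner_space K).
Context (J : set nat) (e : nat -> V) (Ke : orthonormal_basis K J e).
Implicit Types (c d : nat -> R) (D : V -> V).

Definition diagonal_op c D : Prop := forall f, ips K f ->
  ips K (D f) /\ forall j, J j -> ip K (D f) (e j) = c j * ip K f (e j).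

Let Kej j : J j -> ips K (e j). Proof. exact: Ke.1.1. Qed.

Lemma ex_diagonal_op c : ell2_complete K J e -> (forall j, J j -> `|c j| <= 1) ->
  exists D, diagonal_op c D.
Proof.
move=> Kc c1; suff H f : exists g, ips K f -> ips K g /\
    forall j, J j -> ip K g (e j) = c j * ip K f (e j).
  by have [D DP] := choice H; exists D.
have [Kf|] := pselect (ips K f); last by exists 0.
have [|g Kg gE] := Kc (fun j => c j * ip K f (e j)) (ip K f f); last by exists g.
move=> n; apply: le_trans (bessel HK Ke.1 (iota_uniq 0 (n - 0)) _ Kf); last first.
  by move=> j; exact: set_mem.
apply: ler_sum => j /set_mem Jj; rewrite exprMn ler_piMl ?sqr_ge0//.
by rewrite -real_normK ?num_real// expr_le1// c1.
Qed.

Section OneDiagonal.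
Context (c : nat -> R) (D : V -> V) (Dc : diagonal_op c D).

Lemma diag_ips f : ips K f -> ips K (D f).
Proof. by move=> /Dc[]. Qed.

Lemma diag_coef f j : ips K f -> J j -> ip K (D f) (e j) = c j * ip K f (e j).
Proof. by move=> /Dc[_]; apply. Qed.

Let KD := diag_ips.

Lemma diag_lin : linear_on K D.
Proof.
move=> a f g Kf Kg; apply: (basis_eq HK Ke); try in_ips.
move=> j Jj; have Kj := Kej Jj; rewrite diag_coef//; try in_ips.
rewrite !ipDl ?ipZl//; try in_ips.
by rewrite !diag_coef//; ring.
Qed.

Lemma diag_sym f g : ips K f -> ips K g -> ip K (D f) g = ip K f (D g).
Proof.
move=> Kf Kg; have KDf := KD Kf; have KDg := KD Kg.
apply: cvg_unique_real (parseval HK Ke KDf Kg) _.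
apply: cvg_ext (parseval HK Ke Kf KDg) => n.
by apply: eq_bigr => j /set_mem Jj; rewrite !diag_coef//; ring.
Qed.

Lemma diag_form_le d D' : diagonal_op d D' -> (forall j, J j -> `|c j| <= `|d j|) ->
  forall f, ips K f -> ip K (D f) (D f) <= ip K (D' f) (D' f).
Proof.
move=> Dd cd f Kf; have KDf := KD Kf; have [KD'f D'f] := Dd f Kf.
apply: (parseval_le HK Ke) => // n.
apply: le_trans (bessel HK Ke.1 (iota_uniq 0 (n - 0)) _ KD'f); last first.
  by move=> j; exact: set_mem.
apply: ler_sum => j /set_mem Jj; rewrite diag_coef// D'f// !exprMn ler_wpM2r ?sqr_ge0//.
by rewrite -[leLHS]real_normK ?num_real// -[leRHS]real_normK ?num_real// lerXn2r ?nnegrE// cd.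
Qed.

Hypothesis c1 : forall j, J j -> `|c j| <= 1.

Lemma diag_le f : ips K f -> ip K (D f) (D f) <= ip K f f.
Proof.
move=> Kf; apply: (@diag_form_le (fun=> 1) id) => // [g Kg|j Jj].
  by split=> // j Jj; rewrite mul1r.
by rewrite normr1 c1.
Qed.

Lemma diag_norm_le f : ips K f -> ipnorm K (D f) <= ipnorm K f.
Proof. by move=> Kf; rewrite ler_wsqrtr// diag_le. Qed.

End OneDiagonal.

Lemma diag_comp c d cd D D' D'' : diagonal_op c D -> diagonal_op d D' -> diagonal_op cd D'' ->
  (forall j, J j -> cd j = c j * d j) -> forall f, ips K f -> D'' f = D (D' f).
Proof.
move=> Dc Dd Dcd cdE f Kf; have KD'f := diag_ips Dd Kf.
apply: (basis_eq HK Ke); [exact: diag_ips Dcd _ Kf|exact: diag_ips Dc _ KD'f|].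
move=> j Jj; rewrite (diag_coef Dcd)// (diag_coef Dc)// (diag_coef Dd)// cdE//.
by rewrite mulrA.
Qed.

(** Convergence on finite sums of basis vectors extends to every vector by the uniform bound 1. It
    is only strong: the coefficients need not converge uniformly in j. *)
Lemma diag_cvg (T : Type) (F : set_system T) {FF : Filter F} (c : T -> nat -> R) (D : T -> V -> V) :
  (\forall t \near F, diagonal_op (c t) (D t) /\ forall j, J j -> `|c t j| <= 1) ->
  (forall j, J j -> c t j @[t --> F] --> (1 : R)) ->
  forall f, ips K f -> ipnorm K (D t f - f) @[t --> F] --> 0.
Proof.
move=> Dc cj f Kf; apply/cvgrPdist_le => eps eps0.
have /cvgrPdist_le/(_ (eps / 3))[|n _ /(_ n (leqnn n))] := psum_cvg Ke Kf; first lra.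
rewrite sub0r normrN ger0_norm ?ipnorm_ge0// => fn; set s := psum K J e f n in fn.
have Ks : ips K s := ips_psum HK Ke f n.
pose h t := \sum_(0 <= j < n | j \in J) `|ip K f (e j)| * `|c t j - 1|.
have h0 : h t @[t --> F] --> 0.
  apply: cvg_sum0 => j /set_mem Jj; rewrite -[X in _ --> X](mulr0 `|ip K f (e j)|).
  apply: cvgMr; rewrite -[X in _ --> X](@normr0 R R); apply: cvg_norm.
  by apply/subr_cvg0; exact: cj.
have /cvgrPdist_le/(_ (eps / 3)) H := h0.
have {}H : \forall t \near F, `|0 - h t| <= eps / 3 by apply: H; lra.
apply: filterS2 Dc H => t [Dct c1]; rewrite !sub0r !normrN => ht.
rewrite ger0_norm ?ipnorm_ge0//.
have KD := diag_ips Dct.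
have KDf := KD _ Kf; have KDs := KD _ Ks.
have DB := linear_onB (diag_lin Dct) Kf Ks.
have Ds : ipnorm K (D t s - s) <= h t.
  have -> : D t s - s = \sum_(0 <= j < n | j \in J) (ip K f (e j) * (c t j - 1)) *: e j.
    apply: (basis_eq HK Ke); [in_ips|by apply: ips_sum => // j /set_mem/Kej; in_ips|].
    move=> j Jj; have Kj := Kej Jj; rewrite ipBl//; try in_ips.
    have In i : i \in J -> J i by move/set_mem.
    rewrite (diag_coef Dct)// !(ons_ip1 HK Ke.1) ?iota_uniq//.
    by case: ifP => _; ring.
  apply: le_trans (ipnorm_sum HK _ _) _; first by move=> j /set_mem/Kej; in_ips.
  apply: ler_sum => j /set_mem Jj; have Kj := Kej Jj; rewrite ipnormZ//.
  by rewrite /ipnorm Ke.1.2// eqxx sqrtr1 mulr1 normrM.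
have -> : D t f - f = D t (f - s) + ((D t s - s) + (s - f)).
  by rewrite DB [D t s - s + _]addrA subrK addrA subrK.
apply: le_trans (ipnormD HK _ _) _; try in_ips.
have : ipnorm K (D t (f - s)) <= ipnorm K (f - s) by apply: (diag_norm_le Dct c1); in_ips.
rewrite ipnormB// => Dfs.
have tri : ipnorm K (D t s - s + (s - f)) <= ipnorm K (D t s - s) + ipnorm K (s - f).
  by apply: ipnormD => //; in_ips.
move: ht; rewrite ger0_norm; last by apply: sumr_ge0 => j _; rewrite mulr_ge0.
lra.
Qed.

End Diagonal.

(** * Regularized operators *)

Section TikhonovFactor.
Context {R : realType}.
Implicit Types (l a b : R).

(** T divides a cross covariance by the root of l_1 l_2, and T(a) by that of (l_1 + a) (l_2 + a);
    this is the quotient contributed by one side. *)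
Definition tikhonov l a : R := Num.sqrt (l / (l + a)).

Lemma tikhonov_le1 l a : 0 < l -> 0 <= a -> `|tikhonov l a| <= 1.
Proof.
move=> l0 a0; rewrite ger0_norm ?sqrtr_ge0// -sqrtr1 ler_wsqrtr//.
by rewrite ler_pdivrMr ?mul1r ?lerDl// ltr_wpDr.
Qed.

Lemma tikhonov_nonincr l a b : 0 < l -> 0 < a -> a <= b -> `|tikhonov l b| <= `|tikhonov l a|.
Proof.
move=> l0 a0 ab; rewrite !ger0_norm ?sqrtr_ge0// ler_wsqrtr//.
by rewrite ler_pM2l// lef_pV2 ?posrE ?lerD2l// addr_gt0//; exact: lt_le_trans ab.
Qed.

Lemma tikhonov_cvg1 l : 0 < l -> tikhonov l a @[a --> (0:R)^'+] --> (1:R).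
Proof.
move=> l0; rewrite -[X in _ --> X]sqrtr1; apply: continuous_cvg; first exact: sqrt_continuous.
rewrite -[X in _ --> X](_ : l / (l + 0) = 1); last by rewrite addr0 divff ?gt_eqF.
apply: cvgMr; apply: cvgV; first by rewrite addr0 gt_eqF.
by apply: cvgD; [exact: cvg_cst|exact: cvg_at_right_filter cvg_id].
Qed.

(** Regularizing with the larger [b] amounts to regularizing with [a] and then applying one more
    contraction. *)
Lemma tikhonov_ratio l a b : 0 < l -> 0 < a -> a <= b ->
  tikhonov l b = tikhonov l a * Num.sqrt ((l + a) / (l + b)).
Proof.
move=> l0 a0 ab; have b0 := lt_le_trans a0 ab.
rewrite /tikhonov -sqrtrM ?divr_ge0 ?addr_ge0 ?ltW//; congr Num.sqrt.
by field; rewrite !gt_eqF ?addr_gt0.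
Qed.

Lemma tikhonov_ratio_le1 l a b : 0 < l -> 0 < a -> a <= b ->
  `|Num.sqrt ((l + a) / (l + b))| <= 1.
Proof.
move=> l0 a0 ab; rewrite ger0_norm ?sqrtr_ge0// -sqrtr1 ler_wsqrtr//.
by rewrite ler_pdivrMr ?mul1r ?lerD2l// ltr_wpDr// (le_trans _ ab)// ltW.
Qed.

End TikhonovFactor.

(* Ta is T with its matrix coefficients damped by sqrt (lam / (lam + a)) on both
   sides, that is, Ta = D1 T D2 with diagonal contractions Di. *)
Section Regularization.
Context {R : realType} {V : lmodType R} (K1 K2 : ipspace V).
Hypotheses (HK1 : inner_space K1) (HK2 : inner_space K2).
Context (J1 J2 : set nat) (psi1 psi2 : nat -> V) (lam1 lam2 : nat -> R).
Hypotheses (b1 : orthonormal_basis K1 J1 psi1) (b2 : orthonormal_basis K2 J2 psi2).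
Hypotheses (c1 : ell2_complete K1 J1 psi1) (c2 : ell2_complete K2 J2 psi2).
Hypotheses (lam1_gt0 : forall j, J1 j -> 0 < lam1 j) (lam2_gt0 : forall j, J2 j -> 0 < lam2 j).
Context (T Tadj : V -> V) (TK : forall f, ips K2 f -> ips K1 (T f)).
Hypothesis (TadjP : adjoint_op K2 K1 T Tadj).
Hypothesis T1 : forall f g, ips K2 f -> ips K1 g -> ip K1 (T f) g ^+ 2 <= ip K2 f f * ip K1 g g.
Context (sigma : nat -> R) (g f : nat -> V) (T_svd : svd K2 K1 T sigma g f).
Context (Ta Taadj : R -> V -> V).
Hypotheses (TaK : forall (a : R) f, 0 < a -> ips K2 f -> ips K1 (Ta a f))
  (TaadjP : forall a : R, 0 < a -> adjoint_op K2 K1 (Ta a) (Taadj a)).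
Hypothesis Ta_coef : forall (a : R) j k, 0 < a -> J1 j -> J2 k ->
  ip K1 (Ta a (psi2 k)) (psi1 j) =
  tikhonov (lam1 j) a * tikhonov (lam2 k) a * ip K1 (T (psi2 k)) (psi1 j).
Implicit Types (x y z h : V).

Let TadjK x : ips K1 x -> ips K2 (Tadj x). Proof. exact: TadjP.1. Qed.

Let dcoef (lam : nat -> R) (a : R) (j : nat) := tikhonov (lam j) a.

Let ex_D1 a : exists D, 0 < a -> diagonal_op K1 J1 psi1 (dcoef lam1 a) D.
Proof.
have [a0|] := boolP (0 < a); last by exists id.
have [|D DP] := @ex_diagonal_op _ _ _ HK1 _ _ b1 (dcoef lam1 a) c1; last by exists D.
by move=> j Jj; rewrite tikhonov_le1 ?ltW// lam1_gt0.
Qed.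

Let ex_D2 a : exists D, 0 < a -> diagonal_op K2 J2 psi2 (dcoef lam2 a) D.
Proof.
have [a0|] := boolP (0 < a); last by exists id.
have [|D DP] := @ex_diagonal_op _ _ _ HK2 _ _ b2 (dcoef lam2 a) c2; last by exists D.
by move=> j Jj; rewrite tikhonov_le1 ?ltW// lam2_gt0.
Qed.

Definition D1 a := sval (cid (ex_D1 a)).
Definition D2 a := sval (cid (ex_D2 a)).

Let D1P a : 0 < a -> diagonal_op K1 J1 psi1 (dcoef lam1 a) (D1 a).
Proof. exact: (svalP (cid (ex_D1 a))). Qed.

Let D2P a : 0 < a -> diagonal_op K2 J2 psi2 (dcoef lam2 a) (D2 a).
Proof. exact: (svalP (cid (ex_D2 a))). Qed.

Let d1_le1 a j : 0 < a -> J1 j -> `|dcoef lam1 a j| <= 1.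
Proof. by move=> a0 Jj; rewrite tikhonov_le1 ?ltW// lam1_gt0. Qed.

Let d2_le1 a j : 0 < a -> J2 j -> `|dcoef lam2 a j| <= 1.
Proof. by move=> a0 Jj; rewrite tikhonov_le1 ?ltW// lam2_gt0. Qed.

(** The matrix entries describe [Ta a] on basis vectors only, and its values there are what the
    coefficients of [Taadj a x] require. Hence the adjoint is factored before [Ta a], which follows
    by duality. *)
Lemma Taadj_factor a x : 0 < a -> ips K1 x -> Taadj a x = D2 a (Tadj (D1 a x)).
Proof.
move=> a0 Kx; have K1D := diag_ips (D1P a0) Kx; have KTD := TadjK K1D.
have K2D := diag_ips (D2P a0) KTD; have KTax := (TaadjP a0).1 _ Kx.
apply: (basis_eq HK2 b2) => // k Jk; have Kk : ips K2 (psi2 k) by exact: b2.1.1.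
have KTk := TK Kk; have KTak := TaK a0 Kk.
rewrite (diag_coef (D2P a0))// ipC// -(TaadjP a0).2//.
rewrite [ip K2 (Tadj _) _]ipC// -TadjP.2//.
apply: cvg_unique_real (parseval HK1 b1 KTak Kx) _.
apply: (@cvg_ext _ _ _ (fun n => dcoef lam2 a k * \sum_(0 <= j < n | j \in J1)
    ip K1 (T (psi2 k)) (psi1 j) * ip K1 (D1 a x) (psi1 j))); last first.
  by apply: cvgMr; exact: parseval.
move=> n; rewrite mulr_sumr; apply: eq_bigr => j /set_mem Jj; rewrite Ta_coef// (diag_coef (D1P a0))//.
by rewrite /dcoef; ring.
Qed.

Lemma Ta_factor a y : 0 < a -> ips K2 y -> Ta a y = D1 a (T (D2 a y)).
Proof.
move=> a0 Ky; have K2D := diag_ips (D2P a0) Ky; have KTD := TK K2D.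
have K1D := diag_ips (D1P a0) KTD.
apply: (ip_eq HK1) => //; first exact: TaK.
move=> z Kz; have K1Dz := diag_ips (D1P a0) Kz; have KTDz := TadjK K1Dz.
rewrite (TaadjP a0).2// Taadj_factor//.
rewrite -(diag_sym HK2 b2 (D2P a0))//.
by rewrite -TadjP.2// (diag_sym HK1 b1 (D1P a0)).
Qed.

Let Tadj_le x : ips K1 x -> ip K2 (Tadj x) (Tadj x) <= ip K1 x x.
Proof. exact: (adjoint_le HK2 HK1 TadjP T1). Qed.

Lemma Taadj_le_Tadj a x : 0 < a -> ips K1 x ->
  ip K2 (Taadj a x) (Taadj a x) <= ip K2 (Tadj (D1 a x)) (Tadj (D1 a x)).
Proof.
move=> a0 Kx; rewrite Taadj_factor//; apply: (diag_le HK2 b2 (D2P a0)) => [j|].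
  exact: d2_le1.
by apply/TadjK/(diag_ips (D1P a0)).
Qed.

Let Taadj_le a x : 0 < a -> ips K1 x -> ip K2 (Taadj a x) (Taadj a x) <= ip K1 x x.
Proof.
move=> a0 Kx; have K1D := diag_ips (D1P a0) Kx.
apply: le_trans (Taadj_le_Tadj a0 Kx) (le_trans (Tadj_le K1D) _).
by apply: (diag_le HK1 b1 (D1P a0)) => // j; exact: d1_le1.
Qed.

Lemma TTadj_pc : pos_contraction K1 (T \o Tadj).
Proof. exact: (adjoint_square_pc HK2 HK1 TK TadjP Tadj_le). Qed.

Lemma TTadj_compact : compact_form K1 (T \o Tadj).
Proof. exact: (svd_compact_form HK2 HK1 TK TadjP T_svd). Qed.

Lemma TaTaadj_pc a : 0 < a -> pos_contraction K1 (Ta a \o Taadj a).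
Proof.
move=> a0; apply: (adjoint_square_pc HK2 HK1 _ (TaadjP a0)) => x Kx; first exact: TaK.
exact: Taadj_le.
Qed.

Lemma TaTaadj_form_le a x : 0 < a -> ips K1 x ->
  ip K1 ((Ta a \o Taadj a) x) x <= ip K1 ((T \o Tadj) (D1 a x)) (D1 a x).
Proof.
move=> a0 Kx; have K1D := diag_ips (D1P a0) Kx.
rewrite (adjoint_square_form (TaadjP a0))// (adjoint_square_form TadjP)//.
exact: Taadj_le_Tadj.
Qed.

Lemma TaTaadj_compact a : 0 < a -> compact_form K1 (Ta a \o Taadj a).
Proof.
move=> a0 eps eps0; have [n [u [Ku uT]]] := TTadj_compact eps0.
exists n, (fun i => D1 a (u i)); split=> [i|z Kz]; first exact: (diag_ips (D1P a0)).
have K1D := diag_ips (D1P a0) Kz.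
apply: le_trans (TaTaadj_form_le a0 Kz) (le_trans (uT _ K1D) _).
apply: lerD; last first.
  rewrite ler_wpM2l ?(ltW eps0)//; apply: (diag_le HK1 b1 (D1P a0)) => // j.
  exact: d1_le1.
by apply: ler_sum => i _; rewrite (diag_sym HK1 b1 (D1P a0)).
Qed.

Lemma eigval_Ta_le a k : 0 < a -> eigval K1 (Ta a \o Taadj a) k <= eigval K1 (T \o Tadj) k.
Proof.
move=> a0; have dP := D1P a0.
apply: (@eigval_mono _ _ K1 HK1 _ _ b1 c1 _ _ (D1 a) k (TaTaadj_pc a0) TTadj_pc TTadj_compact).
- exact: (diag_ips dP).
- exact: (diag_lin HK1 b1 dP).
- by apply: (diag_le HK1 b1 dP) => j; exact: d1_le1.
- by move=> x; exact: TaTaadj_form_le.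
Qed.

(** On the left D_1(b) = D_1(a) F with a diagonal contraction F, which [eigval_mono] absorbs; on the
    right the coefficients of D_2(b) are at most those of D_2(a). *)
Lemma eigval_Ta_nonincr a b k : 0 < a -> a <= b ->
  eigval K1 (Ta b \o Taadj b) k <= eigval K1 (Ta a \o Taadj a) k.
Proof.
move=> a0 ab; have b0 := lt_le_trans a0 ab.
have r1 j : J1 j -> `|Num.sqrt ((lam1 j + a) / (lam1 j + b))| <= 1.
  by move=> Jj; apply: tikhonov_ratio_le1 => //; exact: lam1_gt0.
have [F FP] := ex_diagonal_op HK1 b1 c1 r1.
apply: (@eigval_mono _ _ K1 HK1 _ _ b1 c1 _ _ F k (TaTaadj_pc b0) (TaTaadj_pc a0) (TaTaadj_compact a0)).
- exact: (diag_ips FP).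
- exact: (diag_lin HK1 b1 FP).
- by apply: (diag_le HK1 b1 FP).
move=> x Kx; have KF := diag_ips FP Kx; have KDF := diag_ips (D1P a0) KF.
rewrite (adjoint_square_form (TaadjP b0))// (adjoint_square_form (TaadjP a0))//.
rewrite !Taadj_factor//.
rewrite (diag_comp HK1 b1 (D1P a0) FP (D1P b0))// => [|j Jj]; last first.
  by apply: tikhonov_ratio => //; exact: lam1_gt0.
apply: (diag_form_le HK2 b2 (D2P b0) (D2P a0)) => [j Jj|]; last exact: TadjK.
by apply: tikhonov_nonincr => //; exact: lam2_gt0.
Qed.

Lemma TaTaadj_cvg x : ips K1 x ->
  ipnorm K1 ((Ta a \o Taadj a) x - (T \o Tadj) x) @[a --> (0:R)^'+] --> 0.
Proof.
move=> Kx; have gt0 : \forall a \near (0:R)^'+, 0 < a by exact: nbhs_right_gt.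
have D1_cvg y : ips K1 y -> ipnorm K1 (D1 a y - y) @[a --> (0:R)^'+] --> 0.
  apply: (diag_cvg HK1 b1 (c := dcoef lam1)) => [|j /lam1_gt0]; last exact: tikhonov_cvg1.
  by apply: filterS gt0 => a a0; split=> [|j]; [exact: D1P|exact: d1_le1].
have D2_cvg y : ips K2 y -> ipnorm K2 (D2 a y - y) @[a --> (0:R)^'+] --> 0.
  apply: (diag_cvg HK2 b2 (c := dcoef lam2)) => [|j /lam2_gt0]; last exact: tikhonov_cvg1.
  by apply: filterS gt0 => a a0; split=> [|j]; [exact: D2P|exact: d2_le1].
pose h := Tadj x; pose w := T h; have Kh : ips K2 h := TadjK Kx; have Kw : ips K1 w := TK Kh.
apply: (@cvg_squeeze0 _ _ _ _ _ (fun a => ipnorm K1 (D1 a x - x) +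
    (ipnorm K2 (D2 a h - h) + ipnorm K2 (D2 a h - h)) + ipnorm K1 (D1 a w - w))); last first.
  rewrite -[X in _ --> X](_ : 0 + (0 + 0) + 0 = 0 :> R); last by rewrite !addr0.
  by apply: cvgD; [apply: cvgD; [exact: D1_cvg|apply: cvgD; exact: D2_cvg]|exact: D1_cvg].
apply: filterS gt0 => a a0; rewrite subr0 ger0_norm ?ipnorm_ge0//.
have K1D y (Ky : ips K1 y) := diag_ips (D1P a0) Ky.
have K2D y (Ky : ips K2 y) := diag_ips (D2P a0) Ky.
have T_lin := adjoint_lin HK1 HK2 TadjK (adjoint_op_sym HK2 HK1 TK TadjP).
have Tadj_lin := adjoint_lin HK2 HK1 TK TadjP.
have D1_lin := diag_lin HK1 b1 (D1P a0); have D2_lin := diag_lin HK2 b2 (D2P a0).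
have D1_le y (Ky : ips K1 y) := diag_norm_le HK1 b1 (D1P a0) (fun j => @d1_le1 a j a0) Ky.
have D2_le y (Ky : ips K2 y) := diag_norm_le HK2 b2 (D2P a0) (fun j => @d2_le1 a j a0) Ky.
have T_le y (Ky : ips K2 y) := adjoint_norm_ler HK2 HK1 TK T1 Ky.
have Tadj_norm_le y (Ky : ips K1 y) := adjoint_norm_le HK2 HK1 TadjP T1 Ky.
have KD1x := K1D _ Kx; have KTD1x := TadjK KD1x.
rewrite /= Taadj_factor// Ta_factor//; last exact: K2D.
pose y1 := Tadj (D1 a x - x); pose y2 := D2 a (D2 a h - h) + (D2 a h - h).
have Kx' : ips K1 (D1 a x - x) by in_ips.
have KD2h := K2D _ Kh; have KD2D2h := K2D _ KD2h.
have Kh' : ips K2 (D2 a h - h) by in_ips.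
have Ky1 : ips K2 y1 by exact: TadjK.
have KD2y1 := K2D _ Ky1; have KD2D2y1 := K2D _ KD2y1.
have KD2h' := K2D _ Kh'.
have Ky2 : ips K2 y2 by rewrite /y2; in_ips.
(* A telescoping sum: each diagonal factor is compared with the identity at one of the fixed vectors
   [x], [h], [w], and the operators in front of the error are contractions. *)
have E : D1 a (T (D2 a (D2 a (Tadj (D1 a x))))) - T (Tadj x) =
    D1 a (T (D2 a (D2 a y1))) + (D1 a (T y2) + (D1 a w - w)).
  have -> : Tadj (D1 a x) = y1 + h by rewrite /y1 (linear_onB Tadj_lin)// subrK.
  have -> : D2 a (D2 a (y1 + h)) = D2 a (D2 a y1) + (y2 + h).
    rewrite /y2 (linear_onB D2_lin)//.
    have -> : D2 a (D2 a h) - D2 a h + (D2 a h - h) + h = D2 a (D2 a h).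
      by rewrite addrA !subrK.
    by rewrite !(linear_onD D2_lin).
  rewrite (linear_onD T_lin)//; last by in_ips.
  rewrite (linear_onD T_lin)// (linear_onD D1_lin); [|exact: TK|by have := TK Ky2; in_ips].
  by rewrite (linear_onD D1_lin)//; [rewrite -!addrA|exact: TK].
have KA := K1D _ (TK KD2D2y1); have KB := K1D _ (TK Ky2); have KC := K1D _ Kw.
rewrite E; apply: le_trans (ipnormD HK1 KA _) _; first by in_ips.
rewrite -addrA; apply: lerD.
  apply: le_trans (D1_le _ (TK KD2D2y1)) (le_trans (T_le _ KD2D2y1) _).
  apply: le_trans (D2_le _ KD2y1) (le_trans (D2_le _ Ky1) _).
  exact: Tadj_norm_le.
apply: le_trans (ipnormD HK1 KB _) _; first by in_ips.
apply: lerD => //.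
apply: le_trans (D1_le _ (TK Ky2)) (le_trans (T_le _ Ky2) _).
apply: le_trans (ipnormD HK2 KD2h' Kh') _.
by rewrite lerD2r D2_le.
Qed.

End Regularization.

(** * Completeness of L^2 *)

Section L2InnerProduct.
Context {d} {T : measurableType d} {R : realType} (mu : {measure set T -> \bar R}).

Local Open Scope quotient_scope.
Local Notation Lfun2 := (LfunType mu (lee1n 2)).
Local Notation L2 := (L2 mu).
Local Notation rep u := (repr (u : L2) : Lfun2).

Lemma Lfun2_measurable (f : Lfun2) : measurable_fun setT (f : T -> R).
Proof. by have := LfunP f; rewrite inE => /andP[/[!inE]]. Qed.

Lemma Lfun2_mul_integrable (f g : Lfun2) :
  mu.-integrable setT (EFin \o (fun x => f x * g x)).
Proof. by apply/Lfun1_integrable; exact: (Lfun2_mul_Lfun1 (LfunP f) (LfunP g)). Qed.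

Lemma pi_L2_ae (f g : Lfun2) : \pi_L2 f = \pi_L2 g -> {ae mu, forall x, f x = g x}.
Proof.
move=> /eqP; rewrite -Quotient.idealrBE => /asboolP; apply: filterS => x /(_ I)/= fg.
by apply/eqP; rewrite -subr_eq0; apply/eqP.
Qed.

Lemma rep_pi_ae (f : Lfun2) : {ae mu, forall x, rep (\pi_L2 f) x = f x}.
Proof. by apply: pi_L2_ae; rewrite reprK. Qed.

Lemma L2_dot_EFin (u v : L2) : (L2_dot u v)%:E = (\int[mu]_x (rep u x * rep v x)%:E)%E.
Proof.
rewrite /L2_dot /Rintegral fineK//; apply: integrable_fin_num => //.
exact: Lfun2_mul_integrable.
Qed.

(** [L2_dot] integrates the canonical representatives; any others differ from them on a null set. *)
Lemma L2_dot_pi (f g : Lfun2) : (L2_dot (\pi_L2 f) (\pi_L2 g))%:E = (\int[mu]_x (f x * g x)%:E)%E.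
Proof.
rewrite L2_dot_EFin; apply: ae_eq_integral => //.
- by apply/measurable_EFinP; apply: measurable_funM; exact: Lfun2_measurable.
- by apply/measurable_EFinP; apply: measurable_funM; exact: Lfun2_measurable.
apply: filterS2 (rep_pi_ae f) (rep_pi_ae g) => x fx gx _.
by rewrite fx gx.
Qed.

Lemma L2_inner_space : inner_space (L2space mu).
Proof.
split => //=.
- move=> u v _ _; apply: EFin_inj; rewrite !L2_dot_EFin.
  by apply: eq_integral => x _; rewrite mulrC.
- move=> a u v w _ _ _; apply: EFin_inj.
  have -> : a *: u + v = \pi_L2 (a *: rep u + rep v) by rewrite L2_piD [\pi_L2 (rep v)]reprK.
  rewrite -[w in LHS]reprK L2_dot_pi (EFinD (a * L2_dot u w)) (EFinM a) !L2_dot_EFin.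
  rewrite -integralZl//; last exact: Lfun2_mul_integrable.
  rewrite -integralD//; last 2 first.
  - by apply: integrableZl => //; exact: Lfun2_mul_integrable.
  - exact: Lfun2_mul_integrable.
  apply: eq_integral => x _; rewrite -EFinM -EFinD; congr EFin.
  by change ((a * rep u x + rep v x) * rep w x = a * (rep u x * rep w x) + rep v x * rep w x); ring.
- move=> u _; rewrite -lee_fin L2_dot_EFin; apply: integral_ge0 => x _.
  by rewrite lee_fin -expr2 sqr_ge0.
- move=> u _ u0; rewrite -[u]reprK; have := L2_dot_EFin u u; rewrite u0 => /esym int0.
  have /ae_eq_integral_abs : measurable_fun setT (fun x => (rep u x * rep u x)%:E).
    by apply/measurable_EFinP; apply: measurable_funM; exact: Lfun2_measurable.
  move=> /(_ mu measurableT)[+ _].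
  under eq_integral do rewrite gee0_abs ?lee_fin -?expr2 ?sqr_ge0// expr2.
  move=> /(_ int0) uu0.
  have pi0 : \pi_L2 (0 : Lfun2) = 0 by rewrite /L2 piE.
  apply/eqP; rewrite -pi0 -Quotient.idealrBE subr0; apply/asboolP.
  apply: filterS uu0 => x /(_ I) /= [] /eqP; rewrite mulf_eq0 orbb => /eqP -> _.
  by [].
Qed.

End L2InnerProduct.

Section L2Completeness.
Context {d} {T : measurableType d} {R : realType} (mu : {measure set T -> \bar R}).

Local Open Scope quotient_scope.
Local Notation Lfun2 := (LfunType mu (lee1n 2)).
Local Notation L2 := (L2 mu).
Local Notation rep u := (repr (u : L2) : Lfun2).

Lemma Lfun2_of_sqr (g : T -> R) : measurable_fun setT g ->
  (\int[mu]_x (g x ^+ 2)%:E < +oo)%E -> g \in Lfun mu 2%:E.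
Proof.
move=> mg g2; rewrite inE; apply/andP; split; rewrite inE//= /finite_norm unlock.
apply: poweR_lty; apply: le_lt_trans g2; rewrite le_eqVlt; apply/orP; left; apply/eqP.
by apply: eq_integral => x _; rewrite /= powR_mulrn// real_normK ?num_real.
Qed.

(* Successive differences with 4^k |F_(k+1) - F_k|^2 summable in mean make F_k
   converge almost everywhere, at a geometric rate. *)
Lemma fast_Cauchy_ae_cvg (F : nat -> Lfun2) :
  (forall n, (\int[mu]_x ((F n.+1 x - F n x) ^+ 2)%:E <= (8^-1 ^+ n)%:E)%E) ->
  {ae mu, forall x, cvgn (fun n => F n x)}.
Proof.
(* With the weight 4^k the integrals are at most 2^-k, so their sum is at most 2; where the series
   is finite, its root bounds |F_(k+1) - F_k| by a multiple of 2^-k. *)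
move=> F8; pose t k x := (4 ^+ k * (F k.+1 x - F k x) ^+ 2)%:E.
pose h x := (\sum_(k <oo | k \in predT) t k x)%E.
have mD n : measurable_fun setT (fun x => (F n.+1 x - F n x) ^+ 2).
  by apply: measurable_funX; apply: measurable_funB; exact: Lfun2_measurable.
have t0 k x : (0 <= t k x)%E by rewrite /t lee_fin mulr_ge0// ?sqr_ge0// exprn_ge0.
have mt k : measurable_fun setT (t k).
  by apply/measurable_EFinP; apply: measurable_funM => //; exact: measurable_cst.
have mh : measurable_fun setT h.
  by apply: ge0_emeasurable_sum => [k x _ _|k _]; [exact: t0|exact: mt].
have h0 x : (0 <= h x)%E by apply: nneseries_ge0 => k _ _; exact: t0.
have inth : (\int[mu]_x h x <= 2%:E)%E.
  rewrite /h; under eq_integral do rewrite (eq_eseriesl (Q := xpredT))//.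
  rewrite integral_nneseries//; apply: lime_le.
    by apply: is_cvg_nneseries => n _ _; exact: integral_ge0.
  apply: nearW => n; apply: (@le_trans _ _ (\sum_(0 <= k < n) (2^-1 ^+ k)%:E)%E).
    apply: lee_sum => k _; rewrite /t.
    under eq_integral do rewrite EFinM.
    rewrite ge0_integralZl_EFin//; last 2 first.
    - by move=> x _; rewrite lee_fin sqr_ge0.
    - exact/measurable_EFinP.
    apply: (@le_trans _ _ ((4 ^+ k)%:E * (8^-1 ^+ k)%:E)%E).
      by apply: lee_wpmul2l => //; rewrite lee_fin exprn_ge0.
    rewrite -EFinM lee_fin -exprMn.
    by rewrite (_ : 4 * 8^-1 = 2^-1 :> R)//; field.
  have G : series (geometric 1 2^-1) n <= 1 * (1 - 2^-1)^-1 :> R.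
    by apply: geometric_le_lim => //; rewrite ger0_norm//; lra.
  rewrite sumEFin lee_fin [leRHS](_ : 2 = 1 * (1 - 2^-1)^-1 :> R); last by field.
  apply: le_trans _ G; rewrite seriesEnat /=.
  by apply: ler_sum => k _; rewrite mul1r.
have ih : mu.-integrable setT h.
  apply/integrableP; split=> //; under eq_integral do rewrite gee0_abs//.
  by apply: le_lt_trans inth _; rewrite ltry.
apply: filterS (integrable_ae measurableT ih) => x /(_ I) hfin.
pose M := Num.sqrt (fine (h x)).
have dM k : `|F k.+1 x - F k x| <= M * 2^-1 ^+ k.
  have : (t k x <= h x)%E.
    apply: le_trans (nneseries_lim_ge k.+1 _); last by move=> *; exact: t0.
    rewrite big_nat_recr//= leeDr// sume_ge0// => i _; exact: t0.
  rewrite -(fineK hfin) lee_fin => tM.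
  have s4 : Num.sqrt (4 ^+ k) = 2 ^+ k :> R.
    rewrite (_ : 4 = 2 ^+ 2 :> R); last by ring.
    by rewrite exprAC sqrtr_sqr ger0_norm ?exprn_ge0.
  have -> : M * 2^-1 ^+ k = Num.sqrt (fine (h x) / 4 ^+ k).
    rewrite /M sqrtrM; last exact: fine_ge0.
    by rewrite sqrtrV ?exprn_ge0// s4 exprVn.
  rewrite -sqrtr_sqr ler_wsqrtr// ler_pdivlMr ?exprn_gt0//.
  by rewrite mulrC.
have cD : cvgn (series (fun k => F k.+1 x - F k x)).
  apply: normed_cvg; apply: (series_le_cvg _ _ dM) => [k|k|]; first exact: normr_ge0.
    by apply: mulr_ge0; [exact: sqrtr_ge0|exact: exprn_ge0].
  by apply: is_cvg_geometric_series; rewrite ger0_norm//; lra.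
have -> : (fun n => F n x) = (fun n => F 0%N x + series (fun k => F k.+1 x - F k x) n).
  by apply/funext => n; rewrite seriesEnat/= telescope_sumr// addrC subrK.
by apply: is_cvgD; [exact: is_cvg_cst|exact: cD].
Qed.

(** The upper limit [f0] is measurable everywhere and equals the limit almost everywhere; Fatou's
    lemma carries the bound for F_m - F_n over to f0 - F_n. *)
Lemma fast_Cauchy_cvg (F : nat -> Lfun2) :
  (forall n m, (n <= m)%N -> (\int[mu]_x ((F m x - F n x) ^+ 2)%:E <= (8^-1 ^+ n)%:E)%E) ->
  exists f : Lfun2, forall n, (\int[mu]_x ((f x - F n x) ^+ 2)%:E <= (8^-1 ^+ n)%:E)%E.
Proof.
move=> F8; have Fae := fast_Cauchy_ae_cvg (fun n => F8 n n.+1 (leqnSn n)).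
pose f0 x := fine (limn_esup (fun n => (F n x)%:E)).
have mF n : measurable_fun setT (F n : T -> R) by exact: Lfun2_measurable.
have mf0 : measurable_fun setT f0.
  apply: measurableT_comp; first exact: fine_measurable.
  by apply: measurable_fun_limn_esup => n; exact/measurable_EFinP.
have f0E x l : F n x @[n --> \oo] --> l -> f0 x = l.
  move=> Fl; rewrite /f0 is_cvg_limn_esupE.
    by rewrite (cvg_lim _ (cvg_EFin _ Fl))//; exact: nearW.
  by apply/cvg_ex; exists l%:E; apply: cvg_EFin; [exact: nearW|exact: Fl].
have mFn n k : measurable_fun setT (fun x => (F k x - F n x) ^+ 2).
  by apply: measurable_funX; apply: measurable_funB.
have f08 n : (\int[mu]_x ((f0 x - F n x) ^+ 2)%:E <= (8^-1 ^+ n)%:E)%E.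
  have -> : (\int[mu]_x ((f0 x - F n x) ^+ 2)%:E =
             \int[mu]_x limn_einf (fun k => ((F k x - F n x) ^+ 2)%:E))%E.
    apply: ae_eq_integral => //.
    - by apply/measurable_EFinP; apply: measurable_funX; exact: measurable_funB.
    - apply: (eq_measurable_fun (fun x => - limn_esup (fun k => - ((F k x - F n x) ^+ 2)%:E))%E).
        by move=> x _; rewrite limn_esupN oppeK.
      apply: measurableT_comp => //; apply: measurable_fun_limn_esup => k.
      by apply: measurableT_comp => //; exact/measurable_EFinP.
    apply: filterS Fae => x /cvg_ex[l Fl] _; rewrite (f0E x l Fl).
    have D2 : ((F k x - F n x) ^+ 2)%:E @[k --> \oo] --> ((l - F n x) ^+ 2)%:E.
      apply: cvg_EFin; first exact: nearW.
      have H : F k x - F n x @[k --> \oo] --> l - F n x by apply: cvgB; [exact: Fl|exact: cvg_cst].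
      by rewrite expr2; exact: (cvgM H H).
    by rewrite is_cvg_limn_einfE ?(cvg_lim _ D2)//; apply/cvg_ex; exists ((l - F n x) ^+ 2)%:E.
  apply: le_trans (fatou _ measurableT _ _) _.
  - by move=> k; exact/measurable_EFinP.
  - by move=> k x _; rewrite lee_fin sqr_ge0.
  rewrite limn_einf_lim; apply: lime_le; first exact: is_cvg_einfs.
  apply: nearW => k; apply: le_trans (F8 n (maxn k n) (leq_maxr _ _)).
  by apply: ereal_inf_lbound; exists (maxn k n) => //=; exact: leq_maxl.
have gF : (fun x => f0 x - F 0%N x) \in Lfun mu 2%:E.
  apply: Lfun2_of_sqr; first exact: measurable_funB.
  by apply: le_lt_trans (f08 0%N) _; rewrite ltry.
(* Square integrability is known for [f0] minus [F 0], from the bound at n = 0; adding [F 0] back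
   gives [f0] as an element of the function space. *)
exists (Lfun_Sub (lee1n 2) gF + F 0%N) => n; apply: le_trans (f08 n).
rewrite le_eqVlt; apply/orP; left; apply/eqP; apply: eq_integral => x _.
by rewrite -[f0 x](subrK (F 0%N x)).
Qed.

Lemma L2_distE (u : L2) (f : Lfun2) :
  (L2_dot (\pi_L2 f - u) (\pi_L2 f - u))%:E = (\int[mu]_x ((f x - rep u x) ^+ 2)%:E)%E.
Proof.
have -> : \pi_L2 f - u = \pi_L2 (f - rep u).
  by rewrite -[u in LHS]reprK /L2 !piE.
by rewrite L2_dot_pi; apply: eq_integral => x _; rewrite -expr2.
Qed.

Lemma L2_complete (u : nat -> L2) :
  (forall eps : R, 0 < eps -> exists N, forall m n, (N <= m)%N -> (N <= n)%N ->
     ipnorm (L2space mu) (u m - u n) <= eps) ->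
  exists f, ipnorm (L2space mu) (u n - f) @[n --> \oo] --> 0.
Proof.
move=> uC; have HI := L2_inner_space mu.
have ex_N k : exists N, forall m n, (N <= m)%N -> (N <= n)%N ->
     ipnorm (L2space mu) (u m - u n) <= Num.sqrt (8^-1 ^+ k).
  by apply: uC; rewrite sqrtr_gt0 exprn_gt0.
have [N NP] := choice ex_N.
(* The partial sums of [N] are nondecreasing and dominate [N]: they index a rapidly Cauchy
   subsequence. *)
pose s k := \sum_(i < k.+1) N i.
have sN k : (N k <= s k)%N by rewrite /s big_ord_recr/= leq_addl.
have s_mono j k : (j <= k)%N -> (s j <= s k)%N.
  elim: k => [|k IH]; first by rewrite leqn0 => /eqP ->.
  rewrite leq_eqVlt => /predU1P[->//|]; rewrite ltnS => /IH/leq_trans; apply.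
  by rewrite /s [in leqRHS]big_ord_recr/= leq_addr.
have norm2 (v : L2) c : 0 <= c -> ipnorm (L2space mu) v <= Num.sqrt c -> L2_dot v v <= c.
  move=> c0 vc; rewrite -[L2_dot v v]/(ip (L2space mu) v v) -(sqr_ipnorm HI)//.
  by rewrite -(sqr_sqrtr c0) ler_sqr ?nnegrE ?ipnorm_ge0 ?sqrtr_ge0.
have [n m nm|f fF] := @fast_Cauchy_cvg (fun k => rep (u (s k))).
  rewrite -L2_distE lee_fin reprK; apply: norm2; first by rewrite exprn_ge0.
  by apply: NP; [exact: leq_trans (sN n) (s_mono _ _ nm)|exact: sN].
exists (\pi_L2 f); apply/cvgrPdist_le => eps eps0.
have s0 : Num.sqrt (8^-1 ^+ k) @[k --> \oo] --> (0:R).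
  rewrite -[X in _ --> X]sqrtr0; apply: continuous_cvg; first exact: sqrt_continuous.
  by apply: cvg_expr; rewrite ger0_norm//; lra.
have g0 : Num.sqrt (8^-1 ^+ k) + Num.sqrt (8^-1 ^+ k) @[k --> \oo] --> (0:R).
  by rewrite -[X in _ --> X](addr0 0); exact: (cvgD s0 s0).
have /cvgrPdist_le/(_ eps eps0)[k _ /(_ k (leqnn k))] := g0.
rewrite sub0r normrN ger0_norm ?addr_ge0 ?sqrtr_ge0// => k_eps.
exists (s k) => // n /= kn; rewrite sub0r normrN ger0_norm ?ipnorm_ge0//.
apply: le_trans k_eps.
have -> : u n - \pi_L2 f = (u n - u (s k)) + (u (s k) - \pi_L2 f) by rewrite addrA subrK.
apply: le_trans (ipnormD HI _ _) _ => //; apply: lerD.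
  by apply: NP; [exact: leq_trans (sN k) kn|exact: sN].
rewrite (ipnormB HI)// ler_wsqrtr// -lee_fin L2_distE; exact: fF.
Qed.

End L2Completeness.

(** * Reproducing kernel Hilbert spaces *)

Section ClosedSubspace.
Context {R : realType} {V : lmodType R} (H : ipspace V) (HH : inner_space H).
Context (M : set V) (HM : closed_subspace H M).

Lemma restrict_inner_space : inner_space (restrict_ip H M).
Proof.
have [MH M0 ML _] := HM; split=> //=.
- by move=> f g /MH Hf /MH Hg; exact: ipC.
- by move=> a f g h /MH Hf /MH Hg /MH Hh; exact: ipL.
- by move=> f /MH Hf; exact: ip_ge0.
- by move=> f /MH Hf; exact: ip_eq0.
Qed.

Lemma closed_subspace_limit (u : nat -> V) f : (forall n, M (u n)) -> ips H f ->
  ipnorm H (u n - f) @[n --> \oo] --> 0 -> M f.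
Proof.
have [_ _ _ Mcl] := HM; move=> Mu Hf uf; apply: Mcl => // r r0.
have /cvgrPdist_lt/(_ r r0)[n _ /(_ n (leqnn n))] := uf.
by rewrite sub0r normrN ger0_norm ?ipnorm_ge0// => ?; exists (u n).
Qed.

Definition cauchy_complete : Prop := forall u : nat -> V, (forall n, ips H (u n)) ->
  (forall eps : R, 0 < eps -> exists N, forall m n, (N <= m)%N -> (N <= n)%N ->
     ipnorm H (u m - u n) <= eps) ->
  exists2 f, ips H f & ipnorm H (u n - f) @[n --> \oo] --> 0.

Hypothesis H_complete : cauchy_complete.

(** The squared distance of two partial sums is a difference of values of the bounded nondecreasing
    [S], so they form a Cauchy sequence in H; closedness keeps its limit in M. *)
Lemma restrict_ell2_complete J e : orthonormal_basis (restrict_ip H M) J e ->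
  ell2_complete (restrict_ip H M) J e.
Proof.
move=> [eo _] c B cB; have HK := restrict_inner_space; have [MH _ _ _] := HM.
pose s n := \sum_(0 <= j < n | j \in J) c j *: e j.
have Ms n : M (s n) by apply: (ips_ons HK eo) => j /set_mem.
pose S n := \sum_(0 <= j < n | j \in J) c j ^+ 2.
have s_sub n m : (n <= m)%N -> ip H (s m - s n) (s m - s n) = S m - S n.
  move=> nm; have -> : s m - s n = \sum_(n <= j < m | j \in J) c j *: e j.
    by rewrite /s (big_cat_nat (leq0n n) nm)/= addrAC subrr add0r.
  have -> : S m - S n = \sum_(n <= j < m | j \in J) c j ^+ 2.
    by rewrite /S (big_cat_nat (leq0n n) nm)/= addrAC subrr add0r.
  have In j : j \in J -> J j by move/set_mem.
  by have := ons_ip_sums HK eo c c (iota_uniq n (m - n)) In.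
have S_mono n m : (n <= m)%N -> S n <= S m.
  by move=> nm; rewrite -subr_ge0 -s_sub// ip_ge0//; apply: ipsD => //; [|apply: ipsN => //]; exact/MH/Ms.
have supS : has_sup (range S).
  by split; [exists (S 0%N), 0%N|exists B => _ [n _ <-]; exact: cB].
have [n|eps eps0|f Hf sf] := @H_complete s; first exact/MH/Ms.
  have [_ [N _ <-] SN] := sup_adherent (exprn_gt0 2 eps0) supS.
  have bound m n : (N <= m)%N -> (m <= n)%N -> ipnorm H (s n - s m) <= eps.
    move=> Nm mn; apply: (ipnorm_le HH); [|exact: ltW|].
      by apply: ipsD => //; [|apply: ipsN => //]; exact/MH/Ms.
    have Sn : S n <= sup (range S) by apply: ub_le_sup; [exact: supS.2|exists n].
    by rewrite s_sub//; have := S_mono _ _ Nm; lra.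
  exists N => m n Nm Nn; have [mn|/ltnW nm] := leqP m n; last exact: bound.
  by rewrite ipnormB//; [exact: bound|exact/MH/Ms|exact/MH/Ms].
have Mf := closed_subspace_limit Ms Hf sf.
by exists f => // j Jj; exact: (sums_to_coef HK eo Jj Mf sf).
Qed.

End ClosedSubspace.

Section IsometricImage.
Context {R : realType} {V : lmodType R} (K L : ipspace V) (HK : inner_space K) (G : V -> V).
Hypotheses (G_onto : forall y, ips L y <-> exists2 x, ips K x & G x = y)
  (G_lin : linear_on K G)
  (G_iso : forall f g, ips K f -> ips K g -> ip L (G f) (G g) = ip K f g).

Let LG x : ips K x -> ips L (G x). Proof. by move=> Kx; apply/G_onto; exists x. Qed.

Let G0 : G 0 = 0. Proof. exact: linear_on0 G_lin. Qed.

(** The inner product of an RKHS is a limit; its laws, its bases and its completeness are all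
    transported from the subspace by the isometry [G] rather than derived from that limit. *)
Lemma isometric_inner_space : inner_space L.
Proof.
split.
- by rewrite -G0; apply: LG; exact: ips0.
- move=> a _ _ /G_onto[x Kx <-] /G_onto[y Ky <-]; rewrite -G_lin//.
  by apply: LG; in_ips.
- by move=> _ _ /G_onto[x Kx <-] /G_onto[y Ky <-]; rewrite !G_iso// ipC.
- move=> a _ _ _ /G_onto[x Kx <-] /G_onto[y Ky <-] /G_onto[z Kz <-].
  by rewrite -G_lin// !G_iso ?ipL//; in_ips.
- by move=> _ /G_onto[x Kx <-]; rewrite G_iso// ip_ge0.
- by move=> _ /G_onto[x Kx <-]; rewrite G_iso// => /(ip_eq0 HK Kx) ->.
Qed.

Lemma isometric_orthonormal_basis J e : orthonormal_basis K J e ->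
  orthonormal_basis L J (fun j => G (e j)).
Proof.
move=> [[Ke eo] eb]; split; [split|] => [j Jj|j k Jj Jk|_ /G_onto[x Kx <-]].
- by apply: LG; exact: Ke.
- by rewrite G_iso ?eo//; exact: Ke.
apply: cvg_ext (eb x Kx) => n.
have Ks : ips K (\sum_(0 <= j < n | j \in J) ip K x (e j) *: e j).
  by apply: ips_sum => // j /set_mem/Ke; in_ips.
rewrite [in RHS](eq_bigr (fun j => ip K x (e j) *: G (e j))); last first.
  by move=> j /set_mem/Ke Kj; rewrite G_iso.
rewrite -(linear_on_sum HK _ _ G_lin); last by move=> j /set_mem/Ke.
set s := \sum_(0 <= j < n | _) _ in Ks *; rewrite /ipnorm.
by rewrite -(linear_onB G_lin)// G_iso//; in_ips.
Qed.

Lemma isometric_ell2_complete J e : orthonormal_on K J e -> ell2_complete K J e ->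
  ell2_complete L J (fun j => G (e j)).
Proof.
move=> [Ke _] Kc c B cB; have [x Kx xc] := Kc c B cB.
by exists (G x) => [|j Jj]; [exact: LG|rewrite G_iso ?xc//; exact: Ke].
Qed.

End IsometricImage.

Section SqrtEigenvector.
Context {R : realType} {V : lmodType R} (K : ipspace V) (HK : inner_space K).

(** With r the root of l, y = B f - r f satisfies B y = - r y because B (B f) = r^2 f, and
    nonnegativity of B forces y = 0. *)
Lemma sqrt_op_eigvec (A B : V -> V) (l : R) f : sqrt_op K A B -> ips K f -> 0 < l ->
  A f = l *: f -> B f = Num.sqrt l *: f.
Proof.
move=> [[KB Blin _] Badj B0 B2] Kf l0 Af; set r := Num.sqrt l.
have r0 : 0 < r by rewrite sqrtr_gt0.
have rr : r * r = l by rewrite -expr2 sqr_sqrtr// ltW.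
pose y := (- r) *: f + B f; have KBf := KB _ Kf.
have Ky : ips K y by rewrite /y; in_ips.
have By : B y = (- r) *: y.
  rewrite /y Blin// B2// Af scalerDr scalerA mulrNN rr addrC.
  by rewrite scaleNr.
have : 0 <= ip K (B y) y by exact: B0.
rewrite By ipZl// mulNr oppr_ge0 pmulr_rle0// => yy.
have /(ip_eq0 HK Ky)/eqP : ip K y y = 0 by apply/le_anti; rewrite yy ip_ge0.
by rewrite /y addrC scaleNr subr_eq0 => /eqP.
Qed.

Lemma sqrt_op_diagonal (A B : V -> V) J e (l : nat -> R) : sqrt_op K A B ->
  orthonormal_basis K J e -> (forall j, J j -> 0 < l j) ->
  (forall j, J j -> A (e j) = l j *: e j) ->
  diagonal_op K J e (fun j => Num.sqrt (l j)) B.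
Proof.
move=> BP Kb l0 Ae f Kf; have [[KB _ _] [_ Badj] _ _] := BP; split; first exact: KB.
move=> j Jj; have Kj : ips K (e j) by exact: Kb.1.1.
by rewrite Badj// (sqrt_op_eigvec BP Kj (l0 _ Jj) (Ae _ Jj)) ipZr.
Qed.

Lemma invsqrt_op_diagonal (S B : V -> V) J e (l : nat -> R) (a : R) : 0 < a ->
  (forall f, ips K f -> ips K (S f)) -> adjoint_op K K S S ->
  invsqrt_op K (fun f => S f + a *: f) B ->
  orthonormal_basis K J e -> (forall j, J j -> 0 < l j) ->
  (forall j, J j -> S (e j) = l j *: e j) ->
  diagonal_op K J e (fun j => Num.sqrt (l j + a)^-1) B.
Proof.
move=> a0 KS Sadj [A' A'inv BP] Kb l0 Se; apply: (sqrt_op_diagonal BP Kb) => j Jj.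
  by rewrite invr_gt0 addr_gt0// l0.
have Kj : ips K (e j) by exact: Kb.1.1.
have la0 : l j + a != 0 by rewrite gt_eqF// addr_gt0// l0.
have SZ c := linear_onZ HK c (adjoint_lin HK HK KS Sadj) Kj.
have [A'A _] := A'inv; have Kcj : ips K ((l j + a)^-1 *: e j) by in_ips.
have [_] := A'A _ Kcj; rewrite SZ Se// scalerA scalerA -scalerDl.
by rewrite [a * _]mulrC -mulrDr mulVf// scale1r.
Qed.

End SqrtEigenvector.

Section ReproducingKernelSpace.
Context {R : realType} {V : lmodType R} (H : ipspace V) (HH : inner_space H).
Hypothesis Hall : forall f, ips H f.
Context (M : set V) (HM : closed_subspace H M).
Local Notation K := (restrict_ip H M).
Context (S Shalf G : V -> V) (J : set nat) (phi : nat -> V) (lam : nat -> R).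
Hypotheses (S_eig : eigenbasis K S J phi lam) (ShalfP : sqrt_op K S Shalf)
  (GP : Gamma_op K J phi lam G).
Local Notation L := (rkhs K Shalf J phi lam).

Let HK : inner_space K := restrict_inner_space HH HM.

Let Kb : orthonormal_basis K J phi. Proof. by case: S_eig. Qed.

Let lam_gt0 j : J j -> 0 < lam j. Proof. by case: S_eig => _ _ _ + _; exact. Qed.

(** [Gamma_op] provides convergence in norm only; closedness of M puts the limit into the subspace,
    where its coefficients can be read off. *)
Lemma Gamma_diagonal : diagonal_op K J phi (fun j => Num.sqrt (lam j)) G.
Proof.
move=> f Kf; have KG : ips K (G f).
  apply: (closed_subspace_limit HM _ (Hall _) (GP Kf)) => n.
  by apply: (ips_ons HK Kb.1) => j /set_mem.
by split=> // j Jj; exact: (sums_to_coef HK Kb.1 Jj KG (GP Kf)).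
Qed.

Let Shalf_diagonal : diagonal_op K J phi (fun j => Num.sqrt (lam j)) Shalf.
Proof. by apply: (sqrt_op_diagonal HK ShalfP Kb lam_gt0); case: S_eig. Qed.

(** [Shalf] and [G] are diagonal with the same entries, so they agree on the subspace and have the
    same image. *)
Lemma rkhs_onto y : ips L y <-> exists2 x, ips K x & G x = y.
Proof.
have SG x : ips K x -> Shalf x = G x.
  move=> Kx; have KG := diag_ips Gamma_diagonal Kx; have KS := diag_ips Shalf_diagonal Kx.
  apply: (basis_eq HK Kb) => // j Jj.
  by rewrite (diag_coef Gamma_diagonal)// (diag_coef Shalf_diagonal).
by split=> -[x Kx <-]; exists x => //; rewrite SG.
Qed.

Lemma rkhs_iso f g : ips K f -> ips K g -> ip L (G f) (G g) = ip K f g.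
Proof.
move=> Kf Kg /=; apply/cvg_lim => //; apply: cvg_ext (parseval HK Kb Kf Kg) => n.
apply: eq_bigr => j /set_mem Jj; rewrite !(diag_coef Gamma_diagonal)//.
have l0 := lam_gt0 Jj; set r := Num.sqrt (lam j).
have -> : lam j = r * r by rewrite -expr2 sqr_sqrtr// ltW.
by field; rewrite gt_eqF// sqrtr_gt0.
Qed.

Lemma Gamma_lin : linear_on K G.
Proof. exact: (diag_lin HK Kb Gamma_diagonal). Qed.

End ReproducingKernelSpace.

(* A bound on the matrix of T in two bases passes to T, one variable at a time. *)
Lemma adjoint_contraction (R : realType) (V : lmodType R) (H K : ipspace V)
    (I J : set nat) (u v : nat -> V) (T Tadj : V -> V) :
  inner_space H -> inner_space K -> orthonormal_basis H I u -> orthonormal_basis K J v ->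
  (forall f, ips H f -> ips K (T f)) -> adjoint_op H K T Tadj ->
  (forall m n (x y : nat -> R),
     ip K (T (\sum_(0 <= k < m | k \in I) x k *: u k)) (\sum_(0 <= j < n | j \in J) y j *: v j) ^+ 2
     <= (\sum_(0 <= k < m | k \in I) x k ^+ 2) * (\sum_(0 <= j < n | j \in J) y j ^+ 2)) ->
  forall f g, ips H f -> ips K g -> ip K (T f) g ^+ 2 <= ip H f f * ip K g g.
Proof.
move=> HH HK Hb Kb TK TadjP T1 f g Hf Kg.
have Kgn n := ips_psum HK Kb g n; have Hfm m := ips_psum HH Hb f m.
have KTf := TK _ Hf.
have step n : ip K (T f) (psum K J v g n) ^+ 2 <= ip H f f * ip K g g.
  have HTg := TadjP.1 _ (Kgn n).
  have : ip H (psum H I u f m) (Tadj (psum K J v g n)) ^+ 2 @[m --> \oo] -->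
      ip H f (Tadj (psum K J v g n)) ^+ 2.
    by apply: cvg_sqr; apply: (ipnorm_cvg_ip HH Hfm Hf HTg); exact: psum_cvg.
  rewrite -TadjP.2// => cv; apply: cvg_le_near cv _; exists 0%N => // m _ /=.
  rewrite -TadjP.2//; apply: le_trans (T1 _ _ _ _) _.
  apply: ler_pM; try by apply: sumr_ge0 => ? _; exact: sqr_ge0.
    by apply: (bessel HH Hb.1) => //; [exact: iota_uniq|move=> k /set_mem].
  by apply: (bessel HK Kb.1) => //; [exact: iota_uniq|move=> k /set_mem].
have : ip K (psum K J v g n) (T f) ^+ 2 @[n --> \oo] --> ip K g (T f) ^+ 2.
  by apply: cvg_sqr; apply: (ipnorm_cvg_ip HK Kgn Kg KTf); exact: psum_cvg.
rewrite [ip K g _]ipC// => cv; apply: cvg_le_near cv _; exists 0%N => // n _ /=.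
by rewrite ipC.
Qed.

(** * Covariance operators and their compressions *)

Section Covariance.
Context {R : realType} {V : lmodType R} (H : ipspace V) (HH : inner_space H).
Context {d : measure_display} {Omega : measurableType d} (P : probability Omega R).
Context (X : Omega -> V) (HX : forall w, ips H (X w)) (S : V -> V).
Hypothesis S_cov : covariance_op P H X S.

Lemma covariance_ips f : ips H f -> ips H (S f).
Proof. by move=> /S_cov[]. Qed.

Lemma covariance_form f g : ips H f -> ips H g ->
  (ip H (S f) g)%:E = 'E_P[fun w => (ip H (X w) f * ip H (X w) g)%R]%E.
Proof.
move=> Hf Hg; have [_ ->//] := S_cov Hf; congr ('E_P[_])%E.
by apply/funext => w; rewrite ipZl.
Qed.

Lemma covariance_adjoint : adjoint_op H H S S.
Proof.
split=> [|f g Hf Hg]; first exact: covariance_ips.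
rewrite [RHS]ipC//; last exact: covariance_ips.
apply: EFin_inj; rewrite !covariance_form//; congr ('E_P[_])%E.
by apply/funext => w; rewrite mulrC.
Qed.

Lemma covariance_ge0 f : ips H f -> 0 <= ip H (S f) f.
Proof.
move=> Hf; rewrite -lee_fin covariance_form//; apply: expectation_ge0 => w.
by rewrite -expr2 sqr_ge0.
Qed.

Lemma covariance_CS f g : ips H f -> ips H g ->
  ip H (S f) g ^+ 2 <= ip H (S f) f * ip H (S g) g.
Proof.
apply: (form_CS HH); [|exact: covariance_ips|exact: covariance_adjoint.2|exact: covariance_ge0].
exact: (adjoint_lin HH HH covariance_ips covariance_adjoint).
Qed.

End Covariance.

Section Compression.
Context {R : realType} {V : lmodType R} (H : ipspace V) (HH : inner_space H).
Context (M : set V) (MH : M `<=` ips H) (U : V -> V) (U_proj : orthproj H M U).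

Lemma orthproj_ip f g : ips H f -> M g -> ip H (U f) g = ip H f g.
Proof.
move=> Hf Mg; have [MUf fUf] := U_proj Hf; have HU := MH MUf; have Hg := MH Mg.
by have := fUf _ Mg; rewrite ipBl// => /eqP; rewrite subr_eq0 => /eqP ->.
Qed.

Lemma orthproj_id g : M g -> U g = g.
Proof.
move=> Mg; have Hg := MH Mg; have [MUg gUg] := U_proj Hg; have HU := MH MUg.
apply/esym/eqP; rewrite -subr_eq0; apply/eqP/(ip_eq0 HH); first by in_ips.
have gU : ips H (g - U g) by in_ips.
by rewrite [X in ip H _ X = _](_ : _ = g - U g)// ipBr// !gUg ?subrr.
Qed.

Context (S : V -> V) (SH : forall f, ips H f -> ips H (S f)) (S_adj : adjoint_op H H S S).
Local Notation SU := (U \o S \o U).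
Local Notation K := (restrict_ip H M).

Lemma compression_ips f : M f -> M (SU f).
Proof.
move=> Mf /=; have [MUf _] := U_proj (MH Mf).
by have [] := U_proj (SH (MH MUf)).
Qed.

Lemma compression_ip f g : M f -> M g -> ip H (SU f) g = ip H (S f) g.
Proof.
by move=> Mf Mg /=; rewrite (orthproj_id Mf) orthproj_ip//; exact/SH/MH.
Qed.

Lemma compression_adjoint : adjoint_op K K SU SU.
Proof.
split=> [g|f g Mf Mg] /=; first exact: compression_ips.
rewrite -/(ip H ((U \o S \o U) f) g) compression_ip// S_adj.2//; try exact: MH.
rewrite ipC//; [|exact: MH|exact/SH/MH].
rewrite -compression_ip// ipC//; [exact/MH/compression_ips|exact: MH].
Qed.

(* Whitening: x_j / sqrt lam_j are the coefficients of a vector on which the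
   covariance form is sum_j x_j^2. *)
Lemma compression_whiten J phi lam (x : nat -> R) n u : inner_space K ->
  orthonormal_on K J phi -> (forall j, J j -> 0 < lam j) ->
  (forall j, J j -> SU (phi j) = lam j *: phi j) ->
  u = \sum_(0 <= j < n | j \in J) (x j / Num.sqrt (lam j)) *: phi j ->
  ip H (S u) u = \sum_(0 <= j < n | j \in J) x j ^+ 2.
Proof.
move=> HK po l0 Sphi uE; have Mphi j : J j -> M (phi j) by exact: po.1.
have Mu : M u by rewrite uE; apply: (ips_ons HK po) => j /set_mem.
have S_lin := adjoint_lin HK HK compression_ips compression_adjoint.
rewrite -compression_ip// -[LHS]/(ip K (SU u) u) uE (linear_on_sum HK _ _ S_lin); last first.
  by move=> j /set_mem/Mphi.
rewrite (eq_bigr (fun j => (x j * Num.sqrt (lam j)) *: phi j)); last first.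
  move=> j /set_mem Jj; rewrite Sphi// scalerA; congr (_ *: _).
  have lj := l0 _ Jj; set r := Num.sqrt (lam j).
  have -> : lam j = r * r by rewrite -expr2 sqr_sqrtr// ltW.
  by field; rewrite gt_eqF// sqrtr_gt0.
have In j : j \in J -> J j by move/set_mem.
rewrite (ons_ip_sums HK po) ?iota_uniq//; apply: eq_bigr => j /In Jj.
by field; rewrite gt_eqF// sqrtr_gt0 l0.
Qed.

End Compression.

(** Abstracted from L^2, which enters through the inner product axioms and Cauchy completeness. The
    subspaces, the spaces H(K_i) and the operators all live on the same ambient [V]. *)
Theorem Hilbert_space_convergence (R : realType) (V : lmodType R)
  (H : ipspace V) (HH : inner_space H) (Hall : forall f, ips H f)
  (Hc : cauchy_complete H)
  (d : measure_display) (Omega : measurableType d) (Pr : probability Omega R)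
  (X : Omega -> V) (S : V -> V) (S_cov : covariance_op Pr H X S)
  (M1 M2 : set V)
  (M1_closed : closed_subspace H M1) (M2_closed : closed_subspace H M2)
  (H1 H2 : ipspace V)
  (H1E : H1 = restrict_ip H M1) (H2E : H2 = restrict_ip H M2)
  (U1 U2 : V -> V)
  (U1_proj : orthproj H M1 U1) (U2_proj : orthproj H M2 U2)
  (S1 S2 S12 : V -> V)
  (S1E : S1 = U1 \o S \o U1) (S2E : S2 = U2 \o S \o U2)
  (S12E : S12 = U1 \o S \o U2)
  (J1 J2 : set nat) (phi1 phi2 : nat -> V) (lam1 lam2 : nat -> R)
  (S1_eig : eigenbasis H1 S1 J1 phi1 lam1)
  (S2_eig : eigenbasis H2 S2 J2 phi2 lam2)
  (gamma : nat -> nat -> R)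
  (gammaE : forall j k, J1 j -> J2 k -> (gamma j k)%:E =
     'E_Pr[fun w => (ip H (U1 (X w)) (phi1 j) * ip H (U2 (X w)) (phi2 k))%R]%E)
  (S1half S2half : V -> V)
  (S1halfP : sqrt_op H1 S1 S1half) (S2halfP : sqrt_op H2 S2 S2half)
  (HK1 HK2 : ipspace V)
  (HK1E : HK1 = rkhs H1 S1half J1 phi1 lam1)
  (HK2E : HK2 = rkhs H2 S2half J2 phi2 lam2)
  (G1 G2 G2inv : V -> V)
  (G1P : Gamma_op H1 J1 phi1 lam1 G1) (G2P : Gamma_op H2 J2 phi2 lam2 G2)
  (G2invP : inverse_op H2 HK2 G2 G2inv)
  (C : V -> V) (C_bounded : bounded_linear H2 H1 C)
  (CP : forall j k, J1 j -> J2 k ->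
     ip H (C (phi2 k)) (phi1 j) = gamma j k / Num.sqrt (lam1 j * lam2 k))
  (T Tadj : V -> V) (TE : T = G1 \o C \o G2inv)
  (TadjP : adjoint_op HK2 HK1 T Tadj)
  (T_svd : exists sigma g f, svd HK2 HK1 T sigma g f)
  (R1 R2 : R -> V -> V)
  (R1P : forall a : R, 0 < a -> invsqrt_op H1 (fun f => S1 f + a *: f) (R1 a))
  (R2P : forall a : R, 0 < a -> invsqrt_op H2 (fun f => S2 f + a *: f) (R2 a))
  (Ta Taadj : R -> V -> V)
  (TaE : forall a, Ta a = G1 \o R1 a \o S12 \o R2 a \o G2inv)
  (TaadjP : forall a : R, 0 < a -> adjoint_op HK2 HK1 (Ta a) (Taadj a))
  (rho2 : nat -> R) (rho2E : forall k, rho2 k = eigval HK1 (T \o Tadj) k)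
  (rho2a : R -> nat -> R)
  (rho2aE : forall a k, rho2a a k = eigval HK1 (Ta a \o Taadj a) k) :
  (forall k,
     [/\ forall a b : R, 0 < a -> a <= b ->
            0 <= rho2a b k /\ rho2a b k <= rho2a a k <= rho2 k,
         rho2a a k @[a --> (0 : R)^'+] --> rho2 k &
         rho2 k <= 1])
  /\
  (forall k (Pa : R -> V -> V) (P : V -> V),
     (forall a : R, 0 < a ->
        orthproj HK1 (eigenspace_op HK1 (Ta a \o Taadj a) (rho2a a k)) (Pa a)) ->
     orthproj HK1 (eigenspace_op HK1 (T \o Tadj) (rho2 k)) P ->
     forall J e, orthonormal_basis HK1 J e ->
       (forall a : R, 0 < a -> (opnorm HK1 (Pa a \- P)%R <= hsnorm HK1 J e (Pa a \- P)%R)%E)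
       /\
       ((\forall a \near (0 : R)^'+, forall j, rho2 j = rho2 k -> rho2a a j = rho2a a k) ->
        hsnorm HK1 J e (Pa a \- P) @[a --> (0 : R)^'+] --> 0%E))
  /\
  (forall k (Pa : R -> V -> V) (P : V -> V),
     (forall a : R, 0 < a ->
        orthproj HK1 (eigenspace_sum HK1 (Ta a \o Taadj a) (rho2a a)
                        [set j | rho2 j = rho2 k]) (Pa a)) ->
     orthproj HK1 (eigenspace_op HK1 (T \o Tadj) (rho2 k)) P ->
     forall J e, orthonormal_basis HK1 J e ->
       (forall a : R, 0 < a -> (opnorm HK1 (Pa a \- P)%R <= hsnorm HK1 J e (Pa a \- P)%R)%E)
       /\
       hsnorm HK1 J e (Pa a \- P) @[a --> (0 : R)^'+] --> 0%E).
Proof.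
have HX w : ips H (X w) by [].
have SH := covariance_ips S_cov.
have S_adj := covariance_adjoint HH HX S_cov.
have M1H : M1 `<=` ips H by case: M1_closed.
have M2H : M2 `<=` ips H by case: M2_closed.
have HH1 : inner_space H1 by rewrite H1E; exact: restrict_inner_space.
have HH2 : inner_space H2 by rewrite H2E; exact: restrict_inner_space.
have [_ b1 S1phi lam1_gt0 _] := S1_eig; have [_ b2 S2phi lam2_gt0 _] := S2_eig.
have phi1M j : J1 j -> M1 (phi1 j) by have := b1.1.1; rewrite H1E; apply.
have phi2M j : J2 j -> M2 (phi2 j) by have := b2.1.1; rewrite H2E; apply.
have c1 : ell2_complete H1 J1 phi1.
  by move: b1; rewrite H1E; exact: restrict_ell2_complete.
have c2 : ell2_complete H2 J2 phi2.
  by move: b2; rewrite H2E; exact: restrict_ell2_complete.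
(* The projections disappear against vectors of their ranges, so the cross covariances are entries
   of the full covariance form. *)
have gamma_S j k : J1 j -> J2 k -> gamma j k = ip H (S (phi2 k)) (phi1 j).
  move=> Jj Jk; apply: EFin_inj; rewrite gammaE// (covariance_form HH HX S_cov)//.
  congr ('E_Pr[_])%E; apply/funext => w.
  rewrite (orthproj_ip HH M1H U1_proj)//; last exact: phi1M.
  by rewrite (orthproj_ip HH M2H U2_proj) 1?mulrC//; exact: phi2M.
have onto1 y : ips HK1 y <-> exists2 x, ips H1 x & G1 x = y.
  by rewrite HK1E; move: S1_eig S1halfP G1P; rewrite H1E => eig sq GP; exact: (rkhs_onto HH Hall M1_closed eig sq GP).
have onto2 y : ips HK2 y <-> exists2 x, ips H2 x & G2 x = y.
  by rewrite HK2E; move: S2_eig S2halfP G2P; rewrite H2E => eig sq GP; exact: (rkhs_onto HH Hall M2_closed eig sq GP).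
have iso1 f g : ips H1 f -> ips H1 g -> ip HK1 (G1 f) (G1 g) = ip H1 f g.
  by rewrite HK1E; move: S1_eig G1P; rewrite H1E => eig GP; exact: (rkhs_iso HH Hall M1_closed _ eig GP).
have iso2 f g : ips H2 f -> ips H2 g -> ip HK2 (G2 f) (G2 g) = ip H2 f g.
  by rewrite HK2E; move: S2_eig G2P; rewrite H2E => eig GP; exact: (rkhs_iso HH Hall M2_closed _ eig GP).
have lin1 : linear_on H1 G1.
  by move: S1_eig G1P; rewrite H1E => eig GP; exact: (Gamma_lin HH Hall M1_closed eig GP).
have lin2 : linear_on H2 G2.
  by move: S2_eig G2P; rewrite H2E => eig GP; exact: (Gamma_lin HH Hall M2_closed eig GP).
have HHK1 := isometric_inner_space HH1 onto1 lin1 iso1.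
have HHK2 := isometric_inner_space HH2 onto2 lin2 iso2.
have bK1 := isometric_orthonormal_basis HH1 onto1 lin1 iso1 b1.
have bK2 := isometric_orthonormal_basis HH2 onto2 lin2 iso2 b2.
have cK1 := isometric_ell2_complete onto1 iso1 b1.1 c1.
have cK2 := isometric_ell2_complete onto2 iso2 b2.1 c2.
have KG1 x : ips H1 x -> ips HK1 (G1 x) by move=> Hx; apply/onto1; exists x.
have KG2 x : ips H2 x -> ips HK2 (G2 x) by move=> Hx; apply/onto2; exists x.
have [G2invG2 G2G2inv] := G2invP.
have G2inv_ips y : ips HK2 y -> ips H2 (G2inv y) by move=> /G2G2inv[].
have G2K x : ips H2 x -> G2inv (G2 x) = x by move=> /G2invG2[].
have CH f : ips H2 f -> ips H1 (C f) by have [+ _ _] := C_bounded; apply.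
have TK f : ips HK2 f -> ips HK1 (T f).
  by move=> Kf; rewrite TE /=; exact/KG1/CH/G2inv_ips.
have H1phi j : J1 j -> ips H1 (phi1 j) by exact: b1.1.1.
have H2phi k : J2 k -> ips H2 (phi2 k) by exact: b2.1.1.
have T_coef j k : J1 j -> J2 k ->
    ip HK1 (T (G2 (phi2 k))) (G1 (phi1 j)) =
    ip H (S (phi2 k)) (phi1 j) / Num.sqrt (lam1 j * lam2 k).
  move=> Jj Jk; have Hj := H1phi _ Jj; have Hk := H2phi _ Jk.
  rewrite TE /= G2K// iso1//; last exact: CH.
  by rewrite -gamma_S// -CP// H1E.
have T1 f g : ips HK2 f -> ips HK1 g -> ip HK1 (T f) g ^+ 2 <= ip HK2 f f * ip HK1 g g.
  (* The vectors [u] and [v] are whitened: <S u, u> and <S v, v> are the sums of squares of [x] and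
     [y], while <S u, v> is the value of the form of T. Cauchy-Schwarz for the covariance is then
     the bound sought. *)
  apply: (adjoint_contraction HHK2 HHK1 bK2 bK1 TK TadjP) => m n x y.
  pose u := \sum_(0 <= k < m | k \in J2) (x k / Num.sqrt (lam2 k)) *: phi2 k.
  pose v := \sum_(0 <= j < n | j \in J1) (y j / Num.sqrt (lam1 j)) *: phi1 j.
  have uu : ip H (S u) u = \sum_(0 <= k < m | k \in J2) x k ^+ 2.
    apply: (compression_whiten HH M2H U2_proj SH S_adj (phi := phi2) (lam := lam2)) => //.
    - by rewrite -H2E.
    - by rewrite -H2E; exact: b2.1.
    - by move=> j Jj; rewrite -S2E S2phi.
  have vv : ip H (S v) v = \sum_(0 <= j < n | j \in J1) y j ^+ 2.
    apply: (compression_whiten HH M1H U1_proj SH S_adj (phi := phi1) (lam := lam1)) => //.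
    - by rewrite -H1E.
    - by rewrite -H1E; exact: b1.1.
    - by move=> j Jj; rewrite -S1E S1phi.
  rewrite -uu -vv; have := covariance_CS HH HX S_cov (Hall u) (Hall v).
  congr (_ ^+ 2 <= _).
  have T_lin := adjoint_lin HHK1 HHK2 TadjP.1 (adjoint_op_sym HHK2 HHK1 TK TadjP).
  have S_lin := adjoint_lin HH HH SH S_adj.
  rewrite (linear_on_sum HHK2 _ _ T_lin); last by move=> k /set_mem/H2phi/KG2.
  rewrite /u (linear_on_sum HH _ _ S_lin)//.
  rewrite ip_suml// [RHS]ip_suml//; last 2 first.
  - by move=> k /set_mem/H2phi/KG2/TK; in_ips.
  - by apply: ips_sum => // j /set_mem/H1phi/KG1; in_ips.
  apply: eq_bigr => k /set_mem Jk; have KTk := TK _ (KG2 _ (H2phi _ Jk)).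
  rewrite /v ip_sumr// [RHS]ip_sumr//; last 2 first.
  - by move=> j /set_mem/H1phi/KG1; in_ips.
  - by in_ips.
  apply: eq_bigr => j /set_mem Jj; have KGj := KG1 _ (H1phi _ Jj).
  rewrite ipZl// ipZr// [RHS]ipZl//; last by in_ips.
  rewrite [in RHS]ipZr// T_coef// sqrtrM ?ltW ?lam1_gt0//.
  by field; rewrite !gt_eqF ?sqrtr_gt0 ?lam1_gt0 ?lam2_gt0.
have S1_adj : adjoint_op H1 H1 S1 S1.
  by rewrite S1E H1E; exact: (compression_adjoint HH M1H U1_proj SH S_adj).
have S2_adj : adjoint_op H2 H2 S2 S2.
  by rewrite S2E H2E; exact: (compression_adjoint HH M2H U2_proj SH S_adj).
have R1_diag a (a0 : 0 < a) := invsqrt_op_diagonal HH1 a0 S1_adj.1 S1_adj (R1P _ a0) b1 lam1_gt0 S1phi.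
have R2_diag a (a0 : 0 < a) := invsqrt_op_diagonal HH2 a0 S2_adj.1 S2_adj (R2P _ a0) b2 lam2_gt0 S2phi.
have S12H f : ips H2 f -> ips H1 (S12 f).
  by move=> _; rewrite S12E H1E /=; have [] := U1_proj _ (SH _ (Hall (U2 f))).
have TaK (a : R) f : 0 < a -> ips HK2 f -> ips HK1 (Ta a f).
  move=> a0 Kf; rewrite TaE /=; apply/KG1/(diag_ips (R1_diag a a0))/S12H.
  exact/(diag_ips (R2_diag a a0))/G2inv_ips.
(* Both inverse roots are diagonal, so the entry is <S phi_2k, phi_1j> over the root of (lam_1j + a)
   (lam_2k + a); the quotient by the entry of T is the product of the two damping factors. *)
have Ta_coef (a : R) j k : 0 < a -> J1 j -> J2 k ->
    ip HK1 (Ta a (G2 (phi2 k))) (G1 (phi1 j)) =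
    tikhonov (lam1 j) a * tikhonov (lam2 k) a * ip HK1 (T (G2 (phi2 k))) (G1 (phi1 j)).
  move=> a0 Jj Jk; have Hj := H1phi _ Jj; have Hk := H2phi _ Jk.
  have Rk : R2 a (phi2 k) = Num.sqrt (lam2 k + a)^-1 *: phi2 k.
    have HR := diag_ips (R2_diag a a0) Hk.
    apply: (basis_eq HH2 b2) => //; first by in_ips.
    by move=> l Jl; rewrite (diag_coef (R2_diag a a0))// ipZl ?b2.1.2//; [case: eqP => [->|]; rewrite ?mulr0|exact: H2phi].
  have HS12 := S12H _ (diag_ips (R2_diag a a0) Hk).
  rewrite TaE /= G2K// iso1//; last exact: (diag_ips (R1_diag a a0)).
  rewrite (diag_coef (R1_diag a a0))// T_coef// S12E /=.
  have -> : ip H1 (U1 (S (U2 (R2 a (phi2 k))))) (phi1 j) =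
      Num.sqrt (lam2 k + a)^-1 * ip H (S (phi2 k)) (phi1 j).
    rewrite H1E -[LHS]/(ip H (U1 _) _) (orthproj_ip HH M1H U1_proj)//; last exact: phi1M.
    have U2R : U2 (R2 a (phi2 k)) = R2 a (phi2 k).
      apply: (orthproj_id HH M2H U2_proj).
      by have := diag_ips (R2_diag a a0) Hk; rewrite H2E.
    rewrite U2R Rk (linear_onZ HH)//; last exact: (adjoint_lin HH HH SH S_adj).
    by rewrite ipZl.
  have l1 := lam1_gt0 _ Jj; have l2 := lam2_gt0 _ Jk.
  have l1a : 0 < lam1 j + a by rewrite addr_gt0.
  have l2a : 0 < lam2 k + a by rewrite addr_gt0.
  rewrite /tikhonov !sqrtrM ?(ltW l1) ?(ltW l2)// !sqrtrV ?(ltW l1a) ?(ltW l2a)//.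
  by field; rewrite !gt_eqF ?sqrtr_gt0.
have [sigma [g [f T_svdP]]] := T_svd.
pose B := T \o Tadj; pose Ba a := Ta a \o Taadj a.
have HB : pos_contraction HK1 B := TTadj_pc HHK1 HHK2 TK TadjP T1.
have cB : compact_form HK1 B := TTadj_compact HHK1 HHK2 TK TadjP T_svdP.
have HBa a : 0 < a -> pos_contraction HK1 (Ba a).
  exact: (TaTaadj_pc HHK1 HHK2 bK1 bK2 cK1 cK2 lam1_gt0 lam2_gt0 TK TadjP T1 TaK TaadjP Ta_coef).
have cBa a : 0 < a -> compact_form HK1 (Ba a).
  exact: (TaTaadj_compact HHK1 HHK2 bK1 bK2 cK1 cK2 lam1_gt0 lam2_gt0 TK TadjP T_svdP TaK TaadjP Ta_coef).
have Ba_le a k : 0 < a -> eigval HK1 (Ba a) k <= eigval HK1 B k.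
  exact: (eigval_Ta_le HHK1 HHK2 bK1 bK2 cK1 cK2 lam1_gt0 lam2_gt0 TK TadjP T1 T_svdP TaK TaadjP Ta_coef).
have Ba_nonincr a b k : 0 < a -> a <= b -> eigval HK1 (Ba b) k <= eigval HK1 (Ba a) k.
  exact: (eigval_Ta_nonincr HHK1 HHK2 bK1 bK2 cK1 cK2 lam1_gt0 lam2_gt0 TK TadjP T1 T_svdP TaK TaadjP Ta_coef).
have Ba_cvg x : ips HK1 x -> ipnorm HK1 (Ba a x - B x) @[a --> (0:R)^'+] --> 0.
  exact: (TaTaadj_cvg HHK1 HHK2 bK1 bK2 cK1 cK2 lam1_gt0 lam2_gt0 TK TadjP T1 TaK TaadjP Ta_coef).
have rho2B k : rho2 k = eigval HK1 B k := rho2E k.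
have rho2Ba a : rho2a a = eigval HK1 (Ba a) by apply/funext => k; exact: rho2aE.
split; [|split].
- move=> k; split.
  + move=> a b a0 ab; have b0 := lt_le_trans a0 ab; rewrite !rho2Ba rho2B.
    by rewrite (eigval_ge0 HHK1 (HBa b b0)) Ba_nonincr// Ba_le.
  + under eq_cvg do rewrite rho2Ba.
    rewrite rho2B; exact: (eigval_cvg HHK1 bK1 cK1 HB cB HBa cBa Ba_le Ba_cvg).
  + by rewrite rho2B (eigval_le1 HHK1 HB).
- move=> k Pa P PaP PP J e Ke; split=> [a a0|].
    apply: (opnorm_sub_orthproj HHK1 Ke _ _ (PaP a a0) PP); exact: eigenspace_op_sub.
  move=> split_free.
  apply: (eigenprojection_cvg HHK1 bK1 cK1 HB cB HBa cBa Ba_le Ba_cvg Ke (k := k)).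
  + by move=> a a0; rewrite -rho2Ba; exact: PaP.
  + by rewrite -rho2B.
  + apply: filterS split_free => a rho2a_k j; rewrite -!rho2B -!rho2Ba; exact: rho2a_k.
- move=> k Pa P PaP PP J e Ke; split=> [a a0|].
    apply: (opnorm_sub_orthproj HHK1 Ke _ _ (PaP a a0) PP).
      exact: (eigenspace_sum_sub HHK1).
    exact: eigenspace_op_sub.
  apply: (eigenprojection_sum_cvg HHK1 bK1 cK1 HB cB HBa cBa Ba_le Ba_cvg Ke (k := k)).
  + move=> a a0; have := PaP a a0; rewrite rho2Ba.
    by under [[set j | _]]eq_set => j do rewrite !rho2B.
  + by rewrite -rho2B.
Qed.

Theorem theorem5p1 (R : realType)
  (* H = L^2(E, nu) *)
  (E : set (measurableTypeR R)) (mE : measurable E)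
  (nu : {measure set (measurableTypeR R) -> \bar R})
  (nu_sfinite : sigma_finite E nu)
  (H : ipspace (L2on nu mE)) (HE : H = L2space (mrestr nu mE))
  (* the random element X and its covariance operator S *)
  (d : measure_display) (Omega : measurableType d) (Pr : probability Omega R)
  (X : Omega -> L2on nu mE) (X_re : random_element H X)
  (X_centered : mean_element Pr H X 0)
  (X_4 : ('E_Pr[fun w => (ipnorm H (X w) ^+ 4)%R] < +oo)%E)
  (S : L2on nu mE -> L2on nu mE) (S_cov : covariance_op Pr H X S)
  (* the decomposition H = H1 (+) H2 with projections U1, U2 *)
  (M1 M2 : set (L2on nu mE))
  (M1_closed : closed_subspace H M1) (M2_closed : closed_subspace H M2)
  (M12_orth : forall f g, M1 f -> M2 g -> ip H f g = 0)
  (M12_sum : forall h, ips H h -> exists f g, [/\ M1 f, M2 g & h = f + g])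
  (H1 H2 : ipspace (L2on nu mE))
  (H1E : H1 = restrict_ip H M1) (H2E : H2 = restrict_ip H M2)
  (U1 U2 : L2on nu mE -> L2on nu mE)
  (U1_proj : orthproj H M1 U1) (U2_proj : orthproj H M2 U2)
  (S1 S2 S12 : L2on nu mE -> L2on nu mE)
  (S1E : S1 = U1 \o S \o U1) (S2E : S2 = U2 \o S \o U2)
  (S12E : S12 = U1 \o S \o U2)
  (S1_inj : forall f, ips H1 f -> S1 f = 0 -> f = 0)
  (S2_inj : forall f, ips H2 f -> S2 f = 0 -> f = 0)
  (J1 J2 : set nat) (phi1 phi2 : nat -> L2on nu mE) (lam1 lam2 : nat -> R)
  (S1_eig : eigenbasis H1 S1 J1 phi1 lam1)
  (S2_eig : eigenbasis H2 S2 J2 phi2 lam2)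
  (gamma : nat -> nat -> R)
  (gammaE : forall j k, J1 j -> J2 k -> (gamma j k)%:E =
     'E_Pr[fun w => (ip H (U1 (X w)) (phi1 j) * ip H (U2 (X w)) (phi2 k))%R]%E)
  (* the spaces H(K1), H(K2) and the unitary maps G1, G2 *)
  (S1half S2half : L2on nu mE -> L2on nu mE)
  (S1halfP : sqrt_op H1 S1 S1half) (S2halfP : sqrt_op H2 S2 S2half)
  (HK1 HK2 : ipspace (L2on nu mE))
  (HK1E : HK1 = rkhs H1 S1half J1 phi1 lam1)
  (HK2E : HK2 = rkhs H2 S2half J2 phi2 lam2)
  (G1 G2 G2inv : L2on nu mE -> L2on nu mE)
  (G1P : Gamma_op H1 J1 phi1 lam1 G1) (G2P : Gamma_op H2 J2 phi2 lam2 G2)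
  (G2invP : inverse_op H2 HK2 G2 G2inv)
  (* the operators C and T, the latter with a singular value decomposition *)
  (C : L2on nu mE -> L2on nu mE) (C_bounded : bounded_linear H2 H1 C)
  (CP : forall j k, J1 j -> J2 k ->
     ip H (C (phi2 k)) (phi1 j) = gamma j k / Num.sqrt (lam1 j * lam2 k))
  (T Tadj : L2on nu mE -> L2on nu mE) (TE : T = G1 \o C \o G2inv)
  (TadjP : adjoint_op HK2 HK1 T Tadj)
  (T_svd : exists sigma g f, svd HK2 HK1 T sigma g f)
  (* R_i a = (S_i + a I)^{-1/2} and Ta a = T(a) *)
  (R1 R2 : R -> L2on nu mE -> L2on nu mE)
  (R1P : forall a : R, 0 < a -> invsqrt_op H1 (fun f => S1 f + a *: f) (R1 a))
  (R2P : forall a : R, 0 < a -> invsqrt_op H2 (fun f => S2 f + a *: f) (R2 a))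
  (Ta Taadj : R -> L2on nu mE -> L2on nu mE)
  (TaE : forall a, Ta a = G1 \o R1 a \o S12 \o R2 a \o G2inv)
  (TaadjP : forall a : R, 0 < a -> adjoint_op HK2 HK1 (Ta a) (Taadj a))
  (* eigenvalues, counted from k = 0 *)
  (rho2 : nat -> R) (rho2E : forall k, rho2 k = eigval HK1 (T \o Tadj) k)
  (rho2a : R -> nat -> R)
  (rho2aE : forall a k, rho2a a k = eigval HK1 (Ta a \o Taadj a) k) :
  (forall k,
     [/\ forall a b : R, 0 < a -> a <= b ->
            0 <= rho2a b k /\ rho2a b k <= rho2a a k <= rho2 k,
         rho2a a k @[a --> (0 : R)^'+] --> rho2 k &
         rho2 k <= 1])
  /\
  (* Eigenprojections for rho2a a k and rho2 k. The condition for convergence says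
     that the eigenvalue does not split; it is void if rho2 k is simple. *)
  (forall k (Pa : R -> L2on nu mE -> L2on nu mE) (P : L2on nu mE -> L2on nu mE),
     (forall a : R, 0 < a ->
        orthproj HK1 (eigenspace_op HK1 (Ta a \o Taadj a) (rho2a a k)) (Pa a)) ->
     orthproj HK1 (eigenspace_op HK1 (T \o Tadj) (rho2 k)) P ->
     forall J e, orthonormal_basis HK1 J e ->
       (forall a : R, 0 < a -> (opnorm HK1 (Pa a \- P)%R <= hsnorm HK1 J e (Pa a \- P)%R)%E)
       /\
       ((\forall a \near (0 : R)^'+, forall j, rho2 j = rho2 k -> rho2a a j = rho2a a k) ->
        hsnorm HK1 J e (Pa a \- P) @[a --> (0 : R)^'+] --> 0%E))
  /\
  (* The same, without condition, when Pa a is the projection onto the sum of the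
     eigenspaces for all the rho2a a j with rho2 j = rho2 k. *)
  (forall k (Pa : R -> L2on nu mE -> L2on nu mE) (P : L2on nu mE -> L2on nu mE),
     (forall a : R, 0 < a ->
        orthproj HK1 (eigenspace_sum HK1 (Ta a \o Taadj a) (rho2a a)
                        [set j | rho2 j = rho2 k]) (Pa a)) ->
     orthproj HK1 (eigenspace_op HK1 (T \o Tadj) (rho2 k)) P ->
     forall J e, orthonormal_basis HK1 J e ->
       (forall a : R, 0 < a -> (opnorm HK1 (Pa a \- P)%R <= hsnorm HK1 J e (Pa a \- P)%R)%E)
       /\
       hsnorm HK1 J e (Pa a \- P) @[a --> (0 : R)^'+] --> 0%E).
Proof.
have HH : inner_space H by rewrite HE; exact: L2_inner_space.
have Hall f : ips H f by rewrite HE.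
have Hc : cauchy_complete H.
  by rewrite HE => u _ /L2_complete[f uf]; exists f.
exact: (Hilbert_space_convergence HH Hall Hc S_cov M1_closed M2_closed H1E H2E
  U1_proj U2_proj S1E S2E S12E S1_eig S2_eig gammaE
  S1halfP S2halfP HK1E HK2E G1P G2P G2invP C_bounded CP TE TadjP T_svd R1P R2P TaE TaadjP
  rho2E rho2aE).
Qed.
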